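(* Let $f$ be a smooth probability density on $\mathbb{R}^n$ with respect to $\gamma$ and let $d\mu=f\,d\gamma$. Assume that $\mu$ has barycenter $b$ and covariance matrix $\Gamma\le\mathrm{Id}$ (in the sense of symmetric matrices). Then $$\delta(f)\;\ge\;\frac14\,\widetilde{\mathcal{D}}(\mu_b,\gamma)^4.$$
   Context: $\gamma$ is the standard Gaussian measure on $\mathbb{R}^n$. $\mathrm{H}(g)=\int g\log g\,d\gamma$, $\mathrm{I}(g)=\int\frac{|\nabla g|^2}{g}d\gamma$, $\delta(g)=\frac12\mathrm{I}(g)-\mathrm{H}(g)$. $f_b(x)=f(x+b)e^{-(b\cdot x+|b|^2/2)}$ and $d\mu_b=f_b\,d\gamma$. The Ornstein–Uhlenbeck semigroup is $P_tg(x)=\int g(e^{-t}x+\sqrt{1-e^{-2t}}\,y)\,d\gamma(y)$. For a probability $\nu=g\,d\gamma$ with finite second moment, $\widetilde{\mathcal{D}}(\nu,\gamma)=\sup_{\varphi}\left|\int[x\varphi-\nabla\varphi]\,d\nu\right|$ (Euclidean norm), the supremum over $\varphi=4\int_0^\infty e^{-4t}P_t\psi\,dt$ with $\psi:\mathbb{R}^n\to\mathbb{R}$ smooth ($C^1$) such that $\int\psi^2\,P_tg\,d\gamma\le1$ for every $t\ge0$ (here $g=f_b$). *)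

(* Defs.v *)
From HB Require Import structures.
From mathcomp Require Import all_boot all_order all_algebra.
From mathcomp Require Import all_classical all_reals all_analysis.

Set Implicit Arguments.
Unset Strict Implicit.
Unset Printing Implicit Defensive.

Import Order.TTheory GRing.Theory Num.Theory.
Import numFieldNormedType.Exports.

Local Open Scope classical_set_scope.
Local Open Scope ring_scope.

(* R^n is 'rV[R]_n.  Its sigma-algebra: the one generated by the      *)
(* coordinate maps x |-> x 0 i (= Borel sigma-algebra of R^n).         *)

Definition rV_coord (R : realType) (n : nat) (i : 'I_n) (x : 'rV[R]_n) : R :=
  x 0 i.

Section rV_measurable.
Context {R : realType} {n : nat}.

Let rV_set0 : g_sigma_preimage (@rV_coord R n) set0.
Proof. exact: sigma_algebra0. Qed.

Let rV_setC A : g_sigma_preimage (@rV_coord R n) A ->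
  g_sigma_preimage (@rV_coord R n) (~` A).
Proof. exact: sigma_algebraC. Qed.

Let rV_bigcup (F : _^nat) : (forall i, g_sigma_preimage (@rV_coord R n) (F i)) ->
  g_sigma_preimage (@rV_coord R n) (\bigcup_i (F i)).
Proof. exact: sigma_algebra_bigcup. Qed.

HB.instance Definition _ :=
  @isMeasurable.Build (measure_tuple_display default_measure_display)
  'rV[R]_n (g_sigma_preimage (@rV_coord R n)) rV_set0 rV_setC rV_bigcup.

End rV_measurable.

Section gaussian_defs.
Context {R : realType} {n : nat}.
Local Notation V := 'rV[R]_n.

(* standard Gaussian measure on R^n: the product of n standard normal
   laws N(0,1), characterised on measurable boxes (this determines the
   measure uniquely). *)
Definition std_gaussian (gamma : probability V R) : Prop :=
  forall A : 'I_n -> set R, (forall i, measurable (A i)) ->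
    gamma [set x : V | forall i, A i (x 0 i)] =
    (\prod_(i < n) fine (normal_prob 0 1 (A i)))%:E.

Definition dotv (x y : V) : R := \sum_(i < n) x 0 i * y 0 i.
Definition enorm (x : V) : R := Num.sqrt (dotv x x).

Definition evec (i : 'I_n) : V := delta_mx 0 i.

Definition grad (g : V -> R) (x : V) : V := \row_i derive g x (evec i).

Fixpoint iderive (vs : seq V) (g : V -> R) : V -> R :=
  match vs with
  | [::] => g
  | v :: vs' => fun x => derive (iderive vs' g) x v
  end.

Definition smooth (g : V -> R) : Prop :=
  forall vs : seq V, continuous (iderive vs g) /\
    (forall x v, derivable (iderive vs g) x v).

Definition C1 (g : V -> R) : Prop :=
  continuous g /\ (forall x v, derivable g x v) /\
  (forall v, continuous (fun x => derive g x v)).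

Definition entropy (gamma : probability V R) (g : V -> R) : \bar R :=
  (\int[gamma]_x (g x * ln (g x))%:E)%E.

Definition fisher (gamma : probability V R) (g : V -> R) : \bar R :=
  (\int[gamma]_x (dotv (grad g x) (grad g x) / g x)%:E)%E.

Definition deficit (gamma : probability V R) (g : V -> R) : \bar R :=
  if fisher gamma g == +oo%E then +oo%E
  else ((2^-1)%:E * fisher gamma g - entropy gamma g)%E.

Definition fshift (f : V -> R) (b : V) : V -> R :=
  fun x => f (x + b) * expR (- (dotv b x + dotv b b / 2)).

Definition OU (gamma : probability V R) (t : R) (g : V -> R) : V -> R :=
  fun x => Rintegral gamma setT
    (fun y => g (expR (- t) *: x + Num.sqrt (1 - expR (- (2 * t))) *: y)).

Definition phi_of (gamma : probability V R) (psi : V -> R) : V -> R :=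
  fun x => 4 * Rintegral lebesgue_measure [set t : R | 0 <= t]
    (fun t => expR (- (4 * t)) * OU gamma t psi x).

Definition admissible (gamma : probability V R) (g : V -> R) (psi : V -> R)
  : Prop :=
  C1 psi /\ forall t : R, 0 <= t ->
    (\int[gamma]_x (psi x ^+ 2 * OU gamma t g x)%:E <= 1)%E.

Definition stein_vec (gamma : probability V R) (g : V -> R) (phi : V -> R)
  : V :=
  \row_i Rintegral gamma setT
    (fun x => (x 0 i * phi x - derive phi x (evec i)) * g x).

Definition Dtilde (gamma : probability V R) (g : V -> R) : \bar R :=
  ereal_sup [set (enorm (stein_vec gamma g (phi_of gamma psi)))%:E
            | psi in admissible gamma g].

Definition loewner_le (A B : 'M[R]_n) : Prop :=
  forall v : V, (v *m A *m v^T) 0 0 <= (v *m B *m v^T) 0 0.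

End gaussian_defs.

(* Main.v *)
(* Put [g = f_b]. By the Cameron-Martin formula, passing from [f] to [g] lowers
   the entropy by [|b|^2 / 2] and the Fisher information by at least [|b|^2], so
   the deficit does not increase; the law of [g] is centred with covariance at
   most the identity. Let [v] be the Stein vector at [phi], [u] its direction and
   [j] the Fisher information of [g] in direction [u].

   Integrating by parts, [v] is the integral of [phi grad g]; rotating
   [gamma \x gamma] turns [|v|] into a time average of the integrals of
   [psi x * score (c x + s y) * g (c x + s y)], with [c = e^-t] and
   [s^2 = 1 - c^2]. Gaussian integration by parts in [y] allows the score to be
   replaced by any combination [k * score + (1 - k) * (u . y) / s]; the best [k]
   is [1 / (1 + s^2 j)], and the covariance bound then gives the weight
   [p t = j / (1 + (1 - e^(-2t)) j)]. By Cauchy-Schwarz and Jensen,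
   [|v|^4 <= int_0^oo 4 e^(-4t) (p t)^2 dt = 2 (j - ln (1 + j))].

   The same replacement in the direction [u], used in the dissipation of entropy
   along the rotations, improves the logarithmic Sobolev inequality to
   [H g <= (I g - j) / 2 + ln (1 + j) / 2], that is
   [delta g >= (j - ln (1 + j)) / 2]. *)
Require Import Defs.
From HB Require Import structures.
From mathcomp Require Import all_boot all_order all_algebra.
From mathcomp Require Import all_classical all_reals all_analysis.
From mathcomp Require Import measurable_realfun.
From mathcomp Require Import ring lra.

Import Order.TTheory GRing.Theory Num.Theory.
Import numFieldNormedType.Exports.

Local Open Scope classical_set_scope.
Local Open Scope ring_scope.
Set Implicit Arguments.
Unset Strict Implicit.
Unset Printing Implicit Defensive.

(** The two estimates meet in one number, the Fisher information [j] of [g] in the direction of the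
    Stein vector: |v|^4 <= 2 (j - ln (1 + j)) <= 4 delta. That direction changes with the test
    function, but the second inequality holds for every unit vector. Lack of regularity shapes the
    rest. The density may vanish and its gradient may be unbounded, so the entropy dissipation is
    computed only for 1/r + g (1 - |x|^2/r)_+^2, with an error [eta] that accounts for its mass and
    second moment, and r tends to infinity by Fatou's lemma. The test function psi is C^1 without
    growth condition: letting t tend to infinity in the admissibility condition puts it in
    L^2(gamma), and every derivative of phi is then taken on the Gaussian kernel instead of psi. The
    price is a factor c/s, which behaves like (2t)^(-1/2) at 0 and is therefore integrable in time.
    Finally, admissibility does not make the Stein integrand integrable; a coordinate of [v] where
    this fails is 0 by convention, and the direction [u] then has a zero coordinate there too. *)

(** * Measurability of maps into R^n for the coordinate sigma-algebra *)

Section rV_measurability.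
Context {R : realType} {n : nat}.
Local Notation V := 'rV[R]_n.

Lemma rV_preimageE : @g_sigma_preimage _ _ V n (@rV_coord R n) =
  <<s \bigcup_i preimage_set_system setT (@rV_coord R n i) measurable >>.
Proof.
rewrite /g_sigma_preimage -bigcup_seq; congr (<<s _ >>).
by apply/seteqP; split => A [i _ Ai]; exists i => //=; rewrite mem_index_enum.
Qed.

Lemma measurable_coord (i : 'I_n) : measurable_fun setT (fun x : V => x 0 i).
Proof.
move=> _ A mA; rewrite setTI /measurable /=.
rewrite rV_preimageE; apply: sub_sigma_algebra; exists i => //.
by exists A => //; rewrite setTI.
Qed.

Lemma measurable_rVP d (T : measurableType d) (F : T -> V) :
  (forall i, measurable_fun setT (fun t => F t 0 i)) -> measurable_fun setT F.
Proof.
move=> mF.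
have : preimage_set_system setT F (@g_sigma_preimage _ _ V n (@rV_coord R n))
    `<=` measurable.
  rewrite rV_preimageE -g_sigma_preimageE.
  apply: smallest_sub; first exact: sigma_algebra_measurable.
  move=> A [B [i _ [C mC <-] <-]]; rewrite !setTI.
  by have := mF i measurableT C mC; rewrite setTI.
by move=> mFm _ A mA; apply: mFm; exists A.
Qed.

End rV_measurability.

(** * Open sets and continuous functions on R^n *)

Section rV_borel.
Context {R : realType} {n : nat}.
Local Notation V := 'rV[R]_n.

Lemma rV_ballP (x y : V) (e : R) : 0 < e ->
  ball x e y <-> forall i, `|x 0 i - y 0 i| < e.
Proof.
move=> e0; split => [[_ h] i|h]; first exact: h.
by split => // i j; rewrite ord1; exact: h.
Qed.

(** The sup-norm cubes with rational centre and radius 1/(k+1) are countably many, and an open set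
    is the union of those it contains. *)
Lemma open_measurable_rV (U : set V) : open U -> measurable U.
Proof.
move=> oU.
pose B (p : 'rV[rat]_n * nat) : set V :=
  [set x | forall i, `|x 0 i - ratr (p.1 0 i)| < p.2.+1%:R^-1].
(* Cubes that leave [U] are replaced by the empty set, so that the union runs over a whole countable
   type. *)
pose F p := if pselect (B p `<=` U) then B p else set0.
have -> : U = \bigcup_p F p.
  apply/seteqP; split => [x Ux|x [p _]]; last first.
    by rewrite /F; case: pselect => // h; exact: h.
  have /nbhs_ballP[e /= e0 xe] : nbhs x U by exact: open_nbhs_nbhs.
  pose k := Num.truncn (2 / e).
  (* Half of [e]: a point of the cube is within [e / 2] of the rational centre, which is itself
     within [e / 2] of [x]. *)
  have ke : k.+1%:R^-1 < e / 2.
    rewrite invf_plt ?posrE ?divr_gt0// invf_div.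
    exact: truncnS_gt.
  have q i : exists q : rat, `|x 0 i - ratr q| < k.+1%:R^-1.
    have [q] : exists q : rat, ratr q \in `](x 0 i - k.+1%:R^-1), (x 0 i + k.+1%:R^-1)[.
      by apply: rat_in_itvoo; rewrite ltrD2l gtrN ?invr_gt0.
    rewrite in_itv/= => /andP[q1 q2]; exists q.
    by rewrite ltr_distlC q1.
  pose Q := \row_i xchoose (q i).
  have xQ : B (Q, k) x.
    by move=> i; rewrite /= mxE; exact: (xchooseP (q i)).
  exists (Q, k) => //; rewrite /F; case: pselect => //; case.
  move=> y yQ; apply: xe; apply/rV_ballP => // i.
  rewrite -(subrK (ratr (Q 0 i)) (x 0 i)) -addrA (le_lt_trans (ler_normD _ _))//.
  rewrite (splitr e) ltrD//; apply: lt_trans ke; first exact: xQ.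
  by rewrite distrC; exact: yQ.
apply: countable_bigcupT_measurable => [|p]; first exact: countableP.
suff mB : measurable (B p) by rewrite /F; case: ifP.
rewrite (_ : B p = \bigcap_(i in [set: 'I_n])
    ((fun x : V => x 0 i) @^-1` ball (ratr (p.1 0 i) : R) p.2.+1%:R^-1)).
  apply: fin_bigcap_measurable => // i _; rewrite -[X in measurable X]setTI.
  by apply: measurable_coord => //; exact: measurable_ball.
apply/seteqP; split => [x Bx i _|x Bx i].
  by have := Bx i; rewrite distrC.
by have := Bx i Logic.I; rewrite /preimage /= distrC.
Qed.

Lemma continuous_measurable_rV (f : V -> R) :
  continuous f -> measurable_fun setT f.
Proof.
move=> cf; apply: (measurability _ (RGenOpens.measurableE R)).
move=> _ [_ [a [b ->] <-]]; rewrite setTI; apply: open_measurable_rV.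
by move/continuousP : cf; apply; exact: interval_open.
Qed.

End rV_borel.

(** * Integration against a measure with a density *)

Section density.
Context d (T : measurableType d) (R : realType).
Variables (m1 m2 : {measure set T -> \bar R}) (k : T -> R).
Hypotheses (mk : measurable_fun setT k) (k0 : forall x, 0 <= k x)
  (m1E : forall A, measurable A -> m1 A = (\int[m2]_(x in A) (k x)%:E)%E).
Import HBNNSimple.
Local Open Scope ereal_scope.

(** Both sides are monotone limits along the simple functions [u n] that increase to [h]; for a
    simple function the claim reduces to the hypothesis on its level sets. *)
Lemma ge0_integral_density (h : T -> \bar R) : measurable_fun setT h ->
  (forall x, 0 <= h x) -> \int[m1]_x h x = \int[m2]_x (h x * (k x)%:E).
Proof.
move=> mh h0.
have mkE : measurable_fun setT (fun x => (k x)%:E) by exact/measurable_EFinP.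
pose u := nnsfun_approx measurableT mh.
have hE x : h x = limn (fun n => (u n x)%:E).
  by apply/esym/cvg_lim => //; exact: cvg_nnsfun_approx.
transitivity (limn (fun n => \int[m1]_x (u n x)%:E)).
  rewrite -monotone_convergence//=.
  - by apply: eq_integral => x _.
  - by move=> n; exact/measurable_EFinP.
  - by move=> n x _; rewrite lee_fin.
  - by move=> x _ a b ab; rewrite lee_fin; exact/lefP/nd_nnsfun_approx.
transitivity (limn (fun n => \int[m2]_x ((u n x)%:E * (k x)%:E))); last first.
  rewrite -monotone_convergence//=.
  - apply: eq_integral => x _; apply/cvg_lim => //; apply: cvgeZr => //.
    exact: cvg_nnsfun_approx.
  - by move=> n; apply: emeasurable_funM => //; exact/measurable_EFinP.
  - by move=> n x _; rewrite mule_ge0// lee_fin.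
  - move=> x _ a b ab; rewrite lee_wpmul2r ?lee_fin//.
    exact/lefP/nd_nnsfun_approx.
apply: congr_lim; apply/funext => n.
under eq_integral do rewrite fimfunE -fsumEFin//.
under [RHS]eq_integral do rewrite fimfunE -fsumEFin//.
rewrite ge0_integral_fsum//; last 2 first.
- by move=> r; apply/measurable_EFinP/measurable_funM.
- by move=> r x _; exact: nnfun_muleindic_ge0.
under [RHS]eq_integral => x _.
  rewrite ge0_mule_fsuml; last by move=> r; exact: nnfun_muleindic_ge0.
  over.
rewrite ge0_integral_fsum//; last 2 first.
- move=> r; apply: emeasurable_funM => //.
  by apply/measurable_EFinP/measurable_funM.
- move=> r x _; apply: mule_ge0; last by rewrite lee_fin.
  exact: nnfun_muleindic_ge0.
apply: eq_fsbigr => r rhn.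
have r0 : (0 <= r)%R.
  by move: rhn => /set_mem[x _ <-].
have mA : measurable (u n @^-1` [set r]) by [].
under eq_integral do rewrite EFinM.
rewrite ge0_integralZl//; last exact/measurable_EFinP.
rewrite integral_indic// setIT m1E//.
under [RHS]eq_integral do rewrite EFinM -muleA.
rewrite ge0_integralZl//; last 2 first.
- by apply: emeasurable_funM => //; apply/measurable_EFinP.
- by move=> x _; apply: mule_ge0; rewrite lee_fin.
congr (_ * _).
rewrite integral_mkcond; apply: eq_integral => x _.
rewrite patchE indicE; case: (x \in _); by rewrite ?mul1e ?mul0e.
Qed.

End density.

(** * Affine changes of variable for the one-dimensional normal law *)

Section normal_affine.
Context {R : realType}.
Local Notation N := (@normal_prob R 0 1).
Local Notation lam := (@lebesgue_measure R).

(* The density of the law of [a + s Y], [Y] standard normal, with respect to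
   the standard normal law itself. *)
Definition normal_kernel (a s z : R) : R :=
  s^-1 * expR (- ((z - a) ^+ 2 / (s ^+ 2 *+ 2)) + z ^+ 2 / 2).

Lemma normal_kernel_ge0 a s z : 0 < s -> 0 <= normal_kernel a s z.
Proof. by move=> s0; rewrite mulr_ge0 ?invr_ge0 ?expR_ge0// ltW. Qed.

Lemma measurable_affine (a s : R) : measurable_fun setT (fun y : R => a + s * y).
Proof. by apply: measurable_funD => //; exact: measurable_funM. Qed.

(** The image of Lebesgue measure under [a + s y], multiplied by [s], gives every half-open interval
    its length, so it is Lebesgue measure. *)
Lemma ge0_integral_lebesgue_affine (a s : R) (h : R -> \bar R) : 0 < s ->
  measurable_fun setT h -> (forall x, (0 <= h x)%E) ->
  (\int[lam]_x h x = s%:E * \int[lam]_y h (a + s * y)%R)%E.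
Proof.
move=> s0 mh h0.
pose phi : R -> R := fun y => a + s * y.
have mphi : measurable_fun [set: measurableTypeR R] (phi : _ -> measurableTypeR R).
  exact: measurable_affine.
have nns : (0 <= s)%R by exact: ltW.
pose m : {measure set (measurableTypeR R) -> \bar R} :=
  mscale (NngNum nns) (measure_function_pushforward__canonical__measure_function_Measure lam mphi).
have lamE A : measurable A -> lam A = m A.
  apply: lebesgue_measure_unique => _ [[p q] /= pq <-].
  rewrite /m /mscale/= /pushforward/=.
  have -> : phi @^-1` `]p, q]%classic = `](p - a) / s, (q - a) / s]%classic.
    apply/seteqP; split => y /=; rewrite !in_itv/= /phi ltr_pdivrMr// ler_pdivlMr//.
      by move=> /andP[? ?]; apply/andP; split; lra.
    by move=> /andP[? ?]; apply/andP; split; lra.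
  rewrite !lebesgue_measure_itv/= !lte_fin ltr_pM2r ?invr_gt0// ltrD2r.
  case: ifPn => _; last by rewrite mule0.
  by rewrite -!EFinB -EFinM; congr (_%:E); field; rewrite gt_eqF.
rewrite (eq_measure_integral m); last by move=> A mA _; exact: lamE.
rewrite ge0_integral_mscale//= ge0_integral_pushforward//.
Qed.


Lemma normal_pdf01E (y : R) :
  normal_pdf 0 1 y = normal_peak 1 * expR (- (y ^+ 2 / 2)).
Proof.
rewrite normal_pdfE ?oner_neq0// /normal_fun subr0 expr1n.
by congr (_ * expR _); rewrite mulNr.
Qed.

Lemma ge0_integral_normal (h : R -> \bar R) : measurable_fun setT h ->
  (forall x, (0 <= h x)%E) ->
  (\int[N]_x h x = \int[lam]_x (h x * (normal_pdf 0 1 x)%:E))%E.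
Proof.
move=> mh h0; rewrite (@ge0_integral_density _ _ _ N lam (normal_pdf 0 1))//.
- exact: measurable_normal_pdf.
- exact: normal_pdf_ge0.
Qed.

Lemma measurable_normal_kernel a s : measurable_fun setT (normal_kernel a s).
Proof.
apply: measurable_funM => //; apply: measurableT_comp => //.
apply: measurable_funD; last exact: measurable_funM.
apply: measurableT_comp => //; apply: measurable_funM => //.
by apply: measurable_funX; exact: measurable_funB.
Qed.

(** After passing to Lebesgue densities and substituting, the claim is the identity s k(z) p(z) =
    p((z - a)/s), with k the kernel and p the normal density. *)
Lemma ge0_integral_normal_affine (a s : R) (h : R -> \bar R) : 0 < s ->
  measurable_fun setT h -> (forall x, (0 <= h x)%E) ->
  (\int[N]_y h (a + s * y)%R = \int[N]_z (h z * (normal_kernel a s z)%:E))%E.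
Proof.
move=> s0 mh h0.
have mk : measurable_fun setT (fun z => (normal_kernel a s z)%:E).
  apply/measurable_EFinP; exact: measurable_normal_kernel.
have mp : measurable_fun setT (fun z : R => (normal_pdf 0 1 z)%:E).
  apply/measurable_EFinP; exact: measurable_normal_pdf.
have k0 z : (0 <= (normal_kernel a s z)%:E)%E by rewrite lee_fin normal_kernel_ge0.
have p0 (z : R) : (0 <= (normal_pdf 0 1 z)%:E)%E by rewrite lee_fin normal_pdf_ge0.
have mc (g : R -> \bar R) : measurable_fun setT g ->
    measurable_fun setT (fun y : R => g (a + s * y)).
  by move=> mg; exact: measurableT_comp mg (measurable_affine a s).
rewrite !ge0_integral_normal//.
- rewrite [RHS](ge0_integral_lebesgue_affine a s0); last 2 first.
  + by do 2?[apply: emeasurable_funM => //].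
  + by move=> z; rewrite !mule_ge0.
  rewrite -ge0_integralZl//.
  + apply: eq_integral => y _; rewrite -(muleA (h _)) [RHS]muleCA; congr (_ * _)%E.
    rewrite -!EFinM; congr EFin; rewrite !normal_pdf01E /normal_kernel.
    rewrite -!mulrA mulVKf ?gt_eqF//.
    rewrite [RHS]mulrCA -expRD; congr (_ * expR _).
    by field; rewrite gt_eqF.
  + apply: (mc (fun z => h z * (normal_kernel a s z)%:E *
      (normal_pdf 0 1 z)%:E)%E).
    by do 2?[apply: emeasurable_funM => //].
  + by move=> y _; rewrite !mule_ge0.
  + by rewrite lee_fin ltW.
- exact: emeasurable_funM.
- by move=> z; rewrite mule_ge0.
- exact: mc.
Qed.

End normal_affine.

(** * A finite measure on R^n is determined by boxes *)

Section box_unique.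
Context {R : realType} {n : nat}.
Local Notation V := 'rV[R]_n.

Definition box (B : 'I_n -> set R) : set V := [set x | forall i, B i (x 0 i)].

Lemma measurable_box (B : 'I_n -> set R) :
  (forall i, measurable (B i)) -> measurable (box B).
Proof.
move=> mB; rewrite (_ : box B = \bigcap_(i in [set: 'I_n])
    ((fun x : V => x 0 i) @^-1` B i)).
  apply: fin_bigcap_measurable => // i _; rewrite -[X in measurable X]setTI.
  exact: measurable_coord.
by apply/seteqP; split => [x Bx i _|x Bx i]; [exact: Bx|exact: Bx].
Qed.

(** Boxes are stable under intersection and generate the sigma-algebra, so uniqueness on a
    generating pi-system applies. *)
Lemma measure_rV_unique (m1 m2 : {measure set V -> \bar R}) :
  (m1 setT < +oo)%E ->
  (forall B, (forall i, measurable (B i)) -> m1 (box B) = m2 (box B)) ->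
  forall A, measurable A -> m1 A = m2 A.
Proof.
move=> m1oo m12 A mA.
pose G : set (set V) :=
  [set A | exists2 B, (forall i, measurable (B i)) & A = box B].
apply: (@g_sigma_algebra_measure_unique _ R _ G _ (fun=> setT)) => //.
- by move=> _ [B mB ->]; exact: measurable_box.
- move=> _; exists (fun=> setT) => //.
  by apply/seteqP; split.
- by apply/seteqP; split => // x _; exists 0%N.
- move=> _ _ [B mB ->] [C mC ->]; exists (fun i => B i `&` C i).
    by move=> i; exact: measurableI.
  by apply/seteqP; split => [x [Bx Cx] i|x BCx]; [split|split => i; have [] := BCx i].
- by move=> _ [B mB ->]; exact: m12.
- move: A mA; rewrite [X in forall A, X A -> _]rV_preimageE.
  apply: smallest_sub; first exact: smallest_sigma_algebra.
  move=> _ [i _ [C mC <-]]; apply: sub_sigma_algebra.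
  (* A condition on a single coordinate is a box whose other sides are the whole line. *)
  exists (fun j => if j == i then C else setT).
    by move=> j; case: ifP.
  apply/seteqP; split => [x [_ Cx] j|x Bx]; first by case: eqP => [->|].
  by have := Bx i; rewrite eqxx.
Qed.

End box_unique.

(** * The law of [a + s Y] for an n-dimensional Gaussian [Y] *)

Section resample.
Context {R : realType} {n : nat} (gamma : probability 'rV[R]_n R).
Hypothesis gaussE : std_gaussian gamma.
Local Notation V := 'rV[R]_n.
Local Notation N := (@normal_prob R 0 1).

Definition upd (i : 'I_n) (x : V) (s : R) : V :=
  \row_j (if j == i then s else x 0 j).

Lemma measurable_upd i : measurable_fun setT (fun p : V * R => upd i p.1 p.2).
Proof.
apply: measurable_rVP => j; under eq_fun do rewrite mxE.
case: (j == i); first exact: measurable_snd.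
exact: measurableT_comp (measurable_coord j) measurable_fst.
Qed.

Lemma measurable_updr i x : measurable_fun setT (upd i x).
Proof.
exact: measurableT_comp (measurable_upd i) (pair1_measurable x).
Qed.

Local Open Scope ereal_scope.

(** Replacing one coordinate by an independent standard normal variable does not change the measure
    of any box, hence preserves [gamma]. This is how one-dimensional formulas enter although [gamma]
    is only characterised on boxes. *)
Lemma ge0_integral_resample i (h : V -> \bar R) : measurable_fun setT h ->
  (forall x, 0 <= h x) ->
  \int[gamma]_x h x = \int[gamma]_x \int[N]_s h (upd i x s).
Proof.
move=> mh h0; have mu := measurable_upd i.
pose m : {measure set V -> \bar R} :=
  measure_function_pushforward__canonical__measure_function_Measure
    (gamma \x N) mu.
transitivity (\int[m]_x h x).
  apply: eq_measure_integral => A mA _.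
  apply: measure_rV_unique => //.
    by rewrite (le_lt_trans (probability_le1 _ _)) ?ltry.
  move=> B mB; rewrite /m/= /pushforward/=.
  pose B' j := if j == i then setT else B j.
  have mB' j : measurable (B' j) by rewrite /B'; case: ifP.
  rewrite (_ : _ @^-1` _ = box B' `*` B i); last first.
    apply/seteqP; split => [[x s] /= xB|[x s] /= [xB sB] j].
      split; last by have := xB i; rewrite mxE eqxx.
      by move=> j; have := xB j; rewrite mxE /B'; case: ifP.
    by have := xB j; rewrite mxE /B'; case: eqP => // ->.
  rewrite (product_measure1E gamma N (measurable_box mB') (mB i)).
  rewrite [LHS](gaussE mB) [X in X * _](gaussE mB').
  have NB : N (B i) = (fine (N (B i)))%:E by apply/esym/fineK; apply: (fin_num_measure N (B i) (mB i)).
  rewrite [X in _ * X]NB -EFinM.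
  rewrite (bigD1 i)//= [in RHS](bigD1 i)//= /B' eqxx.
  rewrite [X in _ = (fine X * _ * _)%:E](probability_setT N) mul1r mulrC; congr (_ * _)%:E.
  by apply: eq_bigr => j /negbTE ->.
rewrite ge0_integral_pushforward//.
exact: (fubini_tonelli1 (m1 := gamma) (m2 := N) _ (measurableT_comp mh mu)
  (fun=> h0 _)).
Qed.

Local Close Scope ereal_scope.

(** Density with respect to [gamma] of the law of [a + s Y]. For [a = c x] with c^2 + s^2 = 1 it is
    the Mehler kernel. *)
Definition gauss_kernel (a : V) (s : R) (z : V) : R :=
  \prod_i normal_kernel (a 0 i) s (z 0 i).

(** The coordinates are transformed one at a time: resample one of them, then use the
    one-dimensional formula for it. *)
Lemma ge0_integral_gauss_affine (a : V) (s : R) (h : V -> \bar R) : 0 < s ->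
  measurable_fun setT h -> (forall x, (0 <= h x)%E) ->
  (\int[gamma]_y h (a + s *: y)%R =
  \int[gamma]_z (h z * (gauss_kernel a s z)%:E))%E.
Proof.
move=> s0 mh h0.
(* The induction is on the list [l] of coordinates already transformed; [K l] is the matching
   partial product of kernels. *)
pose A (l : seq 'I_n) (y : V) : V :=
  \row_j if j \in l then a 0 j + s * y 0 j else y 0 j.
pose K (l : seq 'I_n) (z : V) : R :=
  \prod_(i <- l) normal_kernel (a 0 i) s (z 0 i).
have K0 l z : (0 <= (K l z)%:E)%E.
  by rewrite lee_fin prodr_ge0// => i _; exact: normal_kernel_ge0.
have mK l : measurable_fun setT (fun z => (K l z)%:E).
  apply/measurable_EFinP; apply: measurable_prod => i _.
  exact: measurableT_comp (measurable_normal_kernel _ _) (measurable_coord i).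
have mA l : measurable_fun setT (A l).
  apply: measurable_rVP => j; under eq_fun do rewrite mxE.
  case: (j \in l); last exact: measurable_coord.
  exact: measurableT_comp (measurable_affine _ _) (measurable_coord j).
have main l : uniq l -> forall g : V -> \bar R, measurable_fun setT g ->
    (forall x, (0 <= g x)%E) ->
    (\int[gamma]_y g (A l y) = \int[gamma]_z (g z * (K l z)%:E))%E.
  elim: l => [_ g mg g0|i l IH /= /andP[il ul] g mg g0].
    apply: eq_integral => y _; rewrite /K big_nil mule1; congr g.
    by apply/rowP => j; rewrite mxE.
  have mgA k : measurable_fun setT (fun y => g (A k y)).
    exact: measurableT_comp mg (mA k).
  pose ki (x : V) := (normal_kernel (a 0 i) s (x 0 i))%:E.
  have mki : measurable_fun setT ki.
    apply/measurable_EFinP.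
    exact: measurableT_comp (measurable_normal_kernel _ _) (measurable_coord i).
  have ki0 x : (0 <= ki x)%E by rewrite lee_fin normal_kernel_ge0.
  transitivity (\int[gamma]_x \int[N]_t g (A l (upd i x (a 0 i + s * t)%R)))%E.
    apply: eq_trans (ge0_integral_resample i (mgA (i :: l)) (fun=> g0 _)) _.
    apply: eq_integral => x _; apply: eq_integral => t _; congr g.
    apply/rowP => j; rewrite !mxE inE; case: (eqVneq j i) => [->|ji] //=.
    by rewrite (negbTE il).
  transitivity (\int[gamma]_x (g (A l x) * ki x))%E.
    apply: eq_trans _ (esym (ge0_integral_resample i
      (emeasurable_funM (mgA l) mki) _)); last first.
      by move=> x; rewrite mule_ge0.
    apply: eq_integral => x _.
    have mgu : measurable_fun setT (fun t => g (A l (upd i x t))).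
      exact: measurableT_comp (mgA l) (measurable_updr i x).
    apply: eq_trans (ge0_integral_normal_affine (a 0 i) s0 mgu (fun=> g0 _)) _.
    by apply: eq_integral => t _; rewrite /ki mxE eqxx.
  pose g' (z : V) := (g z * ki z)%E.
  transitivity (\int[gamma]_x g' (A l x))%E.
    by apply: eq_integral => x _; rewrite /g' /ki mxE (negbTE il).
  have g'0 x : (0 <= g' x)%E by rewrite mule_ge0.
  apply: eq_trans (IH ul g' (emeasurable_funM mg mki) g'0) _.
  by apply: eq_integral => z _; rewrite /g' /K big_cons EFinM muleA.
have := main (index_enum 'I_n) (index_enum_uniq _) h mh h0.
rewrite /gauss_kernel => <-; apply: eq_integral => y _; congr h.
by apply/rowP => j; rewrite !mxE mem_index_enum.
Qed.

End resample.

(** * Real-valued integrable functions and their integrals *)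

Section real_integrable.
Context d (T : measurableType d) (R : realType) (mu : {measure set T -> \bar R}).
Implicit Types f g : T -> R.

Definition intR f := mu.-integrable setT (EFin \o f).
Definition rint f : R := Rintegral mu setT f.

Lemma intR_meas f : intR f -> measurable_fun setT f.
Proof. by move=> /integrableP[/measurable_EFinP]. Qed.

Lemma intR_le f g : measurable_fun setT f -> (forall x, `|f x| <= g x) ->
  intR g -> intR f.
Proof.
move=> mf fg ig; apply: (le_integrable measurableT _ _ ig).
  exact/measurable_EFinP.
by move=> x _ /=; rewrite lee_fin (le_trans (fg x))// ler_norm.
Qed.

Lemma intRP f : measurable_fun setT f -> (forall x, 0 <= f x) ->
  intR f <-> (\int[mu]_x (f x)%:E < +oo)%E.
Proof.
move=> mf f0; have e : (\int[mu]_x `|(f x)%:E| = \int[mu]_x (f x)%:E)%E.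
  by apply: eq_integral => x _; rewrite gee0_abs// lee_fin.
split => [/integrableP[_]|h]; first by rewrite /= e.
by apply/integrableP; split; [exact/measurable_EFinP|rewrite /= e].
Qed.

Lemma eq_intR f g : (forall x, f x = g x) -> intR f -> intR g.
Proof. by move=> fg; rewrite (_ : g = f)//; apply/funext => x; rewrite fg. Qed.

Lemma intRD f g : intR f -> intR g -> intR (fun x => f x + g x).
Proof. by move=> fi gi; have := integrableD measurableT fi gi; exact: eq_integrable. Qed.

Lemma intRN f : intR f -> intR (fun x => - f x).
Proof. by move=> fi; have := integrableN fi; exact: eq_integrable. Qed.

Lemma intRB f g : intR f -> intR g -> intR (fun x => f x - g x).
Proof. by move=> fi gi; apply: intRD => //; exact: intRN. Qed.

Lemma intRZ (k : R) f : intR f -> intR (fun x => k * f x).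
Proof. by move=> fi; have := integrableZl measurableT k fi; exact: eq_integrable. Qed.

Lemma intR_abs f : intR f -> intR (fun x => `|f x|).
Proof. by move=> fi; have := integrable_abse fi; exact: eq_integrable. Qed.

Lemma intR0 : intR (fun=> 0).
Proof. exact: integrable0. Qed.

Lemma intR_sum (I : Type) (r : seq I) (F : I -> T -> R) :
  (forall i, intR (F i)) -> intR (fun x => \sum_(i <- r) F i x).
Proof.
move=> iF; elim: r => [|i r IH].
  by apply: eq_intR intR0 => x; rewrite big_nil.
by apply: eq_intR (intRD (iF i) IH) => x; rewrite big_cons.
Qed.

Lemma intRM_sqr f g : measurable_fun setT f -> measurable_fun setT g ->
  intR (fun x => f x ^+ 2) -> intR (fun x => g x ^+ 2) ->
  intR (fun x => f x * g x).
Proof.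
move=> mf mg f2 g2; apply: intR_le (intRD f2 g2); first exact: measurable_funM.
move=> x; rewrite normrM -(real_normK (num_real (f x))).
rewrite -(real_normK (num_real (g x))).
have := sqr_ge0 (`|f x| - `|g x|); have := normr_ge0 (f x).
by have := normr_ge0 (g x); nra.
Qed.

Lemma rintD f g : intR f -> intR g -> rint (fun x => f x + g x) = rint f + rint g.
Proof. by move=> fi gi; rewrite /rint RintegralD. Qed.

Lemma rintB f g : intR f -> intR g -> rint (fun x => f x - g x) = rint f - rint g.
Proof. by move=> fi gi; rewrite /rint RintegralB. Qed.

Lemma rintZ k f : intR f -> rint (fun x => k * f x) = k * rint f.
Proof. by move=> fi; rewrite /rint RintegralZl. Qed.

Lemma eq_rint f g : (forall x, f x = g x) -> rint f = rint g.
Proof. by move=> fg; apply: eq_Rintegral => x _; exact: fg. Qed.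

Lemma rint0 : rint (fun=> 0) = 0.
Proof. by rewrite /rint Rintegral_cst// mul0r. Qed.

Lemma rint_sum (I : Type) (r : seq I) (F : I -> T -> R) :
  (forall i, intR (F i)) ->
  rint (fun x => \sum_(i <- r) F i x) = \sum_(i <- r) rint (F i).
Proof.
move=> iF; elim: r => [|i r IH].
  by rewrite big_nil -[RHS]rint0; apply: eq_rint => x; rewrite big_nil.
rewrite big_cons -IH -rintD//; last exact: intR_sum.
by apply: eq_rint => x; rewrite big_cons.
Qed.

Lemma le_rint f g : intR f -> intR g -> (forall x, f x <= g x) ->
  rint f <= rint g.
Proof. by move=> fi gi fg; rewrite /rint le_Rintegral. Qed.

Lemma rint_ge0 f : (forall x, 0 <= f x) -> 0 <= rint f.
Proof. by move=> f0; apply: Rintegral_ge0. Qed.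

Lemma rintE f : intR f -> (rint f)%:E = (\int[mu]_x (f x)%:E)%E.
Proof. by move=> fi; rewrite /rint /Rintegral fineK//; exact: integrable_fin_num. Qed.

Lemma ae_eq_integrable (f g : T -> \bar R) : measurable_fun setT g ->
  ae_eq mu setT f g -> mu.-integrable setT f -> mu.-integrable setT g.
Proof.
move=> mg fg fi; have [mf fo] := integrableP _ _ _ fi.
apply/integrableP; split => //.
rewrite (ae_eq_integral (abse \o g) (abse \o f))// in fo.
- exact: measurableT_comp.
- exact: measurableT_comp.
- by apply: filterS fg => x fx Dx /=; rewrite fx.
Qed.

Lemma ae_eq_rint f g : intR f -> measurable_fun setT g ->
  {ae mu, forall x, f x = g x} -> intR g /\ rint g = rint f.
Proof.
move=> fi mg fg.
have e : ae_eq mu setT (EFin \o f) (EFin \o g).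
  by apply: filterS fg => x fx _ /=; rewrite fx.
have mf := intR_meas fi.
have mfE : measurable_fun setT (EFin \o f) by exact/measurable_EFinP.
have mgE : measurable_fun setT (EFin \o g) by exact/measurable_EFinP.
have fge := ae_eq_integral _ _ measurableT mfE mgE e.
split; last by rewrite /rint /Rintegral fge.
by apply: ae_eq_integrable fi.
Qed.

(** Almost everywhere [f] equals the minimum of [f] and [h], which lies below [h] at every point. *)
Lemma le_rint_ae f h : intR f -> intR h -> {ae mu, forall x, f x <= h x} ->
  rint f <= rint h.
Proof.
move=> fi hi fh.
have mm : measurable_fun setT (fun x => Num.min (f x) (h x)).
  exact: measurable_minr (intR_meas fi) (intR_meas hi).
have e1 : {ae mu, forall x, f x = Num.min (f x) (h x)}.
  by apply: filterS fh => x fhx; rewrite min_l.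
have [im <-] := ae_eq_rint fi mm e1.
by apply: le_rint => // x; rewrite ge_min lexx orbT.
Qed.

(** The positive or the negative part has infinite integral, so the extended integral is infinite
    (the difference of two infinities is [-oo]), and [fine] sends it to 0. This identifies the
    default value of a coordinate of [stein_vec]. *)
Lemma rint_not_integrable f : measurable_fun setT f -> ~ intR f -> rint f = 0.
Proof.
move=> mf nf; rewrite /rint /Rintegral integralE.
have mfE : measurable_fun setT (EFin \o f) by exact/measurable_EFinP.
have p0 : (0 <= \int[mu]_x (EFin \o f)^\+ x)%E by exact: integral_ge0.
have n0 : (0 <= \int[mu]_x (EFin \o f)^\- x)%E by exact: integral_ge0.
case: (boolP ((\int[mu]_x (EFin \o f)^\+ x)%E \is a fin_num)) => [fp|]; last first.
  rewrite ge0_fin_numE// -leNgt leye_eq => /eqP ->.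
  by move: n0; case: (\int[mu]_x _)%E.
case: (boolP ((\int[mu]_x (EFin \o f)^\- x)%E \is a fin_num)) => [fn|]; last first.
  rewrite ge0_fin_numE// -leNgt leye_eq => /eqP ->.
  by move: fp; case: (\int[mu]_x _)%E.
exfalso; apply: nf; apply/integrableP; split => //.
rewrite (eq_integral (fun x => (EFin \o f)^\+ x + (EFin \o f)^\- x)%E); last first.
  by move=> x _; exact: (congr1 (fun k : T -> \bar R => k x) (fune_abse (EFin \o f))).
rewrite ge0_integralD//; [|exact: measurable_funepos|exact: measurable_funeneg].
by move: fp fn; rewrite !ge0_fin_numE// => fp fn; exact: lte_add_pinfty.
Qed.

End real_integrable.

(** * Transfer of integrals along a weighted map *)

Section transfer.
Context d1 d2 (X : measurableType d1) (Y : measurableType d2) (R : realType).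
Variables (m1 : {measure set X -> \bar R}) (m2 : {measure set Y -> \bar R}).
Variables (phi : X -> Y) (w : X -> R).
Hypotheses (mphi : measurable_fun setT phi) (mw : measurable_fun setT w)
  (w0 : forall x, 0 <= w x).
Hypothesis tr : forall h : Y -> \bar R, measurable_fun setT h ->
  (forall y, (0 <= h y)%E) ->
  (\int[m1]_x (h (phi x) * (w x)%:E) = \int[m2]_y h y)%E.

(** Hypothesis [tr] says that [m2] is the image under [phi] of [m1] weighted by [w]. The instances
    are rotations, Cameron-Martin shifts, the exponential density and permutations of factors. *)
Lemma intR_transfer (h : Y -> R) : intR m2 h ->
  intR m1 (fun x => h (phi x) * w x).
Proof.
move=> ih; have mh := intR_meas ih.
apply/integrableP; split.
  apply/measurable_EFinP; apply: measurable_funM => //.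
  exact: measurableT_comp mh mphi.
rewrite (_ : (\int[_]_x _ = \int[m2]_y `|(h y)%:E|)%E); first by case/integrableP: ih.
rewrite -tr//; last by apply: measurableT_comp => //; exact/measurable_EFinP.
by apply: eq_integral => x _ /=; rewrite normrM [`|w x|]ger0_norm.
Qed.

Lemma rint_transfer (h : Y -> R) : measurable_fun setT h ->
  rint m1 (fun x => h (phi x) * w x) = rint m2 h.
Proof.
move=> mh; rewrite /rint /Rintegral; congr fine.
have mhE : measurable_fun setT (EFin \o h) by exact/measurable_EFinP.
rewrite [RHS]integralE -!tr//.
- rewrite [LHS]integralE; congr (_ - _)%E; apply: eq_integral => x _.
  + by rewrite !funeposE/= EFinM maxe_pMl ?lee_fin// mul0e.
  + by rewrite !funenegE/= -mulNr EFinM maxe_pMl ?lee_fin// mul0e.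
- exact: measurable_funeneg.
- exact: measurable_funepos.
Qed.

End transfer.

(** * Fubini's theorem for real-valued integrals *)

Section fubini_real.
Context d1 d2 (T1 : measurableType d1) (T2 : measurableType d2) (R : realType).
Variables (m1 : {sigma_finite_measure set T1 -> \bar R})
  (m2 : {sigma_finite_measure set T2 -> \bar R}).
Variable f : T1 * T2 -> R.
Hypothesis fi : intR (m1 \x m2)%E f.

Lemma ae_intR1 : {ae m1, forall x, intR m2 (fun y => f (x, y))}.
Proof. exact: ae_integrable1 fi. Qed.

(** The sections of [f] are integrable only almost everywhere; the values that [rint] takes on the
    exceptional set do not affect the outer integral. *)
Lemma fubini_real1 : intR m1 (fun x => rint m2 (fun y => f (x, y))) /\
  rint m1 (fun x => rint m2 (fun y => f (x, y))) = rint (m1 \x m2)%E f.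
Proof.
have Fi := integrable_fubini_F fi.
have e : {ae m1, forall x, setT x -> fubini_F m2 (EFin \o f) x =
    (EFin \o (fun x => rint m2 (fun y => f (x, y)))) x}.
  apply: filterS ae_intR1 => x xi _.
  by rewrite /= rintE.
have mF : measurable_fun setT (EFin \o (fun x => rint m2 (fun y => f (x, y)))).
  apply/measurable_EFinP; apply: (measurableT_comp (f := fine)) => //.
  exact: measurable_fubini_F fi.
split; first exact: ae_eq_integrable mF e Fi.
rewrite {1 3}/rint /Rintegral; congr fine; rewrite -(integral12_prod_meas1 fi).
by apply/esym/ae_eq_integral => //; exact: measurable_fubini_F fi.
Qed.

End fubini_real.

Section fubini_real_swap.
Context d1 d2 (T1 : measurableType d1) (T2 : measurableType d2) (R : realType).
Variables (m1 : {sigma_finite_measure set T1 -> \bar R})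
  (m2 : {sigma_finite_measure set T2 -> \bar R}).
Variable f : T1 * T2 -> R.
Hypothesis fi : intR (m1 \x m2)%E f.

Lemma intR_swap : intR (m2 \x m1)%E (fun p => f (p.2, p.1)).
Proof.
have mf : measurable_fun setT (EFin \o f) by exact: measurable_int fi.
have mfs : measurable_fun setT (EFin \o (fun p : T2 * T1 => f (p.2, p.1))).
  have ms : measurable_fun setT (fun p : T2 * T1 => (p.2, p.1)).
    exact: measurable_fun_pair measurable_snd measurable_fst.
  exact: (measurableT_comp mf ms).
apply: (proj2 (@integrable12ltyP _ _ _ _ _ m2 m1 _ mfs)).
exact: (proj1 (@integrable21ltyP _ _ _ _ _ m1 m2 _ mf) fi).
Qed.

Lemma fubini_real2 : intR m2 (fun y => rint m1 (fun x => f (x, y))) /\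
  rint m2 (fun y => rint m1 (fun x => f (x, y))) = rint (m1 \x m2)%E f.
Proof.
have [h ->] := fubini_real1 intR_swap; split => //.
rewrite /rint /Rintegral; congr fine.
by rewrite -(integral12_prod_meas1 intR_swap) -(integral21_prod_meas1 fi).
Qed.

End fubini_real_swap.

(** * Rotations of the product measure and the Cameron-Martin formula *)

Section gauss_calculus.
Context {R : realType} {n : nat} (gamma : probability 'rV[R]_n R).
Hypothesis gaussE : std_gaussian gamma.
Local Notation V := 'rV[R]_n.
Local Notation lam := (@lebesgue_measure R).
Local Notation gamma2 := (gamma \x gamma)%E.

Lemma dotvC (x y : V) : dotv x y = dotv y x.
Proof. by apply: eq_bigr => i _; rewrite mulrC. Qed.

Lemma dotvDl (x y z : V) : dotv (x + y) z = dotv x z + dotv y z.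
Proof. by rewrite -big_split; apply: eq_bigr => i _; rewrite mxE mulrDl. Qed.

Lemma dotvZl (k : R) (x z : V) : dotv (k *: x) z = k * dotv x z.
Proof. by rewrite mulr_sumr; apply: eq_bigr => i _; rewrite mxE mulrA. Qed.

Lemma dotvDr (x y z : V) : dotv x (y + z) = dotv x y + dotv x z.
Proof. by rewrite ![dotv x _]dotvC dotvDl. Qed.

Lemma dotvZr (k : R) (x z : V) : dotv x (k *: z) = k * dotv x z.
Proof. by rewrite ![dotv x _]dotvC dotvZl. Qed.

Lemma dotv_evec (i : 'I_n) (x : V) : dotv (evec i) x = x 0 i.
Proof.
rewrite /dotv (bigD1 i)//= !mxE !eqxx mul1r big1 ?addr0// => j ji.
by rewrite !mxE (negbTE ji) andbF mul0r.
Qed.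

Lemma dotv_evec1 (i : 'I_n) : dotv (evec i) (evec i : V) = 1.
Proof. by rewrite dotv_evec mxE !eqxx. Qed.

Lemma dotv_ge0 (x : V) : 0 <= dotv x x.
Proof. by apply: sumr_ge0 => i _; rewrite -expr2 sqr_ge0. Qed.

Lemma measurable_rVD d (T : measurableType d) (F G : T -> V) :
  measurable_fun setT F -> measurable_fun setT G ->
  measurable_fun setT (fun t => F t + G t).
Proof.
move=> mF mG; apply: measurable_rVP => i; under eq_fun do rewrite mxE.
by apply: measurable_funD; exact: measurableT_comp (measurable_coord i) _.
Qed.

Lemma measurable_rVZ d (T : measurableType d) (k : T -> R) (F : T -> V) :
  measurable_fun setT k -> measurable_fun setT F ->
  measurable_fun setT (fun t => k t *: F t).
Proof.
move=> mk mF; apply: measurable_rVP => i; under eq_fun do rewrite mxE.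
by apply: measurable_funM => //; exact: measurableT_comp (measurable_coord i) _.
Qed.

Lemma measurable_dotv d (T : measurableType d) (F G : T -> V) :
  measurable_fun setT F -> measurable_fun setT G ->
  measurable_fun setT (fun t => dotv (F t) (G t)).
Proof.
move=> mF mG; apply: measurable_sum => i; apply: measurable_funM.
  exact: measurableT_comp (measurable_coord i) mF.
exact: measurableT_comp (measurable_coord i) mG.
Qed.

(** For c^2 + s^2 = 1 this is an orthogonal reflection, chosen instead of a rotation because it is
    its own inverse. *)
Definition rot (c s : R) (p : V * V) : V * V :=
  (c *: p.1 + s *: p.2, s *: p.1 - c *: p.2).

Lemma measurable_rot c s : measurable_fun setT (rot c s).
Proof.
apply: measurable_fun_pair.
  by apply: measurable_rVD; apply: measurable_rVZ.
under eq_fun do rewrite -scaleNr.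
by apply: measurable_rVD; apply: measurable_rVZ.
Qed.

Lemma rotK c s p : c ^+ 2 + s ^+ 2 = 1 -> rot c s (rot c s p) = p.
Proof.
move=> cs; rewrite /rot /=; case: p => x y /=; congr pair.
  apply/rowP => i; rewrite !mxE.
  rewrite (_ : _ + _ = (c ^+ 2 + s ^+ 2) * x 0 i); first by rewrite cs mul1r.
  by ring.
apply/rowP => i; rewrite !mxE.
rewrite (_ : _ - _ = (c ^+ 2 + s ^+ 2) * y 0 i); first by rewrite cs mul1r.
by ring.
Qed.

(** Symmetry of the Mehler kernel, that is, reversibility of the Ornstein-Uhlenbeck semigroup. *)
Lemma gauss_kernel_sym (c s : R) (x z : V) : c ^+ 2 + s ^+ 2 = 1 -> s != 0 ->
  gauss_kernel (c *: x) s z = gauss_kernel (c *: z) s x.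
Proof.
move=> cs s0; apply: eq_bigr => i _; rewrite !mxE /normal_kernel.
congr (_ * expR _); apply/eqP; rewrite -subr_eq0; apply/eqP.
have c2 : c ^+ 2 = 1 - s ^+ 2 by rewrite -cs addrK.
transitivity ((z 0 i ^+ 2 - x 0 i ^+ 2) * ((s ^+ 2 + c ^+ 2 - 1) / (s ^+ 2 *+ 2))).
  by field.
by rewrite (addrC (s ^+ 2)) cs subrr mul0r mulr0.
Qed.

Lemma measurable_gauss_kernel s : measurable_fun setT
  (fun p : V * V => gauss_kernel p.1 s p.2).
Proof.
apply: measurable_prod => i _; rewrite /normal_kernel.
have m1 : measurable_fun setT (fun p : V * V => p.1 0 i).
  exact: measurableT_comp (measurable_coord i) measurable_fst.
have m2 : measurable_fun setT (fun p : V * V => p.2 0 i).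
  exact: measurableT_comp (measurable_coord i) measurable_snd.
apply: measurable_funM => //; apply: measurableT_comp => //.
apply: measurable_funD; last by apply: measurable_funM => //; exact: measurable_funX.
apply: measurableT_comp => //; apply: measurable_funM => //.
by apply: measurable_funX; exact: measurable_funB.
Qed.

Lemma gauss_kernel_ge0 a s (z : V) : 0 < s -> 0 <= gauss_kernel a s z.
Proof. by move=> s0; apply: prodr_ge0 => i _; exact: normal_kernel_ge0. Qed.

(** For fixed [x] the variable [z = c x + s y] has density the Mehler kernel. By symmetry of the
    kernel [x] and [z] can be exchanged, and undoing the substitution gives the unrotated
    integral. *)
Lemma ge0_integral_rot (c s : R) (h : V * V -> \bar R) : 0 < s ->
  c ^+ 2 + s ^+ 2 = 1 -> measurable_fun setT h -> (forall p, (0 <= h p)%E) ->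
  (\int[gamma2]_p h (rot c s p) = \int[gamma2]_p h p)%E.
Proof.
move=> s0 cs mh h0.
have mhr : measurable_fun setT (fun p => h (rot c s p)).
  exact: measurableT_comp mh (measurable_rot c s).
(* When [z = c x + s y], the second component [s x - c y] of the reflection equals
   [(x - c z) / s]. *)
pose F (x z : V) := h (z, s^-1 *: (x - c *: z)).
have mF : measurable_fun setT (fun p : V * V => F p.1 p.2).
  apply: (measurableT_comp mh); apply: measurable_fun_pair => //.
  apply: measurable_rVZ => //; under eq_fun do rewrite -scaleNr.
  by apply: measurable_rVD => //; exact: measurable_rVZ.
pose K (x z : V) := (gauss_kernel (c *: x) s z)%:E.
have mK : measurable_fun setT (fun p : V * V => K p.1 p.2).
  apply/measurable_EFinP.
  have m1 : measurable_fun setT (fun p : V * V => (c *: p.1, p.2)).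
    by apply: measurable_fun_pair => //; exact: measurable_rVZ.
  exact: (measurableT_comp (measurable_gauss_kernel s) m1).
have mFK : measurable_fun setT (fun p : V * V => F p.1 p.2 * K p.1 p.2)%E.
  exact: emeasurable_funM.
have FK0 p : (0 <= F p.1 p.2 * K p.1 p.2)%E.
  by apply: mule_ge0; [exact: h0|rewrite lee_fin gauss_kernel_ge0].
transitivity (\int[gamma]_x \int[gamma]_z (F x z * K x z))%E.
  apply: eq_trans (fubini_tonelli1 _ mhr (fun=> h0 _)) _.
  apply: eq_integral => x _.
  have mFx : measurable_fun setT (F x) by exact: (measurableT_comp mF (pair1_measurable x)).
  apply: eq_trans _ (ge0_integral_gauss_affine gaussE (c *: x) s0 mFx (fun=> h0 _)).
  apply: eq_integral => y _; rewrite /F /rot /=; congr (h (_, _)).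
  apply/rowP => i; rewrite !mxE.
  have sn0 : s != 0 by rewrite gt_eqF.
  have c2 : c ^+ 2 = 1 - s ^+ 2 by rewrite -cs addrK.
  transitivity (s^-1 * ((1 - c ^+ 2) * x 0 i - c * s * y 0 i)).
    by rewrite c2; field.
  by congr (_ * _); ring.
transitivity (\int[gamma]_z \int[gamma]_x (F x z * K x z))%E.
  exact: (fubini_tonelli _ mFK FK0).
apply: eq_trans _ (esym (fubini_tonelli1 _ mh h0)).
apply: eq_integral => z _.
have mFz : measurable_fun setT (F ^~ z) by exact: (measurableT_comp mF (pair2_measurable z)).
apply: eq_trans _ (eq_trans
  (esym (ge0_integral_gauss_affine gaussE (c *: z) s0 mFz (fun=> h0 _))) _).
  by apply: eq_integral => x _; rewrite /K gauss_kernel_sym// gt_eqF.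
apply: eq_integral => y _; rewrite /F; congr (h (_, _)).
by rewrite addrC addKr scalerA mulVf ?gt_eqF// scale1r.
Qed.

Section rot_real.
Variables (c s : R) (h : V * V -> R).
Hypotheses (s0 : 0 < s) (cs : c ^+ 2 + s ^+ 2 = 1).

Let tr (k : V * V -> \bar R) : measurable_fun setT k ->
  (forall y, (0 <= k y)%E) ->
  (\int[gamma2]_x (k (rot c s x) * (cst 1 x)%:E) = \int[gamma2]_y k y)%E.
Proof.
move=> mk k0; rewrite -(ge0_integral_rot s0 cs mk k0).
by apply: eq_integral => p _; rewrite mule1.
Qed.

Lemma intR_rot : intR gamma2 h -> intR gamma2 (fun p => h (rot c s p)).
Proof.
move=> hi; apply: (@eq_intR _ _ _ _ (fun p => h (rot c s p) * cst 1 p)).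
  by move=> p; rewrite mulr1.
by apply: intR_transfer tr _ hi => //; exact: measurable_rot.
Qed.

Lemma rint_rot : measurable_fun setT h ->
  rint gamma2 (fun p => h (rot c s p)) = rint gamma2 h.
Proof.
move=> mh; rewrite -(rint_transfer (w := cst 1) (fun=> ler01) tr mh).
by apply: eq_rint => p; rewrite mulr1.
Qed.

End rot_real.

Definition cm_weight (a x : V) : R := expR (- (dotv a x + dotv a a / 2)).

Lemma measurable_cm_weight a : measurable_fun setT (cm_weight a).
Proof.
apply: measurableT_comp => //; apply: measurableT_comp => //.
by apply: measurable_funD => //; exact: measurable_dotv.
Qed.

Lemma measurable_shift (a : V) : measurable_fun setT (fun x : V => x + a).
Proof. exact: measurable_rVD. Qed.

(** With [s = 1] the kernel is exp(a . z - |a|^2 / 2), the inverse of the weight evaluated at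
    [z - a]. *)
Lemma ge0_integral_cameron_martin (a : V) (h : V -> \bar R) :
  measurable_fun setT h -> (forall x, (0 <= h x)%E) ->
  (\int[gamma]_x (h (x + a)%R * (cm_weight a x)%:E) = \int[gamma]_x h x)%E.
Proof.
move=> mh h0.
pose k (z : V) := (h z * (cm_weight a (z - a))%:E)%E.
have mk : measurable_fun setT k.
  apply: emeasurable_funM => //; apply/measurable_EFinP.
  exact: measurableT_comp (measurable_cm_weight a) (measurable_shift (- a)).
have k0 z : (0 <= k z)%E by rewrite mule_ge0// lee_fin expR_ge0.
transitivity (\int[gamma]_y k (a + 1 *: y)%R)%E.
  by apply: eq_integral => y _; rewrite /k scale1r [a + y]addrC addrK.
apply: eq_trans (ge0_integral_gauss_affine gaussE a ltr01 mk k0) _.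
apply: eq_integral => z _; rewrite /k -muleA -EFinM.
rewrite (_ : _ * _ = 1) ?mule1//.
have -> : gauss_kernel a 1 z = expR (dotv a z - dotv a a / 2).
  rewrite /gauss_kernel /dotv mulr_suml -sumrB expR_sum.
  apply: eq_bigr => i _; rewrite /normal_kernel invr1 mul1r; congr expR.
  by rewrite expr1n; field.
rewrite /cm_weight -expRD -(scaleN1r a) dotvDr dotvZr -[RHS]expR0; congr expR; by field.
Qed.

Lemma intR_cameron_martin (a : V) (h : V -> R) : intR gamma h ->
  intR gamma (fun x => h (x + a) * cm_weight a x).
Proof.
apply: intR_transfer => //.
- exact: measurable_shift.
- exact: measurable_cm_weight.
- by move=> x; exact: expR_ge0.
- exact: ge0_integral_cameron_martin.
Qed.

Lemma rint_cameron_martin (a : V) (h : V -> R) : measurable_fun setT h ->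
  rint gamma (fun x => h (x + a) * cm_weight a x) = rint gamma h.
Proof.
apply: rint_transfer => //.
- by move=> x; exact: expR_ge0.
- exact: ge0_integral_cameron_martin.
Qed.

End gauss_calculus.

(** * Derivatives along lines *)

Section line_derivative.
Context {R : realType} {n : nat}.
Local Notation V := 'rV[R]_n.

Lemma is_derive_line (G : V -> R) (x v : V) (t g : R) :
  is_derive (x + t *: v) v G g -> is_derive t 1 (fun r : R => G (x + r *: v)) g.
Proof.
have e : (fun h : R => h^-1 *: (((fun r : R => G (x + r *: v)) \o shift t) (h *: 1)
      - G (x + t *: v))) =
    (fun h : R => h^-1 *: ((G \o shift (x + t *: v)) (h *: v) - G (x + t *: v))).
  apply/funext => h /=; congr (_ *: (G _ - _)).
  by rewrite scaler1 scalerDl addrCA.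
by case=> dG <-; split; rewrite /derivable /derive e.
Qed.

Lemma derivable1_continuous (f : R -> R) :
  (forall t, derivable f t 1) -> continuous f.
Proof.
by move=> df t; apply: differentiable_continuous; apply/derivable1_diffP.
Qed.

End line_derivative.

(** * Gaussian moments and integration by parts *)

Section gauss_ibp.
Context {R : realType} {n : nat} (gamma : probability 'rV[R]_n R).
Hypothesis gaussE : std_gaussian gamma.
Local Notation V := 'rV[R]_n.
Local Notation lam := (@lebesgue_measure R).

Lemma intR_cst (k : R) : intR gamma (fun=> k).
Proof. exact: finite_measure_integrable_cst. Qed.

Lemma rint_cst (k : R) : rint gamma (fun=> k) = k.
Proof. by rewrite /rint Rintegral_cst// [X in fine X]probability_setT mulr1. Qed.

Lemma measurable_dotvl (a : V) : measurable_fun setT (dotv a).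
Proof. exact: measurable_dotv. Qed.

Lemma intR_expR_dotv (a : V) : intR gamma (fun x => expR (dotv a x)).
Proof.
have := intRZ (expR (dotv a a / 2))
  (intR_cameron_martin gaussE (- a) (intR_cst 1)).
apply: eq_intR => x; rewrite mul1r /cm_weight -expRD -(scaleN1r a).
by rewrite !dotvZl dotvZr; congr expR; field.
Qed.

Lemma expR_norm_le (t : R) : expR `|t| <= expR t + expR (- t).
Proof.
have [t0|t0] := ler0P t.
  by rewrite -[leLHS]add0r lerD2r expR_ge0.
by rewrite -[leLHS]addr0 lerD2l expR_ge0.
Qed.

Lemma intR_expR_norm (a : V) : intR gamma (fun x => expR `|dotv a x|).
Proof.
apply: intR_le (intRD (intR_expR_dotv a) (intR_expR_dotv (- a))).
  apply: measurableT_comp => //; apply: measurableT_comp => //.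
  exact: measurable_dotvl.
move=> x; rewrite ger0_norm ?expR_ge0// (le_trans (expR_norm_le _))//.
by rewrite -(scaleN1r a) dotvZl mulN1r.
Qed.

Lemma sqr_le_expR (t : R) : t ^+ 2 <= 4 * expR `|t|.
Proof.
rewrite -real_normK ?num_real//.
have -> : `|t| = `|t| / 2 + `|t| / 2 by lra.
rewrite expRD; have := expR_ge1Dx (`|t| / 2); have := normr_ge0 t; nra.
Qed.

Lemma intR_dotv_sqr (a : V) : intR gamma (fun x => dotv a x ^+ 2).
Proof.
apply: intR_le (intRZ 4 (intR_expR_norm a)).
  by apply: measurable_funX; exact: measurable_dotvl.
by move=> x; rewrite ger0_norm ?sqr_ge0// sqr_le_expR.
Qed.

Lemma intR_dotv (a : V) : intR gamma (dotv a).
Proof.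
apply: intR_le (intRD (intR_cst 1) (intR_dotv_sqr a)).
  exact: measurable_dotvl.
move=> x; rewrite -(real_normK (num_real (dotv a x))).
by have := sqr_ge0 (`|dotv a x| - 1); have := normr_ge0 (dotv a x); nra.
Qed.

(* Integrating [d/dt (G (x + t v) cm_weight (t v) x)] over [x] and [0 <= t <= 1]
   gives both [\int (G' - (v . x) G)] and, by the Cameron-Martin formula, [0]. *)
Lemma gauss_ibp (v : V) (G G' : V -> R) :
  (forall x, is_derive x v G (G' x)) ->
  (forall x, continuous (fun t : R => G' (x + t *: v))) ->
  measurable_fun setT G' -> intR gamma G ->
  intR gamma (fun x => G' x - dotv v x * G x) ->
  rint gamma (fun x => G' x - dotv v x * G x) = 0.
Proof.
move=> dG cG' mG' iG; set D := fun x => _; move=> iD.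
have mG := intR_meas iG; have mD := intR_meas iD.
pose w (x : V) (t : R) := cm_weight (t *: v) x.
have wE x t : w x t = expR (- (t * dotv v x + t ^+ 2 * (dotv v v / 2))).
  by rewrite /w /cm_weight !dotvZl dotvZr; congr expR; field.
pose Q (p : V * R) := \1_(`[0, 1]%classic : set R) p.2 * (D (p.1 + p.2 *: v) * w p.1 p.2).
have mxt : measurable_fun setT (fun p : V * R => p.1 + p.2 *: v).
  by apply: measurable_rVD => //; exact: measurable_rVZ.
have mw : measurable_fun setT (fun p : V * R => w p.1 p.2).
  under eq_fun do rewrite wE.
  apply: measurableT_comp => //; apply: measurableT_comp => //.
  apply: measurable_funD; apply: measurable_funM => //.
    exact: measurableT_comp (measurable_dotvl v) measurable_fst.
  exact: measurable_funX.
have mQ : measurable_fun setT Q.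
  apply: measurable_funM; first exact: measurableT_comp.
  apply: measurable_funM => //; exact: (measurableT_comp mD mxt).
have iQ : intR (gamma \x lam)%E Q.
  apply: (proj2 (@integrable21ltyP _ _ _ _ _ gamma lam _ _)).
    exact/measurable_EFinP.
  (* By Cameron-Martin the integral of |Q| over [x] is that of |D| for every [t] in [0, 1], which
     makes [Q] integrable on the product. *)
  have e (t : R) : (\int[gamma]_x `|(Q (x, t))%:E| =
      (\1_(`[0, 1]%classic : set R) t)%:E * (rint gamma (fun x => `|D x|))%:E)%E.
    rewrite rintE; last exact: intR_abs.
    have mDa : measurable_fun setT (fun x => `|D x|%:E).
      by apply/measurable_EFinP; exact: measurableT_comp.
    rewrite -[X in (_ * X)%E](ge0_integral_cameron_martin gaussE (t *: v) mDa)//.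
    rewrite -ge0_integralZl ?lee_fin//.
    - apply: eq_integral => x _; rewrite /Q /= !normrM !EFinM.
      by rewrite [`|\1_ _ _|]ger0_norm// [`|w _ _|]ger0_norm ?expR_ge0.
    - apply: emeasurable_funM; last by apply/measurable_EFinP; exact: measurable_cm_weight.
      exact: (measurableT_comp mDa (measurable_shift _)).
    - by move=> x _; rewrite mule_ge0// lee_fin expR_ge0.
  apply: (@le_lt_trans _ _ (\int[lam]_t ((\1_(`[0, 1]%classic : set R) t)%:E *
      (rint gamma (fun x => `|D x|))%:E))%E).
    by rewrite le_eqVlt; apply/orP; left; apply/eqP/eq_integral => t _; exact: e.
  rewrite ge0_integralZr//.
  - rewrite integral_indic//= setIT lebesgue_measure_itv/= lte01.
    by rewrite oppr0 adde0 mul1e ltry.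
  - exact/measurable_EFinP.
  - by rewrite lee_fin rint_ge0.
have [_ h1] := fubini_real1 iQ; have [_ h2] := fubini_real2 iQ.
have {h1} Q0 : rint (gamma \x lam)%E Q = 0.
  rewrite -h1.
  rewrite (@eq_rint _ _ _ _ _ (fun x : V => G (x + v) * cm_weight v x - G x)).
    rewrite rintB//; last exact: intR_cameron_martin.
    by rewrite rint_cameron_martin// subrr.
  move=> x; rewrite /rint /Rintegral /Q /=.
  have dF (t : R) : is_derive t 1 (fun t : R => G (x + t *: v) * w x t)
      (D (x + t *: v) * w x t).
    have -> : w x = fun t => expR (- (t * dotv v x + t ^+ 2 * (dotv v v / 2))).
      by apply/funext => r; rewrite wE.
    have dg := is_derive_line (dG (x + t *: v)).
    apply: is_derive_eq.
    rewrite /D dotvDr dotvZr /GRing.scale/=; by field.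
  have cw : continuous (w x).
    have -> : w x = fun t => expR (- (t * dotv v x + t ^+ 2 * (dotv v v / 2))).
      by apply/funext => r; rewrite wE.
    by apply: derivable1_continuous => t; exact: ex_derive.
  have cd : continuous (fun t : R => dotv v (x + t *: v)).
    have -> : (fun t : R => dotv v (x + t *: v)) = (fun t => dotv v x + t * dotv v v).
      by apply/funext => r; rewrite dotvDr dotvZr.
    by apply: derivable1_continuous => t; exact: ex_derive.
  have cG : continuous (fun t : R => G (x + t *: v)).
    apply: derivable1_continuous => t.
    by have [] := is_derive_line (dG (x + t *: v)).
  have cQ : continuous (fun t : R => D (x + t *: v) * w x t).
    move=> t; apply: cvgM; last exact: cw.
    by apply: cvgB; [exact: cG'|apply: cvgM; [exact: cd|exact: cG]].
  have cF : continuous (fun t : R => G (x + t *: v) * w x t).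
    by move=> t; apply: cvgM; [exact: cG|exact: cw].
  transitivity (fine (\int[lam]_(t in `[0%R, 1%R]) (D (x + t *: v) * w x t)%:E)%E).
    congr fine; rewrite [RHS]integral_mkcond; apply: eq_integral => t _.
    by rewrite patchE indicE; case: (_ \in _); rewrite ?mul1r ?mul0r.
  rewrite (@continuous_FTC2 R _ (fun t : R => G (x + t *: v) * w x t) 0 1)//.
  - have -> : w x 0 = 1.
      by rewrite wE !mul0r expr0n/= mul0r addr0 oppr0 expR0.
    by rewrite /w !scale1r scale0r addr0 mulr1.
  - exact: continuous_subspaceT.
  - split => [t _||].
    + by have [] := dF t.
    + exact/cvg_at_right_filter/cF.
    + exact/cvg_at_left_filter/cF.
  - by move=> t _; rewrite derive1E; have [_ ->] := dF t.
(* In the other order of integration, Cameron-Martin makes the inner integral equal to that of [D]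
   for each [t] in [0, 1]. *)
rewrite -Q0 -h2.
transitivity (rint lam (fun t : R => \1_(`[0, 1]%classic : set R) t * rint gamma D)).
  set I := rint gamma D; rewrite /rint /Rintegral.
  rewrite (_ : \int[lam]_x _ = I%:E)%E//.
  under eq_integral do rewrite EFinM.
  rewrite integralZr//.
    rewrite integral_indic//= setIT lebesgue_measure_itv/= lte01.
    by rewrite oppr0 adde0 mul1e.
  apply/integrableP; split; first exact/measurable_EFinP.
  under eq_integral do rewrite gee0_abs ?lee_fin//.
  rewrite integral_indic//= setIT lebesgue_measure_itv/= lte01.
  by rewrite oppr0 adde0 ltry.
apply: eq_rint => t.
rewrite -(rint_cameron_martin gaussE (t *: v) mD) /Q /= -rintZ//.
exact: intR_cameron_martin.
Qed.

End gauss_ibp.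

(** * Differentiability of functions with continuous partial derivatives *)

Section C1_calculus.
Context {R : realType} {n : nat}.
Local Notation V := 'rV[R]_n.

Lemma smooth_C1 (f : V -> R) : smooth f -> C1 f.
Proof.
move=> sf; have [cf df] := sf [::]; split; [exact: cf|split; [exact: df|]].
by move=> v; have [cv _] := sf [:: v]; exact: cv.
Qed.

Fact dotv_is_linear (a : V) : linear (dotv a : V -> R^o).
Proof. by move=> k x y; rewrite dotvDr dotvZr. Qed.

HB.instance Definition _ (a : V) :=
  GRing.isLinear.Build R V R^o *:%R (dotv a : V -> R^o) (dotv_is_linear a).

Lemma coord_norm_le (x : V) i : `|x 0 i| <= `|x|.
Proof.
apply/ler_addgt0Pr => e e0; apply: ltW.
have xe : 0 < `|x| + e by rewrite ltr_wpDl.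
have : ball (0 : V) (`|x| + e) x.
  by rewrite mx_norm_ball /ball_/= sub0r normrN ltrDl.
by move=> /(rV_ballP _ _ xe) /(_ i); rewrite mxE sub0r normrN.
Qed.

Lemma continuous_dotv (a : V) : continuous (dotv a).
Proof.
apply: continuous_big => [|i _ x]; first exact: add_continuous.
by apply: continuousM; [exact: cst_continuous|exact: coord_continuous].
Qed.

Lemma mean_value_at0 (f df : R -> R) (a : R) :
  (forall t : R, is_derive t 1 f (df t)) ->
  exists2 xi, `|xi| <= `|a| & f a - f 0 = df xi * a.
Proof.
move=> dF; have cf : continuous f.
  by apply: derivable1_continuous => t; have [] := dF t.
have [a0|a0] := lerP 0 a.
  have [c] := MVT_segment a0 (fun x _ => dF x) (continuous_subspaceT cf).
  rewrite in_itv/= => /andP[c0 ca] e; exists c; last by rewrite e subr0.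
  by rewrite !ger0_norm.
have [c] := MVT_segment (ltW a0) (fun x _ => dF x) (continuous_subspaceT cf).
rewrite in_itv/= => /andP[c0 ca] e; exists c; last by rewrite -opprB e; ring.
by rewrite ler0_norm// ltr0_norm// lerN2.
Qed.

Variable g : V -> R.
Hypothesis C1g : C1 g.

(** The increment is telescoped along a path that changes one coordinate at a time; each piece is
    controlled by the mean value theorem and the continuity of one partial derivative. *)
Lemma C1_differentiable x : differentiable g x.
Proof.
have [cg [dg cdg]] := C1g.
pose L : {linear V -> R^o} := dotv (grad g x).
have Lc : continuous L by exact: continuous_dotv.
suff key : g \o shift x = cst (g x) + L +o_ 0 id.
  have e := diff_unique Lc key.
  by apply/diff_locallyP; split; rewrite e.
apply/eqaddoP => e e0.
(* There are [n] pieces of size at most d |h|; dividing by [n + 1] also covers dimension 0. *)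
pose d := e / n.+1%:R.
have d0 : 0 < d by rewrite divr_gt0.
have Hi i : nbhs x [set y | `|'D_(evec i) g y - 'D_(evec i) g x| < d].
  have := cdg (evec i) x.
  by move/cvgrPdist_lt => /(_ _ d0); apply: filterS => y; rewrite distrC.
have : nbhs x [set y | forall i, `|'D_(evec i) g y - 'D_(evec i) g x| < d].
  exact: (@filter_forall _ _ _ (nbhs x) (nbhs_filter x) Hi).
move=> /nbhs_ballP[r /= r0 hr].
suff : nbhs (0 : V) [set h : V | `|g (h + x) - (g x + dotv (grad g x) h)| <= e * `|h|].
  by [].
apply/nbhs_ballP; exists r => //= h; rewrite mx_norm_ball /ball_/= sub0r normrN => hr'.
(* [H k] keeps the first [k] coordinates of [h], so the path goes from 0 to [h] in [n] steps. *)
pose H (k : nat) : V := \row_j if (j < k)%N then h 0 j else 0.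
have Hn : H n = h by apply/rowP => j; rewrite mxE ltn_ord.
have H0 : H 0%N = 0 by apply/rowP => j; rewrite !mxE.
have HS (i : 'I_n) : H i.+1 = H i + h 0 i *: evec i.
  apply/rowP => j; rewrite !mxE eqxx/= ltnS leq_eqVlt -val_eqE/=.
  have [/val_inj ->|ji] := eqVneq (val j) (val i).
    by rewrite ltnn mulr1 add0r.
  by rewrite mulr0 addr0.
have tele : g (h + x) - g x = \sum_(i < n) (g (x + H i.+1) - g (x + H i)).
  rewrite -(big_mkord xpredT (fun i => g (x + H i.+1) - g (x + H i))).
  by rewrite (telescope_sumr (fun i => g (x + H i)))// Hn H0 addr0 (addrC h).
rewrite opprD addrA tele /dotv -sumrB (le_trans (ler_norm_sum _ _ _))//.
apply: (@le_trans _ _ (\sum_(i < n) d * `|h|)); last first.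
  rewrite sumr_const card_ord -mulrnAl ler_wpM2r// /d -mulr_natr mulrAC.
  by rewrite ler_pdivrMr// ler_pM2l// ler_nat.
apply: ler_sum => i _; rewrite HS addrA.
have [xi xih] := @mean_value_at0 (fun t => g (x + H i + t *: evec i))
  (fun t => 'D_(evec i) g (x + H i + t *: evec i)) (h 0 i)
  (fun t => is_derive_line (derivableP (dg _ _))).
rewrite scale0r addr0 => ->.
rewrite mxE -mulrBl normrM ler_pM//.
  apply/ltW/hr/rV_ballP => // j; rewrite !mxE.
  rewrite (_ : _ - _ = - ((if (j < i)%N then h 0 j else 0) + xi * (j == i)%:R));
    last by ring.
  rewrite normrN (le_lt_trans _ hr')//.
  have [ji|ij] := ltnP j i.
    rewrite (_ : j == i = false) ?mulr0 ?addr0 ?coord_norm_le//.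
    by apply/negbTE; rewrite neq_ltn ji.
  rewrite add0r; case: (_ == _); last by rewrite mulr0 normr0.
  by rewrite mulr1 (le_trans xih)// coord_norm_le.
exact: coord_norm_le.
Qed.

Lemma C1_derive x v : 'D_v g x = dotv v (grad g x).
Proof.
have dg := C1_differentiable x.
rewrite deriveE// [in LHS](matrix_sum_delta v) big_ord1 linear_sum.
apply: eq_bigr => i _; rewrite linearZ /grad mxE -deriveE//.
Qed.

Lemma C1_is_derive_curve (z : R -> V) (dz : R -> V) (t : R) :
  is_derive t 1 z (dz t) ->
  is_derive t 1 (fun r => g (z r)) (dotv (dz t) (grad g (z t))).
Proof.
move=> [dzt dze].
have dz' : differentiable z t by exact/derivable1_diffP.
have dg := C1_differentiable (z t).
have dc : differentiable (g \o z) t by exact: differentiable_comp.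
split; first exact/derivable1_diffP.
by rewrite (deriveE _ dc) diff_comp//= -(deriveE _ dz') dze -(deriveE _ dg) C1_derive.
Qed.

End C1_calculus.

Lemma measurable_invr (R : realType) : measurable_fun [set: R] (@GRing.inv R).
Proof.
have o0 : open (~` [set (0 : R)]) 
  by apply/closed_openC/accessible_closed_set1/hausdorff_accessible/Rhausdorff.
rewrite -(setUv [set (0 : R)]); apply/measurable_funU => //.
  by apply: measurableC.
split; first exact: measurable_fun_set1.
apply: open_continuous_measurable_fun => // x; rewrite inE => /eqP x0.
by apply: cvgV => //; exact: cvg_id.
Qed.

(** * The score and the second moment of its mixtures *)

Section quadratic_form.
Context {R : realType} {n : nat} (gamma : probability 'rV[R]_n R).
Hypothesis gaussE : std_gaussian gamma.
Local Notation V := 'rV[R]_n.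
Local Notation gamma2 := (gamma \x gamma)%E.

Lemma intR_prod (a b : V -> R) : intR gamma a -> intR gamma b ->
  intR gamma2 (fun p => a p.1 * b p.2) /\
  rint gamma2 (fun p => a p.1 * b p.2) = rint gamma a * rint gamma b.
Proof.
move=> ia ib.
have mab : measurable_fun setT (fun p : V * V => a p.1 * b p.2).
  apply: measurable_funM; first exact: measurableT_comp (intR_meas ia) measurable_fst.
  exact: measurableT_comp (intR_meas ib) measurable_snd.
have iab : intR gamma2 (fun p => a p.1 * b p.2).
  apply: (proj2 (@integrable12ltyP _ _ _ _ _ gamma gamma _ _)).
    exact/measurable_EFinP.
  apply: (@le_lt_trans _ _ (\int[gamma]_x (`|a x| * rint gamma (fun y => `|b y|))%:E)%E).
    rewrite le_eqVlt; apply/orP; left; apply/eqP; apply: eq_integral => x _.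
    rewrite -rintZ; last exact: intR_abs.
    rewrite rintE; last by apply: intRZ; exact: intR_abs.
    by apply: eq_integral => y _; rewrite /= normrM.
  have := intRZ (rint gamma (fun y => `|b y|)) (intR_abs ia).
  move=> /(eq_intR (g := fun x => `|a x| * rint gamma (fun y => `|b y|))) h.
  rewrite -rintE ?ltry//; by apply: h => x; rewrite mulrC.
split => //; have [_ <-] := fubini_real1 iab.
rewrite -[RHS]mulrC -rintZ//; apply: eq_rint => x /=.
by rewrite rintZ// mulrC.
Qed.

Lemma rint_dotv (u : V) : rint gamma (dotv u) = 0.
Proof.
have := @gauss_ibp _ _ _ gaussE u (fun=> 1) (fun=> 0).
have e x : 0 - dotv u x * 1 = (-1) * dotv u x by ring.
move=> h; apply/eqP; rewrite -oppr_eq0 -mulN1r -rintZ; last exact: intR_dotv.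
rewrite -(eq_rint _ e) h//.
- by move=> x y; exact: cvg_cst.
- exact: intR_cst.
- by apply: eq_intR (intRZ (-1) (intR_dotv gaussE u)) => x; rewrite e.
Qed.

Lemma is_derive_dotv (u v x : V) : is_derive x v (dotv u) (dotv u v).
Proof.
pose L : {linear V -> R^o} := dotv u.
have Lc : continuous L by exact: continuous_dotv.
have dL : differentiable (dotv u : V -> R) x by exact: (linear_differentiable (f := L)).
split; first exact: diff_derivable.
by rewrite deriveE// (@diff_lin _ _ _ L).
Qed.

Lemma rint_dotv_sqr (u : V) : rint gamma (fun x => dotv u x ^+ 2) = dotv u u.
Proof.
have e x : dotv u u - dotv u x * dotv u x = dotv u u - dotv u x ^+ 2 by ring.
have iu := intR_dotv_sqr gaussE u.
have id : intR gamma (fun x => dotv u u - dotv u x * dotv u x).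
  by apply: eq_intR (intRB (intR_cst gamma (dotv u u)) iu) => x; rewrite e.
have := @gauss_ibp _ _ _ gaussE u (dotv u) (fun=> dotv u u)
  (fun x => is_derive_dotv u u x) (fun=> _) _ (intR_dotv gaussE u) id.
rewrite (eq_rint _ e) rintB//; last exact: intR_cst.
rewrite rint_cst => h; apply/esym/eqP; rewrite -subr_eq0; apply/eqP/h => //.
by move=> x t; exact: cvg_cst.
Qed.

Lemma dotv_cauchy_schwarz (x y : V) : dotv x y ^+ 2 <= dotv x x * dotv y y.
Proof.
have h (t : R) : 0 <= dotv x x - 2 * t * dotv x y + t ^+ 2 * dotv y y.
  have := dotv_ge0 (x + (- t) *: y); rewrite dotvDl !dotvDr !dotvZl !dotvZr.
  rewrite (dotvC y x); congr (0 <= _); ring.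
have := dotv_ge0 y; rewrite le_eqVlt => /predU1P[y0|y0].
  have [->|xy] := eqVneq (dotv x y) 0.
    by rewrite expr0n/= mulr_ge0 ?dotv_ge0.
  (* When [y] has zero norm the quadratic is affine in [t]; this [t] gives it the value -1, a
     contradiction. *)
  have := h ((dotv x x + 1) / (2 * dotv x y)); rewrite -y0 mulr0 addr0.
  rewrite (_ : _ - _ = -1); last by field.
  by rewrite ler0N1.
have := h (dotv x y / dotv y y).
rewrite (_ : _ + _ = dotv x x - dotv x y ^+ 2 / dotv y y); last by field; rewrite gt_eqF.
by rewrite subr_ge0 ler_pdivrMr.
Qed.

Variable g : V -> R.
Hypotheses (C1g : C1 g) (g0 : forall x, 0 <= g x).

Lemma measurable_C1 : measurable_fun setT g.
Proof. by have [cg _] := C1g; exact: continuous_measurable_rV. Qed.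

Lemma continuous_dgrad (u : V) : continuous (fun x => dotv u (grad g x)).
Proof.
have [_ [_ cd]] := C1g.
rewrite (_ : (fun _ => _) = (fun x => 'D_u g x)) => [x|]; first exact: cd.
by apply/funext => x; rewrite C1_derive.
Qed.

Lemma measurable_dgrad (u : V) : measurable_fun setT (fun x => dotv u (grad g x)).
Proof. by apply: continuous_measurable_rV; exact: continuous_dgrad. Qed.

Lemma is_derive_C1 (x v : V) : is_derive x v g (dotv v (grad g x)).
Proof.
have [_ [dg _]] := C1g.
by split; [exact: dg|rewrite C1_derive].
Qed.

(** A zero of a nonnegative function is a minimum, so all derivatives vanish there. *)
Lemma dgrad_eq0 (u x : V) : g x = 0 -> dotv u (grad g x) = 0.
Proof.
move=> gx0.
pose f (t : R) := g (x + t *: u).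
have xE : x + 0 *: u = x by rewrite scale0r addr0.
have df : is_derive (0 : R) 1 f (dotv u (grad g x)).
  by apply: is_derive_line; rewrite xE; exact: is_derive_C1.
have dft t : derivable f t 1.
  by have [] := is_derive_line (is_derive_C1 (x + t *: u) u).
have d0 : is_derive (0 : R) 1 f 0.
  apply: (@derive1_at_min R f (-1) 1 0) => //.
  - by rewrite in_itv/= ltr01 ltrN10.
  - by move=> t _; rewrite /f xE gx0 g0.
by case: df => _ <-; case: d0.
Qed.

Variable u : V.
Hypothesis u1 : dotv u u = 1.
Hypotheses (ig : intR gamma g)
  (iI : intR gamma (fun x => dotv (grad g x) (grad g x) / g x))
  (iG : intR gamma (fun x => dotv u x ^+ 2 * g x)).

Definition score (x : V) := dotv u (grad g x) / g x.

(** The identity survives at zeros of [g], where division by 0 makes the score 0, because the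
    derivative vanishes too. *)
Lemma scoreM x : score x * g x = dotv u (grad g x).
Proof.
rewrite /score; have [gx0|gx0] := eqVneq (g x) 0.
  by rewrite gx0 mulr0 dgrad_eq0.
by rewrite divfK.
Qed.

Lemma measurable_score : measurable_fun setT score.
Proof.
apply: measurable_funM; first exact: measurable_dgrad.
exact: measurableT_comp (@measurable_invr R) measurable_C1.
Qed.

Lemma intR_score_sqr : intR gamma (fun x => score x ^+ 2 * g x).
Proof.
apply: intR_le iI.
  apply: measurable_funM; last exact: measurable_C1.
  by apply: measurable_funX; exact: measurable_score.
move=> x; rewrite ger0_norm; last by rewrite mulr_ge0 ?sqr_ge0.
rewrite expr2 -mulrA scoreM {1}/score mulrAC -expr2 ler_wpM2r ?invr_ge0//.
by rewrite (le_trans (dotv_cauchy_schwarz _ _))// u1 mul1r.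
Qed.

Lemma intR_weighted (a b : V -> R) : measurable_fun setT a -> measurable_fun setT b ->
  intR gamma (fun x => a x ^+ 2 * g x) -> intR gamma (fun x => b x ^+ 2 * g x) ->
  intR gamma (fun x => a x * b x * g x).
Proof.
move=> ma mb ia ib; apply: intR_le (intRD ia ib).
  by apply: measurable_funM; [exact: measurable_funM|exact: measurable_C1].
move=> x; rewrite normrM [`|g x|]ger0_norm// -mulrDl ler_wpM2r// normrM.
rewrite -(real_normK (num_real (a x))) -(real_normK (num_real (b x))).
have := sqr_ge0 (`|a x| - `|b x|); have := normr_ge0 (a x).
by have := normr_ge0 (b x); nra.
Qed.

Lemma intR_1g : intR gamma (fun x => 1 ^+ 2 * g x).
Proof. by apply: eq_intR ig => x; rewrite expr1n mul1r. Qed.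

Lemma intR_dgrad : intR gamma (fun x => dotv u (grad g x)).
Proof.
apply: eq_intR (intR_weighted measurable_score (measurable_cst (1 : R))
  intR_score_sqr intR_1g) => x.
by rewrite mulr1 scoreM.
Qed.

Lemma intR_dotvg : intR gamma (fun x => dotv u x * g x).
Proof.
apply: eq_intR (intR_weighted (measurable_dotvl u) (measurable_cst (1 : R))
  iG intR_1g) => x.
by rewrite mulr1.
Qed.

Lemma intR_dotv_dgrad : intR gamma (fun x => dotv u x * dotv u (grad g x)).
Proof.
apply: eq_intR (intR_weighted (measurable_dotvl u) measurable_score iG
  intR_score_sqr) => x.
by rewrite -mulrA scoreM.
Qed.

Definition mass := rint gamma g.
Definition second := rint gamma (fun x => dotv u x ^+ 2 * g x).
Definition finfo := rint gamma (fun x => score x ^+ 2 * g x).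

(** Gaussian integration by parts applied to (u . x) g. *)
Lemma rint_dotv_dgrad :
  rint gamma (fun x => dotv u x * dotv u (grad g x)) = second - mass.
Proof.
have e x : (dotv u u *: g x + dotv u x *: dotv u (grad g x)) - dotv u x * (dotv u x * g x) =
    g x + dotv u x * dotv u (grad g x) - dotv u x ^+ 2 * g x.
  by rewrite u1 /GRing.scale/=; ring.
have i3 := intRB (intRD ig intR_dotv_dgrad) iG.
have := @gauss_ibp _ _ _ gaussE u (fun x => dotv u x * g x)
  (fun x => dotv u u *: g x + dotv u x *: dotv u (grad g x)).
rewrite (eq_rint _ e) rintB//; last exact: intRD intR_dotv_dgrad.
rewrite rintD//; last exact: intR_dotv_dgrad.
rewrite -/mass -/second => h.
apply/eqP; rewrite eq_sym subr_eq addrC -subr_eq0 -oppr_eq0 opprB; apply/eqP/h => {h}.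
- move=> x; have d1 := is_derive_dotv u u x; have d2 := is_derive_C1 x u.
  by apply: is_derive_eq; rewrite addrC /GRing.scale/=; ring.
- move=> x.
  rewrite (_ : (fun _ => _) = (fun y => g y + dotv u y * dotv u (grad g y)) \o
    (fun t : R => x + t *: u)); last first.
    by apply/funext => t /=; rewrite u1 /GRing.scale/= mul1r.
  move=> t; apply: continuous_comp.
    apply: (@continuousD _ _ _ (fun=> x) (fun t : R => t *: u)); first exact: cst_continuous.
    exact: scalel_continuous.
  have [cg _] := C1g; apply: continuousD; first exact: cg.
  by apply: continuousM; [exact: continuous_dotv|exact: continuous_dgrad].
- apply: measurable_funD; apply: measurable_funM => //; first exact: measurable_C1.
    exact: measurable_dotvl.
  exact: measurable_dgrad.
- exact: intR_dotvg.
- by apply: eq_intR i3 => x; rewrite e.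
Qed.

Variables c s : R.
Hypotheses (s0 : 0 < s) (cs : c ^+ 2 + s ^+ 2 = 1).

(** In the rotated variables X = c x + s y and Y = s x - c y one has (u . y)/s = u . X - (c/s) u .
    Y. The integrand is then quadratic in u . Y, which is independent of X with moments 1, 0, 1. *)
Lemma rint_mixed_score (l : R) :
  let F := fun p : V * V => (l * score (c *: p.1 + s *: p.2) +
    (1 - l) * (dotv u p.2 / s)) ^+ 2 * g (c *: p.1 + s *: p.2) in
  intR gamma2 F /\ rint gamma2 F = l ^+ 2 * finfo +
    2 * l * (1 - l) * (second - mass) +
    (1 - l) ^+ 2 * (second + mass * (c / s) ^+ 2).
Proof.
move=> F.
(* [A], [B], [C] are the coefficients of the powers 0, 1, 2 of u . Y. *)
pose A x := l ^+ 2 * (score x ^+ 2 * g x) +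
  (2 * l * (1 - l) * (dotv u x * dotv u (grad g x)) +
  (1 - l) ^+ 2 * (dotv u x ^+ 2 * g x)).
pose B x := - (2 * l * (1 - l) * (c / s)) * dotv u (grad g x) +
  - (2 * (1 - l) ^+ 2 * (c / s)) * (dotv u x * g x).
pose C x := (1 - l) ^+ 2 * (c / s) ^+ 2 * g x.
have iA2 := intRD (intRZ (2 * l * (1 - l)) intR_dotv_dgrad) (intRZ ((1 - l) ^+ 2) iG).
have iA : intR gamma A := intRD (intRZ (l ^+ 2) intR_score_sqr) iA2.
have iB : intR gamma B by apply: intRD; apply: intRZ; [exact: intR_dgrad|exact: intR_dotvg].
have iC : intR gamma C by exact: intRZ.
pose H (q : V * V) := A q.1 * 1 + (B q.1 * dotv u q.2 + C q.1 * dotv u q.2 ^+ 2).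
have [hA1 hA2] := intR_prod iA (intR_cst gamma 1).
have [hB1 hB2] := intR_prod iB (intR_dotv gaussE u).
have [hC1 hC2] := intR_prod iC (intR_dotv_sqr gaussE u).
have FE p : F p = H (rot c s p).
  have p2 : p.2 = s *: (rot c s p).1 - c *: (rot c s p).2.
    by rewrite -[in LHS](rotK p cs).
  rewrite /F -[c *: p.1 + s *: p.2]/((rot c s p).1) p2 /H /A /B /C.
  move: (rot c s p).1 (rot c s p).2 => x y.
  rewrite -(scaleNr c) dotvDr !dotvZr.
  rewrite -(scoreM x); by field; rewrite gt_eqF.
have iH : intR gamma2 H by apply: intRD => //; exact: intRD.
have -> : F = (fun p => H (rot c s p)) by apply/funext.
split; first exact: intR_rot.
rewrite rint_rot//; last exact: intR_meas iH.
rewrite /H rintD//; last exact: intRD.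
rewrite rintD// hA2 hB2 hC2 rint_cst rint_dotv rint_dotv_sqr u1.
rewrite /C rintZ// /A rintD//; last exact: intRZ intR_score_sqr.
rewrite rintD; [|exact: intRZ intR_dotv_dgrad|exact: intRZ].
rewrite !rintZ//; [|exact: intR_dotv_dgrad|exact: intR_score_sqr].
by rewrite rint_dotv_dgrad -/finfo -/second -/mass; ring.
Qed.

End quadratic_form.

(** * From one-variable derivatives back to directional ones *)

Section lines.
Context {R : realType} {n : nat}.
Local Notation V := 'rV[R]_n.

Lemma is_derive_of_line (G : V -> R) (x v : V) (d : R) :
  is_derive (0 : R) 1 (fun r : R => G (x + r *: v)) d -> is_derive x v G d.
Proof.
have e : (fun h : R => h^-1 *: (((fun r : R => G (x + r *: v)) \o shift 0) (h *: 1)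
      - G (x + 0 *: v))) =
    (fun h : R => h^-1 *: ((G \o shift x) (h *: v) - G x)).
  apply/funext => h /=; rewrite scale0r !addr0; congr (_ *: (G _ - _)).
  by rewrite scaler1 addrC.
by case=> dG <-; move: dG; rewrite /derivable e => dG; split; rewrite /derive ?e.
Qed.

Lemma continuous_line (x v : V) : continuous (fun t : R => x + t *: v).
Proof.
move=> t; apply: (@continuousD _ _ _ (fun=> x) (fun t : R => t *: v)).
  exact: cst_continuous.
exact: scalel_continuous.
Qed.

Lemma continuous_on_line (G : V -> R) (x v : V) : continuous G ->
  continuous (fun t : R => G (x + t *: v)).
Proof.
move=> cG t; apply: (@continuous_comp _ _ _ (fun t : R => x + t *: v) G).
  exact: continuous_line.
exact: cG.
Qed.

End lines.

(** * The score at a rotated point, tested against [psi] *)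

Section rotated_score.
Context {R : realType} {n : nat} (gamma : probability 'rV[R]_n R).
Hypothesis gaussE : std_gaussian gamma.
Local Notation V := 'rV[R]_n.
Local Notation gamma2 := (gamma \x gamma)%E.

Variable g : V -> R.
Hypotheses (C1g : C1 g) (g0 : forall x, 0 <= g x).
Variable u : V.
Hypothesis u1 : dotv u u = 1.
Hypotheses (ig : intR gamma g)
  (iI : intR gamma (fun x => dotv (grad g x) (grad g x) / g x))
  (iG : intR gamma (fun x => dotv u x ^+ 2 * g x)).
Variables c s : R.
Hypotheses (s0 : 0 < s) (cs : c ^+ 2 + s ^+ 2 = 1).

Let z (p : V * V) := c *: p.1 + s *: p.2.

Lemma measurable_z : measurable_fun setT z.
Proof. by apply: measurable_rVD; apply: measurable_rVZ. Qed.

Lemma intR_z (a : V -> R) : intR gamma a -> intR gamma2 (fun p => a (z p)).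
Proof.
move=> ia; have [h _] := intR_prod ia (intR_cst gamma 1).
by apply: eq_intR (intR_rot gaussE s0 cs h) => p; rewrite mulr1.
Qed.

Lemma rint_z (a : V -> R) : intR gamma a -> rint gamma2 (fun p => a (z p)) = rint gamma a.
Proof.
move=> ia; have [h e] := intR_prod ia (intR_cst gamma 1).
rewrite rint_cst mulr1 in e; rewrite -e -(rint_rot gaussE s0 cs (intR_meas h)).
by apply: eq_rint => p; rewrite mulr1.
Qed.

Lemma intR_dotv2_z : intR gamma2 (fun p => dotv u p.2 * g (z p)).
Proof.
have [h1 _] := intR_prod (intRZ s (intR_dotvg C1g g0 ig iG)) (intR_cst gamma 1).
have [h2 _] := intR_prod (intRZ c ig) (intR_dotv gaussE u).
apply: eq_intR (intR_rot gaussE s0 cs (intRB h1 h2)) => p.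
have -> : dotv u p.2 = dotv u (s *: (rot c s p).1 - c *: (rot c s p).2).
  by rewrite -[in LHS](rotK p cs).
rewrite -[z p]/((rot c s p).1); move: (rot c s p).1 (rot c s p).2 => x y.
by rewrite -(scaleNr c) dotvDr !dotvZr; ring.
Qed.

(** Integration by parts in [y] for fixed [x]; moving [y] moves the point [c x + s y] at speed [s].
    It holds only for almost every [x] because Fubini gives no more for the integrability of the
    sections. *)
Lemma ae_dgrad_z : {ae gamma, forall x,
  s * rint gamma (fun y => dotv u (grad g (z (x, y)))) =
  rint gamma (fun y => dotv u y * g (z (x, y)))}.
Proof.
have i1 := ae_intR1 (intR_z ig).
have i2 := ae_intR1 (intR_z (intR_dgrad C1g g0 u1 ig iI)).
have i3 := ae_intR1 intR_dotv2_z.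
apply: filterS3 i1 i2 i3 => x ix1 ix2 ix3.
have zE y (r : R) : z (x, y + r *: u) = z (x, y) + r *: (s *: u).
  by rewrite /z /= scalerDr addrA !scalerA mulrC.
pose G y := g (z (x, y)); pose G' y := s * dotv u (grad g (z (x, y))).
have iG' : intR gamma (fun y => G' y - dotv u y * G y).
  by apply: intRB => //; exact: intRZ.
have h := @gauss_ibp _ _ _ gaussE u G G' _ _ _ ix1 iG'.
apply/eqP; rewrite -subr_eq0 -rintZ// -rintB//; last exact: intRZ.
apply/eqP/h => [y|y|].
- apply: is_derive_of_line; rewrite /G /G' -dotvZl.
  under eq_fun do rewrite zE.
  by apply: is_derive_line; rewrite scale0r addr0; exact: is_derive_C1.
- have cl : continuous (fun t : R => dotv u (grad g (z (x, y) + t *: (s *: u)))).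
    exact: (@continuous_on_line _ _ (fun w => dotv u (grad g w)) (z (x, y))
      (s *: u) (@continuous_dgrad _ _ _ C1g u)).
  move=> t; rewrite /G'; under eq_fun do rewrite zE.
  exact: (cvgM (cvg_cst s) (cl t)).
- apply: measurable_funM => //.
  exact: measurableT_comp (measurable_dgrad C1g u) (measurableT_comp measurable_z (pair1_measurable x)).
Qed.

Variable psi : V -> R.
Hypotheses (mpsi : measurable_fun setT psi)
  (ipsi : intR gamma2 (fun p => psi p.1 ^+ 2 * g (z p))).

Let mpsi1 : measurable_fun setT (fun p : V * V => psi p.1).
Proof. exact: measurableT_comp mpsi measurable_fst. Qed.

Let mgz : measurable_fun setT (fun p => g (z p)).
Proof. exact: measurableT_comp (measurable_C1 C1g) measurable_z. Qed.

Let msz : measurable_fun setT (fun p => score g u (z p)).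
Proof. exact: measurableT_comp (measurable_score C1g u) measurable_z. Qed.

Lemma intR_weighted2 (a : V * V -> R) : measurable_fun setT a ->
  intR gamma2 (fun p => a p ^+ 2 * g (z p)) ->
  intR gamma2 (fun p => psi p.1 * (a p * g (z p))).
Proof.
move=> ma ia; apply: intR_le (intRD ipsi ia).
  by apply: measurable_funM => //; exact: measurable_funM.
move=> p; rewrite mulrA normrM [`|g _|]ger0_norm// -mulrDl ler_wpM2r// normrM.
rewrite -(real_normK (num_real (a p))) -(real_normK (num_real (psi p.1))).
have := sqr_ge0 (`|a p| - `|psi p.1|); have := normr_ge0 (a p).
by have := normr_ge0 (psi p.1); nra.
Qed.

Lemma intR_psi_dgrad : intR gamma2 (fun p => psi p.1 * dotv u (grad g (z p))).
Proof.
have h := intR_z (intR_score_sqr C1g g0 u1 iI).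
apply: eq_intR (intR_weighted2 msz h) => p.
by rewrite scoreM.
Qed.

Let mdu2 : measurable_fun setT (fun p : V * V => dotv u p.2 / s).
Proof.
apply: measurable_funM => //.
exact: measurableT_comp (measurable_dotvl u) measurable_snd.
Qed.

Lemma intR_psi_dotv : intR gamma2 (fun p => psi p.1 * (dotv u p.2 / s * g (z p))).
Proof.
apply: intR_weighted2 => //.
have [h _] := rint_mixed_score gaussE C1g g0 u1 ig iI iG s0 cs 0.
by apply: eq_intR h => p; rewrite mul0r add0r subr0 mul1r.
Qed.

(** [psi] depends on [x] alone, so it factors out of the integral in [y], where [ae_dgrad_z]
    applies. *)
Lemma rint_psi_dgrad : rint gamma2 (fun p => psi p.1 * dotv u (grad g (z p))) =
  rint gamma2 (fun p => psi p.1 * (dotv u p.2 / s * g (z p))).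
Proof.
have [i1 <-] := fubini_real1 intR_psi_dgrad.
have [i2 <-] := fubini_real1 intR_psi_dotv.
apply: (proj2 (ae_eq_rint i2 (intR_meas i1) _)).
have j1 := ae_intR1 (intR_z (intR_dgrad C1g g0 u1 ig iI)).
have j2 := ae_intR1 intR_dotv2_z.
apply: filterS3 ae_dgrad_z j1 j2 => x e ix1 ix2 /=.
transitivity (psi x / s * rint gamma (fun y => dotv u y * g (z (x, y)))).
  by rewrite -rintZ//; apply: eq_rint => y; ring.
by rewrite rintZ// -e mulrA divfK// gt_eqF.
Qed.

(* Young's inequality [2 a b <= k a^2 + b^2 / k], after replacing the score by
   a convex combination of the two representations above. *)
Lemma psi_dgrad_le (l k : R) : 0 < k ->
  rint gamma2 (fun p => psi p.1 ^+ 2 * g (z p)) <= 1 ->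
  rint gamma2 (fun p => psi p.1 * dotv u (grad g (z p))) <=
  (k + (l ^+ 2 * finfo gamma g u +
    2 * l * (1 - l) * (second gamma g u - mass gamma g) +
    (1 - l) ^+ 2 * (second gamma g u + mass gamma g * (c / s) ^+ 2)) / k) / 2.
Proof.
move=> k0 psi1.
have [iF <-] := rint_mixed_score gaussE C1g g0 u1 ig iI iG s0 cs l.
set F := (fun p => _) in iF *.
set T := rint _ _.
have TE : T = rint gamma2 (fun p => psi p.1 *
    ((l * score g u (z p) + (1 - l) * (dotv u p.2 / s)) * g (z p))).
  transitivity (l * T + (1 - l) * T); first by ring.
  rewrite {2}/T rint_psi_dgrad -!rintZ; [|exact: intR_psi_dotv|exact: intR_psi_dgrad].
  rewrite -rintD; [|exact: intRZ intR_psi_dgrad|exact: intRZ intR_psi_dotv].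
  by apply: eq_rint => p; rewrite -(scoreM C1g g0 u); ring.
have mW : measurable_fun setT (fun p : V * V =>
    l * score g u (z p) + (1 - l) * (dotv u p.2 / s)).
  by apply: measurable_funD; apply: measurable_funM.
rewrite TE; apply: (@le_trans _ _ (rint gamma2 (fun p => 2^-1 * (k * (psi p.1 ^+ 2 * g (z p)) + k^-1 * F p)))).
  apply: le_rint; first exact: intR_weighted2.
    by apply: intRZ; apply: intRD; exact: intRZ.
  move=> p; rewrite /F -/(z p); set W := _ + _.
  rewrite mulrA (_ : 2^-1 * _ = (2^-1 * (k * psi p.1 ^+ 2 + k^-1 * W ^+ 2)) * g (z p)); last by ring.
  apply: ler_wpM2r => //.
  rewrite -subr_ge0 (_ : _ - _ = (2 * k)^-1 * (k * psi p.1 - W) ^+ 2); last first.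
    by field; rewrite gt_eqF.
  by rewrite mulr_ge0 ?sqr_ge0// invr_ge0 mulr_ge0// ltW.
rewrite rintZ; last by apply: intRD; exact: intRZ.
rewrite rintD; [|exact: intRZ|exact: intRZ].
rewrite !rintZ// mulrC ler_wpM2r// mulrC [_ / k]mulrC lerD2r.
by rewrite mulrC ler_piMr// ltW.
Qed.

End rotated_score.

(** * Differentiation under the integral and the Cauchy-Schwarz inequality *)

Section under_integral.
Context d (T : measurableType d) (R : realType) (mu : {measure set T -> \bar R}).

Lemma is_derive_rint (f f' : R -> T -> R) (G : T -> R) (a u v : R) :
  u < a < v -> (forall t, u < t < v -> intR mu (f t)) ->
  (forall t y, u < t < v -> is_derive t 1 (f ^~ y) (f' t y)) ->
  intR mu G -> (forall t y, u < t < v -> `|f' t y| <= G y) ->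
  is_derive a 1 (fun t => rint mu (f t)) (rint mu (f' a)).
Proof.
move=> auv fi df iG fG.
have Iuv t : (`]u, v[%classic : set R) t -> u < t < v by rewrite /= in_itv.
have aI : (`]u, v[%classic : set R) a by rewrite /= in_itv.
have pE t y : u < t < v -> partial1of2 f t y = f' t y.
  by move=> tuv; rewrite /partial1of2 derive1E; have [_ ->] := df t y tuv.
have G0 y : 0 <= G y by rewrite (le_trans _ (fG a y auv)).
have h1 t : (`]u, v[%classic : set R) t -> mu.-integrable setT (EFin \o f t).
  by move=> /Iuv; exact: fi.
have h2 t y : (`]u, v[%classic : set R) t -> setT y -> derivable (f ^~ y) t 1.
  by move=> /Iuv tuv _; have [] := df t y tuv.
have h3 t y : (`]u, v[%classic : set R) t -> setT y -> `|partial1of2 f t y| <= G y.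
  by move=> /Iuv tuv _; rewrite pE// fG.
split; first exact: (derivable_under_integral measurableT aI h1 h2 G0 iG h3).
rewrite -derive1E.
rewrite (differentiation_under_integral measurableT aI h1 h2 G0 iG h3).
by apply: eq_rint => y; rewrite pE.
Qed.

Lemma continuous_rint (f : R -> T -> R) (G : T -> R) (a u v : R) :
  u < a < v -> (forall t, u < t < v -> measurable_fun setT (f t)) ->
  (forall y, continuous (f ^~ y)) ->
  intR mu G -> (forall t y, u < t < v -> `|f t y| <= G y) ->
  {for a, continuous (fun t => rint mu (f t))}.
Proof.
move=> auv mf cf iG fG.
have Iuv t : (`]u, v[%classic : set R) t -> u < t < v by rewrite /= in_itv.
have aI : (`]u, v[%classic : set R) a by rewrite /= in_itv.
have h1 t : (`]u, v[%classic : set R) t -> mu.-integrable setT (EFin \o f t).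
  by move=> /Iuv tuv; apply: intR_le iG => [|y]; [exact: mf|exact: fG].
have h2 : {ae mu, forall y, setT y -> {in (`]u, v[%classic : set R), continuous (f ^~ y)}}.
  by apply: aeW => y _ t _; exact: cf.
have h3 t : (`]u, v[%classic : set R) t -> {ae mu, forall y, setT y -> `|f t y| <= G y}.
  by move=> /Iuv tuv; apply: aeW => y _; exact: fG.
exact: (continuity_under_integral measurableT h1 h2 iG h3 (mem_set aI)).
Qed.

Lemma quadratic_discriminant (A B C : R) :
  (forall t, 0 <= A - 2 * t * B + t ^+ 2 * C) -> B ^+ 2 <= A * C.
Proof.
move=> h; have A0 := h 0; rewrite mulr0 mul0r subr0 expr0n/= mul0r addr0 in A0.
have [C0|C0|C0] := ltgtP C 0.
(* A negative leading coefficient is impossible: with k = (A + 1)/(-C) the quadratic is negative at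
   [k + 1] when B = 0, and otherwise the values at [k + 1] and [-(k + 1)] have a negative sum. *)
- have [B0|B0] := eqVneq B 0.
    have := h ((A + 1) / - C + 1); rewrite B0 mulr0 subr0.
    have : 0 < (A + 1) / - C by rewrite divr_gt0 ?oppr_gt0// ltr_wpDl.
    have : (A + 1) / - C * - C = A + 1 by rewrite divfK// oppr_eq0 lt_eqF.
    set k := _ / _; nra.
  have := h 1; have := h (-1); have h1 := h ((A + 1) / - C + 1); have h2 := h (- ((A + 1) / - C + 1)).
  have : 0 < (A + 1) / - C by rewrite divr_gt0 ?oppr_gt0// ltr_wpDl.
  have : (A + 1) / - C * - C = A + 1 by rewrite divfK// oppr_eq0 lt_eqF.
  move: h1 h2; set k := _ / _; nra.
- have := h (B / C).
  rewrite (_ : _ + _ = A - B ^+ 2 / C); last by field; rewrite gt_eqF.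
  by rewrite subr_ge0 ler_pdivrMr.
- rewrite C0 mulr0; have [->|B0] := eqVneq B 0; first by rewrite expr0n.
  have := h ((A + 1) / (2 * B)); rewrite C0 mulr0 addr0.
  rewrite (_ : _ - _ = -1); last by field.
  by rewrite ler0N1.
Qed.

Lemma rint_cauchy_schwarz (a b : T -> R) : measurable_fun setT a ->
  measurable_fun setT b -> intR mu (fun x => a x ^+ 2) -> intR mu (fun x => b x ^+ 2) ->
  rint mu (fun x => a x * b x) ^+ 2 <=
  rint mu (fun x => a x ^+ 2) * rint mu (fun x => b x ^+ 2).
Proof.
move=> ma mb ia ib; have iab := intRM_sqr ma mb ia ib.
apply: quadratic_discriminant => t.
have -> : rint mu (fun x => a x ^+ 2) - 2 * t * rint mu (fun x => a x * b x) +
    t ^+ 2 * rint mu (fun x => b x ^+ 2) = rint mu (fun x => (a x - t * b x) ^+ 2).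
  rewrite -!rintZ// -rintB//; last exact: intRZ.
  rewrite -rintD//; last exact: intRZ; last by apply: intRB => //; exact: intRZ.
  by apply: eq_rint => x; ring.
by apply: rint_ge0 => x; exact: sqr_ge0.
Qed.

End under_integral.

Lemma is_derive_circle (R : realType) (n : nat) (x y : 'rV[R]_n) (t : R) :
  is_derive t 1 (fun r => cos r *: x + sin r *: y) (- sin t *: x + cos t *: y).
Proof.
have D i j : is_derive t 1 (fun r => (cos r *: x + sin r *: y) i j)
    ((- sin t *: x + cos t *: y) i j).
  rewrite !mxE; under eq_fun do rewrite !mxE.
  by apply: is_derive_eq; rewrite /GRing.scale/=; ring.
split; first by apply/derivable_mxP => i j; have [] := D i j.
by apply/matrixP => i j; rewrite derive_mx; [rewrite !mxE; have [_ ->] := D i j; rewrite !mxE|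
  apply/derivable_mxP => k l; have [] := D k l].
Qed.

(** * Dissipation of entropy for densities bounded above and away from 0 *)

Section entropy_path.
Context {R : realType} {n : nat} (gamma : probability 'rV[R]_n R).
Hypothesis gaussE : std_gaussian gamma.
Local Notation V := 'rV[R]_n.
Local Notation gamma2 := (gamma \x gamma)%E.

Variables (g : V -> R) (e B : R).
Hypotheses (C1g : C1 g) (e0 : 0 < e) (ge : forall x, e <= g x)
  (gB : forall x, g x <= B) (dgB : forall i x, `|grad g x 0 i| <= B).

Lemma path_gt0 x : 0 < g x. Proof. exact: lt_le_trans (ge x). Qed.

Let g0 x : 0 <= g x. Proof. exact: ltW (path_gt0 x). Qed.

Let B0 : 0 < B. Proof. exact: lt_le_trans (lt_le_trans e0 (ge 0)) (gB 0). Qed.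

Let mg : measurable_fun setT g. Proof. exact: measurable_C1. Qed.

Let gradE i x : grad g x 0 i = dotv (evec i) (grad g x).
Proof. by rewrite dotv_evec. Qed.

Let mgrad i : measurable_fun setT (fun x => grad g x 0 i).
Proof. by under eq_fun do rewrite gradE; exact: measurable_dgrad. Qed.

Lemma intR_bounded (a : V -> R) (K : R) : measurable_fun setT a ->
  (forall x, `|a x| <= K) -> intR gamma a.
Proof. by move=> ma aK; exact: intR_le ma aK (intR_cst gamma K). Qed.

Let ig : intR gamma g.
Proof. by apply: (intR_bounded (K := B)) => // x; rewrite ger0_norm. Qed.

(** The Ornstein-Uhlenbeck semigroup with the angle [t] as time, [cos t] replacing the exponential.
    The path is smooth at both ends: it starts from [a] at 0 and reaches the mean of [a] at pi/2. *)
Definition heat (a : V -> R) (t : R) (x : V) : R :=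
  rint gamma (fun y => a (cos t *: x + sin t *: y)).

Let mab (a b : R) (x : V) : measurable_fun setT (fun y : V => a *: x + b *: y).
Proof. by apply: measurable_rVD => //; exact: measurable_rVZ. Qed.

Let mz (t : R) (x : V) : measurable_fun setT (fun y : V => cos t *: x + sin t *: y).
Proof. exact: mab. Qed.

Let mz2 (t : R) : measurable_fun setT (fun p : V * V => cos t *: p.1 + sin t *: p.2).
Proof. by apply: measurable_rVD; exact: measurable_rVZ. Qed.

Lemma intR_heat (a : V -> R) K t x : measurable_fun setT a ->
  (forall x, `|a x| <= K) -> intR gamma (fun y => a (cos t *: x + sin t *: y)).
Proof.
move=> ma aK; apply: (intR_bounded (K := K)) => //.
exact: measurableT_comp ma (mz t x).
Qed.

Lemma measurable_heat (a : V -> R) K t : measurable_fun setT a ->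
  (forall x, `|a x| <= K) -> measurable_fun setT (heat a t).
Proof.
move=> ma aK.
have i2 : intR gamma2 (fun p => a (cos t *: p.1 + sin t *: p.2)).
  have [iK _] := intR_prod (intR_cst gamma K) (intR_cst gamma 1).
  apply: intR_le iK.
    exact: measurableT_comp ma (mz2 t).
  by move=> p; rewrite mulr1; exact: aK.
have [h _] := fubini_real1 i2.
exact: intR_meas h.
Qed.

Lemma heat_le (a : V -> R) K t x : measurable_fun setT a ->
  (forall x, `|a x| <= K) -> `|heat a t x| <= K.
Proof.
move=> ma aK; have ih := intR_heat t x ma aK.
rewrite (le_trans (le_normr_Rintegral measurableT ih))//.
rewrite -[leRHS](rint_cst gamma K); apply: le_rint => //; first exact: intR_abs.
exact: intR_cst.
Qed.

Let gBn x : `|g x| <= B. Proof. by rewrite ger0_norm. Qed.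

Lemma heat_ge t x : e <= heat g t x.
Proof.
rewrite -(rint_cst gamma e); apply: le_rint => //; first exact: intR_cst.
exact: intR_heat mg gBn.
Qed.

Let Qgt0 t x : 0 < heat g t x. Proof. exact: lt_le_trans (heat_ge t x). Qed.

Let QB t x : heat g t x <= B.
Proof. exact: le_trans (ler_norm _) (heat_le t x mg gBn). Qed.

Definition ent (r : R) : R := r * ln r.

Let A1 (x : V) : R := \sum_i `|x 0 i|.

Lemma intR_l1norm : intR gamma A1.
Proof.
apply: intR_sum => i; apply: intR_abs.
by apply: eq_intR (intR_dotv gaussE (evec i)) => x; rewrite dotv_evec.
Qed.

Lemma dotv_grad_le w x : `|dotv w (grad g x)| <= B * A1 w.
Proof.
rewrite /dotv (le_trans (ler_norm_sum _ _ _))// /A1 mulr_sumr ler_sum// => i _.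
by rewrite normrM mulrC ler_wpM2r.
Qed.

Lemma l1norm_circle_le (a b : R) (x y : V) : `|a| <= 1 -> `|b| <= 1 ->
  A1 (a *: x + b *: y) <= A1 x + A1 y.
Proof.
move=> a1 b1; rewrite /A1 -big_split/= ler_sum// => i _.
rewrite !mxE (le_trans (ler_normD _ _))// !normrM.
by apply: lerD; rewrite ler_piMl.
Qed.

Let cos1 t : `|cos t : R| <= 1. Proof. by rewrite ler_norml cos_geN1 cos_le1. Qed.
Let sin1 t : `|sin t : R| <= 1. Proof. by rewrite ler_norml sin_geN1 sin_le1. Qed.
Let Nsin1 t : `|- sin t : R| <= 1. Proof. by rewrite normrN. Qed.

Let dz t (p : V * V) := - sin t *: p.1 + cos t *: p.2.
Let z t (p : V * V) := cos t *: p.1 + sin t *: p.2.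

Let DQ t x := rint gamma (fun y => dotv (dz t (x, y)) (grad g (z t (x, y)))).

Let near1 (t : R) : t - 1 < t < t + 1.
Proof. by rewrite ltrDl ltr01 gtrBl ltr01. Qed.

Lemma is_derive_heat (t : R) (x : V) : is_derive t 1 (fun r => heat g r x) (DQ t x).
Proof.
apply: (@is_derive_rint _ _ _ gamma (fun r y => g (cos r *: x + sin r *: y))
  (fun r y => dotv (dz r (x, y)) (grad g (z r (x, y))))
  (fun y => B * (A1 x + A1 y)) t (t - 1) (t + 1) (near1 t)).
- by move=> r _; exact: intR_heat mg gBn.
- move=> r y _; exact: (@C1_is_derive_curve _ _ g C1g
    (fun r => cos r *: x + sin r *: y) (fun r => dz r (x, y)) r
    (is_derive_circle x y r)).
- apply: intRZ; apply: intRD; [exact: intR_cst|exact: intR_l1norm].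
- move=> r y _; rewrite (le_trans (dotv_grad_le _ _))// ler_pM2l//.
  exact: l1norm_circle_le.
Qed.

Let K1 := rint gamma A1.

Let idz t x : intR gamma (fun y => dotv (dz t (x, y)) (grad g (z t (x, y)))).
Proof.
apply: intR_le (intRZ B (intRD (intR_cst gamma (A1 x)) intR_l1norm)).
  apply: (measurable_dotv (mab _ _ _)).
  apply: measurable_rVP => i; exact: measurableT_comp (mgrad i) (mz t x).
move=> y; rewrite (le_trans (dotv_grad_le _ _))// ler_pM2l//.
exact: l1norm_circle_le.
Qed.

Lemma DQ_le t x : `|DQ t x| <= B * (A1 x + K1).
Proof.
rewrite (le_trans (le_normr_Rintegral measurableT (idz t x)))//.
have -> : B * (A1 x + K1) = rint gamma (fun y => B * (A1 x + A1 y)).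
  rewrite rintZ; last by apply: intRD; [exact: intR_cst|exact: intR_l1norm].
  by rewrite rintD ?rint_cst//; [exact: intR_cst|exact: intR_l1norm].
apply: le_rint; first exact: intR_abs.
- by apply: intRZ; apply: intRD; [exact: intR_cst|exact: intR_l1norm].
- move=> y; rewrite (le_trans (dotv_grad_le _ _))// ler_pM2l//.
  exact: l1norm_circle_le.
Qed.

Let CL := `|ln e| + `|ln B| + 1.

Lemma ln_heat_le t x : `|ln (heat g t x) + 1| <= CL.
Proof.
have h1 : ln e <= ln (heat g t x) by rewrite ler_ln ?posrE// heat_ge.
have h2 : ln (heat g t x) <= ln B by rewrite ler_ln ?posrE.
rewrite (le_trans (ler_normD _ _))// normr1 lerD2r ler_norml.
have := ler_norm (ln B); have := ler_norm (- ln e); rewrite normrN.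
by have := normr_ge0 (ln B); have := normr_ge0 (ln e); lra.
Qed.

Lemma ent_le t x : `|ent (heat g t x)| <= B * CL.
Proof.
rewrite /ent normrM; apply: ler_pM => //; first exact: heat_le.
have h1 : ln e <= ln (heat g t x) by rewrite ler_ln ?posrE// heat_ge.
have h2 : ln (heat g t x) <= ln B by rewrite ler_ln ?posrE.
rewrite /CL ler_norml.
have := ler_norm (ln B); have := ler_norm (- ln e); rewrite normrN.
by have := normr_ge0 (ln B); have := normr_ge0 (ln e); lra.
Qed.

Definition Ent t := rint gamma (fun x => ent (heat g t x)).

Lemma measurable_ent : measurable_fun setT ent.
Proof. by apply: measurable_funM => //; exact: measurable_ln. Qed.

Lemma is_derive_Ent (t : R) : is_derive t 1 Ent
  (rint gamma (fun x => (ln (heat g t x) + 1) * DQ t x)).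
Proof.
apply: (@is_derive_rint _ _ _ gamma (fun r x => ent (heat g r x))
  (fun r x => (ln (heat g r x) + 1) * DQ r x)
  (fun x => CL * (B * (A1 x + K1))) t (t - 1) (t + 1) (near1 t)).
- move=> r _; apply: (intR_bounded (K := B * CL)); last exact: ent_le.
  exact: measurableT_comp measurable_ent (measurable_heat r mg gBn).
- move=> r x _; rewrite /ent.
  have d1 := is_derive_heat r x.
  have d2 : is_derive r 1 (fun t => ln (heat g t x)) ((heat g r x)^-1 * DQ r x).
    exact: is_derive1_comp (is_derive1_ln (Qgt0 r x)) d1.
  apply: is_derive_eq; rewrite /GRing.scale/=; field.
  by rewrite gt_eqF.
- by do 2!apply: intRZ; apply: intRD; [exact: intR_l1norm|exact: intR_cst].
- move=> r x _; rewrite normrM ler_pM//; [exact: ln_heat_le|exact: DQ_le].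
Qed.



Let heatd (v : V) (t : R) (x : V) := heat (fun w => dotv v (grad g w)) t x.

Let mdg v : measurable_fun setT (fun w => dotv v (grad g w)).
Proof. exact: measurable_dgrad. Qed.

Let idgz v t x : intR gamma (fun y => dotv v (grad g (cos t *: x + sin t *: y))).
Proof. exact: intR_heat (mdg v) (dotv_grad_le v). Qed.

(** The commutation of the gradient with the semigroup; the factor [cos t] is the dependence of the
    evaluation point on [x]. *)
Lemma is_derive_heat_space (t : R) (x v : V) :
  is_derive x v (heat g t) (cos t * heatd v t x).
Proof.
apply: is_derive_of_line.
have zE (r : R) y : cos t *: (x + r *: v) + sin t *: y =
    (cos t *: x + sin t *: y) + r *: (cos t *: v).
  by rewrite scalerDr !scalerA (mulrC r) addrAC.
have -> : cos t * heatd v t x = rint gamma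
    (fun y => dotv (cos t *: v) (grad g (cos t *: (x + 0 *: v) + sin t *: y))).
  rewrite /heatd /heat -rintZ//; apply: eq_rint => y.
  by rewrite scale0r addr0 dotvZl.
apply: (@is_derive_rint _ _ _ gamma (fun (r : R) y => g (cos t *: (x + r *: v) + sin t *: y))
  (fun r y => dotv (cos t *: v) (grad g (cos t *: (x + r *: v) + sin t *: y)))
  (fun y => B * A1 (cos t *: v)) 0 (-1) 1).
- by rewrite ltrN10 ltr01.
- by move=> r _; exact: intR_heat mg gBn.
- move=> r y _; under eq_fun do rewrite zE.
  by rewrite zE; apply: is_derive_line; exact: is_derive_C1.
- exact: intR_cst.
- by move=> r y _; exact: dotv_grad_le.
Qed.

Let heatdZ k v t x : heatd (k *: v) t x = k * heatd v t x.
Proof. by rewrite /heatd /heat -rintZ//; apply: eq_rint => y; rewrite dotvZl. Qed.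

Let heatd_le v t x : `|heatd v t x| <= B * A1 v.
Proof. exact: heat_le (mdg v) (dotv_grad_le v). Qed.

Let ratio_le v t x : `|heatd v t x / heat g t x| <= B * A1 v / e.
Proof.
rewrite normrM normfV (ger0_norm (ltW (Qgt0 t x))); apply: ler_pM => //.
  by rewrite invr_ge0 ltW.
by rewrite lef_pV2 ?posrE// heat_ge.
Qed.

Let mheatd v t : measurable_fun setT (heatd v t).
Proof. exact: measurable_heat (mdg v) (dotv_grad_le v). Qed.

Let mheat t : measurable_fun setT (heat g t).
Proof. exact: measurable_heat mg gBn. Qed.

Lemma continuous_heatd_line (t : R) (x v w : V) :
  continuous (fun r : R => heatd w t (x + r *: v)).
Proof.
move=> a.
have zE (r : R) y : cos t *: (x + r *: v) + sin t *: y =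
    (cos t *: x + sin t *: y) + r *: (cos t *: v).
  by rewrite scalerDr !scalerA (mulrC r) addrAC.
apply: (@continuous_rint _ _ _ gamma (fun (r : R) y =>
  dotv w (grad g (cos t *: (x + r *: v) + sin t *: y))) (fun=> B * A1 w) a (a - 1) (a + 1)).
- exact: near1.
- by move=> r _; exact: measurableT_comp (mdg w) (mz t _).
- move=> y; under eq_fun do rewrite zE.
  exact: (@continuous_on_line _ _ (fun w' => dotv w (grad g w')) _ _
    (@continuous_dgrad _ _ _ C1g w)).
- exact: intR_cst.
- by move=> r y _; exact: dotv_grad_le.
Qed.

Let A t x := ln (heat g t x) + 1.

Let mA t : measurable_fun setT (A t).
Proof.
by apply: measurable_funD => //; exact: measurableT_comp (@measurable_ln R) (mheat t).
Qed.

Lemma is_derive_ln_heat (t : R) (x v : V) :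
  is_derive x v (A t) ((heat g t x)^-1 * (cos t * heatd v t x)).
Proof.
apply: is_derive_of_line.
have d1 : is_derive (0 : R) 1 (fun r : R => heat g t (x + r *: v)) (cos t * heatd v t x).
  by apply: is_derive_line; rewrite scale0r addr0; exact: is_derive_heat_space.
have q0 : 0 < heat g t (x + (0 : R) *: v) by [].
have d2 : is_derive (0 : R) 1 (fun r : R => ln (heat g t (x + r *: v))) _ :=
  is_derive1_comp (is_derive1_ln q0) d1.
have -> : heat g t x = heat g t (x + (0 : R) *: v) by rewrite scale0r addr0.
by apply: is_derive_eq; rewrite addr0.
Qed.

Lemma continuous_heat_line (t : R) (x v : V) :
  continuous (fun r : R => heat g t (x + r *: v)).
Proof.
apply: derivable1_continuous => r.
by have [] := is_derive_line (is_derive_heat_space t (x + r *: v) v).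
Qed.

(** Integration by parts in [y]: [sin t] comes from the dependence of the point on [y], [cos t] from
    the commutation of gradient and semigroup. *)
Lemma rint_coord_ln_heat (t : R) (x v : V) :
  rint gamma (fun y => dotv v y * A t (cos t *: x + sin t *: y)) =
  sin t * cos t * rint gamma (fun y => heatd v t (cos t *: x + sin t *: y) /
    heat g t (cos t *: x + sin t *: y)).
Proof.
pose w y := cos t *: x + sin t *: y.
have wE y (r : R) : w (y + r *: v) = w y + r *: (sin t *: v).
  by rewrite /w scalerDr !scalerA (mulrC r) addrA.
pose G y := A t (w y).
pose Q y := heatd v t (w y) / heat g t (w y).
have mQ : measurable_fun setT Q.
  apply: measurable_funM; first exact: measurableT_comp (mheatd v t) (mz t x).
  exact: measurableT_comp (@measurable_invr R) (measurableT_comp (mheat t) (mz t x)).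
have QE y : `|Q y| <= B * A1 v / e by exact: ratio_le.
have iQ : intR gamma Q := intR_bounded mQ QE.
have mG : measurable_fun setT G by exact: measurableT_comp (mA t) (mz t x).
have GE y : `|G y| <= CL by exact: ln_heat_le.
have iG : intR gamma G := intR_bounded mG GE.
have iyG : intR gamma (fun y => dotv v y * G y).
  apply: intR_le (intRZ CL (intR_abs (intR_dotv gaussE v))).
    by apply: measurable_funM => //; exact: measurable_dotvl.
  by move=> y; rewrite normrM mulrC ler_wpM2r.
have h := @gauss_ibp _ _ _ gaussE v G (fun y => sin t * cos t * Q y) _ _ _ iG.
apply/esym/eqP; rewrite -subr_eq0 -rintZ// -rintB//; last exact: intRZ.
apply/eqP/h => [y|y||].
- apply: is_derive_of_line; rewrite /G; under eq_fun do rewrite wE.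
  have -> : sin t * cos t * Q y = (heat g t (w y))^-1 * (cos t * heatd (sin t *: v) t (w y)).
    by rewrite heatdZ /Q; ring.
  by apply: is_derive_line; rewrite scale0r addr0; exact: is_derive_ln_heat.
- have cQ : continuous (fun r : R => heatd v t (w y + r *: (sin t *: v)) *
      (heat g t (w y + r *: (sin t *: v)))^-1).
    move=> r; apply: cvgM; first exact: continuous_heatd_line.
    by apply: cvgV; [rewrite gt_eqF|exact: continuous_heat_line].
  move=> r; rewrite /Q; under eq_fun do rewrite wE.
  exact: (cvgM (cvg_cst (sin t * cos t)) (cQ r)).
- exact: measurable_funM.
- by apply: intRB => //; exact: intRZ.
Qed.

(** The Fisher information integrand of [heat g t] without its factor cos^2 t. *)
Let dissip t x := (\sum_i heatd (evec i) t x ^+ 2) / heat g t x.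

Let iA12 k : intR gamma2 (fun p => k * (A1 p.1 + A1 p.2)).
Proof.
have [h1 _] := intR_prod intR_l1norm (intR_cst gamma 1).
have [h2 _] := intR_prod (intR_cst gamma 1) intR_l1norm.
by apply: eq_intR (intRZ k (intRD h1 h2)) => p; rewrite mulr1 mul1r.
Qed.

(** De Bruijn's identity. The derivative of the entropy is a double integral in which the logarithm
    depends on [x] and the gradient on the moving point; the reflection exchanges these two, after
    which integration by parts in [y] acts on the logarithm. *)
Lemma rint_ent_derive t : 0 < sin t ->
  rint gamma (fun x => A t x * DQ t x) = - (sin t * cos t) * rint gamma (dissip t).
Proof.
move=> st; have cs : cos t ^+ 2 + sin t ^+ 2 = 1 by rewrite addrC sin2cos2 subrK.
pose F p := A t p.1 * dotv (dz t p) (grad g (z t p)).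
have mgz : measurable_fun setT (fun p => grad g (z t p)).
  by apply: measurable_rVP => i; exact: measurableT_comp (mgrad i) (mz2 t).
have mA1 : measurable_fun setT (fun p : V * V => A t p.1).
  exact: measurableT_comp (mA t) measurable_fst.
have mF : measurable_fun setT F.
  apply: measurable_funM => //; apply: measurable_dotv => //.
  by apply: measurable_rVD; exact: measurable_rVZ.
have iF : intR gamma2 F.
  apply: (intR_le mF _ (iA12 (CL * B))) => p; rewrite normrM -mulrA.
  apply: ler_pM => //; first exact: ln_heat_le.
  rewrite (le_trans (dotv_grad_le _ _))// ler_pM2l//.
  exact: l1norm_circle_le.
transitivity (rint gamma2 F).
  have [_ <-] := fubini_real1 iF; apply: eq_rint => x.
  by rewrite /F /DQ -rintZ.
rewrite -(rint_rot gaussE st cs mF).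
have iFr := intR_rot gaussE st cs iF.
have [_ <-] := fubini_real1 iFr.
(* Both sides are compared with this integrand: integrating it in [y] gives [dissip], and after the
   reflection it is what integration by parts produces. *)
pose M p := \sum_i heatd (evec i) t p.1 / heat g t p.1 * dotv (evec i) (grad g (z t p)).
have mM : measurable_fun setT M.
  apply: measurable_sum => i; apply: measurable_funM.
    apply: measurable_funM; first exact: measurableT_comp (mheatd _ t) measurable_fst.
    exact: measurableT_comp (@measurable_invr R) (measurableT_comp (mheat t) measurable_fst).
  by apply: measurable_dotv.
have Me p : `|M p| <= (\sum_(i < n) B * A1 (evec i) / e * (B * A1 (evec i))) * 1.
  rewrite mulr1 (le_trans (ler_norm_sum _ _ _))// ler_sum// => i _.
  by rewrite normrM; apply: ler_pM => //; exact: dotv_grad_le.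
have iM : intR gamma2 M.
  have [iK _] := intR_prod (intR_cst gamma (\sum_(i < n) B * A1 (evec i) / e * (B * A1 (evec i)))) (intR_cst gamma 1).
  exact: intR_le mM Me iK.
have -> : rint gamma (dissip t) = rint gamma2 M.
  have [_ <-] := fubini_real1 iM; apply: eq_rint => x.
  rewrite /M /= rint_sum; last by move=> i; apply: intRZ; exact: idgz.
  rewrite /dissip mulr_suml; apply: eq_bigr => i _.
  rewrite rintZ; last exact: idgz.
  by rewrite expr2 mulrAC.
rewrite -(rint_rot gaussE st cs mM).
have iMr := intR_rot gaussE st cs iM.
have [iMx <-] := fubini_real1 iMr.
rewrite -rintZ//; apply: eq_rint => x.
(* After the reflection the moving point is [x] and its velocity is [-y], so the gradient of [g] is
   constant in [y]. *)
have zr y : z t (rot (cos t) (sin t) (x, y)) = x.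
  by have /(congr1 fst) := rotK (x, y) cs.
have dzr y : dz t (rot (cos t) (sin t) (x, y)) = - y.
  have -> p : dz t p = - (rot (cos t) (sin t) p).2.
    by rewrite /dz /rot /= opprB scaleNr addrC.
  by rewrite rotK.
have iL i : intR gamma (fun y => - grad g x 0 i * (dotv (evec i) y * A t (cos t *: x + sin t *: y))).
  apply: intRZ; apply: intR_le (intRZ CL (intR_abs (intR_dotv gaussE (evec i)))).
    apply: measurable_funM; first exact: measurable_dotvl.
    exact: measurableT_comp (mA t) (mz t x).
  by move=> y; rewrite normrM mulrC ler_wpM2r//; exact: ln_heat_le.
have iL2 i : intR gamma (fun y => grad g x 0 i * (heatd (evec i) t (cos t *: x + sin t *: y) /
    heat g t (cos t *: x + sin t *: y))).
  apply: intRZ; apply: (intR_bounded (K := B * A1 (evec i) / e)).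
    apply: measurable_funM; first exact: measurableT_comp (mheatd _ t) (mz t x).
    exact: measurableT_comp (@measurable_invr R) (measurableT_comp (mheat t) (mz t x)).
  by move=> y; exact: ratio_le.
transitivity (\sum_i - grad g x 0 i * (sin t * cos t * rint gamma
    (fun y => heatd (evec i) t (cos t *: x + sin t *: y) / heat g t (cos t *: x + sin t *: y)))).
  rewrite -(eq_bigr _ (fun i _ => congr1 ( *%R (- grad g x 0 i)) (rint_coord_ln_heat t x (evec i)))).
  transitivity (rint gamma (fun y => \sum_i - grad g x 0 i *
      (dotv (evec i) y * A t (cos t *: x + sin t *: y)))).
    apply: eq_rint => y; rewrite /F dzr zr /rot /= /dotv mulr_sumr.
    by apply: eq_bigr => i _; rewrite -/(dotv (evec i) y) dotv_evec mxE; ring.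
  rewrite rint_sum//; apply: eq_bigr => i _; rewrite rintZ//.
  apply: intR_le (intRZ CL (intR_abs (intR_dotv gaussE (evec i)))).
    apply: measurable_funM; first exact: measurable_dotvl.
    exact: measurableT_comp (mA t) (mz t x).
  by move=> y; rewrite normrM mulrC ler_wpM2r//; exact: ln_heat_le.
transitivity (- (sin t * cos t) * rint gamma (fun y => \sum_i grad g x 0 i *
    (heatd (evec i) t (cos t *: x + sin t *: y) / heat g t (cos t *: x + sin t *: y)))).
  rewrite rint_sum// mulr_sumr; apply: eq_bigr => i _.
  rewrite rintZ; first by ring.
  apply: (intR_bounded (K := B * A1 (evec i) / e)).
    apply: measurable_funM; first exact: measurableT_comp (mheatd _ t) (mz t x).
    exact: measurableT_comp (@measurable_invr R) (measurableT_comp (mheat t) (mz t x)).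
  by move=> y; exact: ratio_le.
congr (_ * _); apply: eq_rint => y; rewrite /M zr /rot /=.
by apply: eq_bigr => i _; rewrite dotv_evec; ring.
Qed.



Let measurable_sqrt : measurable_fun setT (@Num.sqrt R).
Proof. exact: continuous_measurable_fun (@sqrt_continuous R). Qed.

Variable u : V.
Hypothesis u1 : dotv u u = 1.

Let nrm2 x := dotv (grad g x) (grad g x) / g x.

Let grad_sqr_le x : dotv (grad g x) (grad g x) <= \sum_(i < n) B * B.
Proof.
apply: ler_sum => i _; rewrite -expr2 -real_normK ?num_real// expr2.
by apply: ler_pM.
Qed.

Let iI : intR gamma nrm2.
Proof.
apply: (intR_bounded (K := (\sum_(i < n) B * B) / e)).
  apply: measurable_funM; last exact: measurableT_comp (@measurable_invr R) mg.
  by apply: measurable_dotv; apply: measurable_rVP.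
move=> x; rewrite ger0_norm; last by rewrite mulr_ge0 ?dotv_ge0 ?invr_ge0.
apply: ler_pM; rewrite ?dotv_ge0 ?invr_ge0//.
by rewrite lef_pV2 ?posrE// path_gt0.
Qed.

Let iG : intR gamma (fun x => dotv u x ^+ 2 * g x).
Proof.
apply: intR_le (intRZ B (intR_dotv_sqr gaussE u)).
  by apply: measurable_funM => //; apply: measurable_funX; exact: measurable_dotvl.
move=> x; rewrite ger0_norm; last by rewrite mulr_ge0 ?sqr_ge0.
by rewrite mulrC ler_wpM2r ?sqr_ge0.
Qed.

Let m := mass gamma g.
Let S := second gamma g u.
Let j := finfo gamma g u.

(** The averaged gradient does not change when a field [b] of mean zero in [y] is added along [u].
    Cauchy-Schwarz with weight [g] is applied to this modified gradient: its part orthogonal to [u]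
    contributes |grad g|^2/g minus the part along [u], and its component along [u] is a mixed score
    times [g]. *)
Lemma dissip_le t l : 0 < sin t ->
  intR gamma (dissip t) /\ rint gamma (dissip t) <= rint gamma nrm2 - j +
    (l ^+ 2 * j + 2 * l * (1 - l) * (S - m) +
     (1 - l) ^+ 2 * (S + m * (cos t / sin t) ^+ 2)).
Proof.
move=> st; have cs : cos t ^+ 2 + sin t ^+ 2 = 1 by rewrite addrC sin2cos2 subrK.
have idis : intR gamma (dissip t).
  apply: (intR_bounded (K := (\sum_(i < n) (B * A1 (evec i)) ^+ 2) / e)).
    apply: measurable_funM; last exact: measurableT_comp (@measurable_invr R) (mheat t).
    by apply: measurable_sum => i; exact: measurable_funX.
  move=> x; rewrite ger0_norm; last first.
    apply: mulr_ge0; last by rewrite invr_ge0 ltW.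
    by apply: sumr_ge0 => i _; exact: sqr_ge0.
  apply: ler_pM; [by apply: sumr_ge0 => i _; exact: sqr_ge0|by rewrite invr_ge0 ltW| |].
    apply: ler_sum => i _; rewrite -[leLHS]real_normK ?num_real//.
    by rewrite !expr2; apply: ler_pM.
  by rewrite lef_pV2 ?posrE// heat_ge.
split => //.
have is2 := intR_score_sqr C1g g0 u1 iI.
pose P w := nrm2 w - score g u w ^+ 2 * g w.
have iP : intR gamma P by exact: intRB.
have [iF <-] := rint_mixed_score gaussE C1g g0 u1 ig iI iG st cs l.
set F := (fun p : V * V => _) in iF *.
have iPz := intR_z gaussE st cs iP.
have -> : rint gamma nrm2 - j = rint gamma P by rewrite rintB.
rewrite -(rint_z gaussE st cs iP) -rintD//.
have iPF := intRD iPz iF.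
have [iX <-] := fubini_real1 iPF.
apply: le_rint_ae => //.
have a1 := ae_dgrad_z gaussE C1g g0 u1 ig iI iG st cs.
have a2 := ae_intR1 (intR_z gaussE st cs (intR_dgrad C1g g0 u1 ig iI)).
have a3 := ae_intR1 (intR_dotv2_z gaussE C1g g0 ig iG st cs).
have a4 := ae_intR1 iPF.
apply: filterS2 (filterI a1 a2) (filterI a3 a4) => x [x1 x2] [x3 x4].
pose zy y := cos t *: x + sin t *: y.
(* By [ae_dgrad_z] this has mean zero in [y] for almost every [x]. *)
pose b y := (1 - l) * ((sin t)^-1 * (dotv u y * g (zy y)) - dotv u (grad g (zy y))).
have ib : intR gamma b by apply: intRZ; apply: intRB => //; exact: intRZ.
have b0 : rint gamma b = 0.
  rewrite /b rintZ; last by apply: intRB => //; exact: intRZ.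
  rewrite rintB//; last exact: intRZ.
  by rewrite rintZ// -x1 mulKf ?gt_eqF// subrr mulr0.
pose W i y := grad g (zy y) 0 i + u 0 i * b y.
have igz i : intR gamma (fun y => grad g (zy y) 0 i) by exact: intR_heat (mgrad i) (dgB i).
have iW i : intR gamma (W i) by apply: intRD => //; exact: intRZ.
have WE i : heatd (evec i) t x = rint gamma (W i).
  rewrite /W rintD//; last exact: intRZ.
  rewrite rintZ// b0 mulr0 addr0; apply: eq_rint => y.
  by rewrite dotv_evec.
have sumW y : \sum_i W i y ^+ 2 / g (zy y) = P (zy y) + F (x, y).
  have gn0 : g (zy y) != 0 by rewrite gt_eqF// path_gt0.
  have sn0 : sin t != 0 by rewrite gt_eqF.
  rewrite -mulr_suml.
  have -> : \sum_i W i y ^+ 2 = dotv (grad g (zy y)) (grad g (zy y)) +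
      2 * b y * dotv u (grad g (zy y)) + b y ^+ 2 * dotv u u.
    rewrite /dotv !mulr_sumr -!big_split /=; apply: eq_bigr => i _.
    by rewrite /W; ring.
  rewrite u1 mulr1 /F /P /nrm2 /score /= -/(zy y) /b.
  by field; rewrite gn0 sn0.
have mgz : measurable_fun setT (fun y => g (zy y)) by exact: measurableT_comp mg (mz t x).
have mW i : measurable_fun setT (W i) by exact: intR_meas (iW i).
(* The product [W i] is split as (W / sqrt g) * sqrt g for Cauchy-Schwarz. *)
have mWg i : measurable_fun setT (fun y => W i y / Num.sqrt (g (zy y))).
  apply: measurable_funM => //; apply: measurableT_comp (@measurable_invr R) _.
  exact: measurableT_comp measurable_sqrt mgz.
have sq y : Num.sqrt (g (zy y)) ^+ 2 = g (zy y) by rewrite sqr_sqrtr.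
have WgE i y : (W i y / Num.sqrt (g (zy y))) ^+ 2 = W i y ^+ 2 / g (zy y).
  by rewrite expr_div_n sq.
have iWg i : intR gamma (fun y => W i y ^+ 2 / g (zy y)).
  apply: intR_le x4.
    apply: measurable_funM; first exact: measurable_funX.
    exact: measurableT_comp (@measurable_invr R) mgz.
  move=> y; rewrite ger0_norm; last by rewrite mulr_ge0 ?sqr_ge0 ?invr_ge0.
  rewrite -[leRHS]sumW (bigD1 i)//= lerDl sumr_ge0// => k _.
  by rewrite mulr_ge0 ?sqr_ge0 ?invr_ge0.
rewrite /dissip ler_pdivrMr//.
rewrite -(eq_rint _ sumW) rint_sum// mulr_suml; apply: ler_sum => i _.
rewrite WE.
have := @rint_cauchy_schwarz _ _ _ gamma (fun y => W i y / Num.sqrt (g (zy y)))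
  (fun y => Num.sqrt (g (zy y))) (mWg i).
have e1 y : W i y / Num.sqrt (g (zy y)) * Num.sqrt (g (zy y)) = W i y.
  by rewrite divfK// gt_eqF// sqrtr_gt0 path_gt0.
rewrite (eq_rint _ e1) (eq_rint _ (WgE i)) (eq_rint _ sq); apply.
- exact: measurableT_comp measurable_sqrt mgz.
- by apply: eq_intR (iWg i) => y; rewrite WgE.
- by apply: eq_intR (intR_heat t x mg gBn) => y; rewrite sq.
Qed.

(** [jb] and [Ab] bound the Fisher information along and across [u]; [eta] measures how far mass and
    second moment are from those of a normalised density, so that the estimate applies to truncated
    densities. *)
Lemma entropy_nice_le (Ab jb eta : R) : 0 <= eta -> 0 <= jb ->
  rint gamma nrm2 - j <= Ab -> j <= jb -> S <= 1 + eta ->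
  1 - eta <= m -> m <= 1 + eta ->
  rint gamma (fun x => ent (g x)) <=
    ent m + 2^-1 * (Ab + eta * (1 + jb ^+ 2)) + 2^-1 * ln (1 + jb).
Proof.
move=> eta0 jb0 hA hj hS hm1 hm2.
pose C := Ab + eta * (1 + jb ^+ 2).
have p1 t : 0 < 1 + sin t ^+ 2 * jb by rewrite ltr_pwDl// mulr_ge0 ?sqr_ge0.
(* A primitive of sin t cos t times the bound on the dissipation proved in [K_le]. *)
pose G t := 2^-1 * (C * sin t ^+ 2) + 2^-1 * ln (1 + sin t ^+ 2 * jb).
have dG (t : R) : is_derive t 1 G (sin t * cos t * (C + jb / (1 + sin t ^+ 2 * jb))).
  have d1 : is_derive t 1 (fun t => 1 + sin t ^+ 2 * jb) (2 * sin t * cos t * jb).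
    by apply: is_derive_eq; rewrite /GRing.scale/=; ring.
  have d2 : is_derive t 1 (fun t => ln (1 + sin t ^+ 2 * jb))
      ((1 + sin t ^+ 2 * jb)^-1 * (2 * sin t * cos t * jb)).
    exact: (@is_derive1_comp R (@ln R) _ t _ _ (is_derive1_ln (p1 t)) d1).
  rewrite /G; apply: is_derive_eq; rewrite /GRing.scale/=; field.
  by rewrite gt_eqF.
have dE (t : R) : 0 < sin t -> is_derive t 1 Ent (- (sin t * cos t) * rint gamma (dissip t)).
  by move=> st; rewrite -rint_ent_derive//; exact: is_derive_Ent.
have K_le t : 0 < sin t -> rint gamma (dissip t) <= C + jb / (1 + sin t ^+ 2 * jb).
  (* The minimiser of l^2 jb + (1 - l)^2 / sin^2 t; the minimum is jb / (1 + jb sin^2 t), which is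
     [h5]. *)
  move=> st; pose l := (1 + sin t ^+ 2 * jb)^-1.
  have [_ h] := dissip_le l st; apply: (le_trans h).
  have l0 : 0 < l by rewrite invr_gt0.
  have l1 : l <= 1 by rewrite invf_le1// lerDl mulr_ge0 ?sqr_ge0.
  have c2 : cos t ^+ 2 = 1 - sin t ^+ 2 by rewrite cos2sin2.
  have sn0 : sin t != 0 by rewrite gt_eqF.
  have pn0 : 1 + sin t ^+ 2 * jb != 0 by rewrite gt_eqF.
  have h1 : l ^+ 2 * j <= l ^+ 2 * jb by rewrite ler_wpM2l ?sqr_ge0.
  (* Here l (1 - l) <= 1/4 and S - m <= 2 eta. *)
  have h2 : 2 * l * (1 - l) * (S - m) <= eta.
    have : l * (1 - l) <= 4^-1.
      by rewrite -subr_ge0 (_ : _ - _ = (l - 2^-1) ^+ 2) ?sqr_ge0//; field.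
    have : 0 <= l * (1 - l) by rewrite mulr_ge0 ?subr_ge0// ltW.
    have : S - m <= 2 * eta by lra.
    move: (S - m) => D; set w := l * (1 - l) => D2 w0 w4.
    rewrite -(mulrA 2) -/w; nra.
  have h3 : (1 - l) ^+ 2 * (S + m * (cos t / sin t) ^+ 2) <=
      (1 + eta) * ((1 - l) / sin t) ^+ 2.
    have -> : (1 + eta) * ((1 - l) / sin t) ^+ 2 =
        (1 - l) ^+ 2 * ((1 + eta) + (1 + eta) * (cos t / sin t) ^+ 2).
      by rewrite !expr_div_n c2; field.
    by rewrite ler_wpM2l ?sqr_ge0// lerD// ler_wpM2r ?sqr_ge0.
  have h4 : ((1 - l) / sin t) ^+ 2 <= jb ^+ 2.
    have -> : (1 - l) / sin t = sin t * jb * l by rewrite /l; field; rewrite sn0 pn0.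
    have s1 : sin t ^+ 2 <= 1 by rewrite -[leRHS](cos2Dsin2 t) lerDr sqr_ge0.
    rewrite 2!exprMn mulrAC ler_piMl ?sqr_ge0// mulr_ile1 ?sqr_ge0//.
    by rewrite expr_le1// ltW.
  have h5 : l ^+ 2 * jb + ((1 - l) / sin t) ^+ 2 = jb / (1 + sin t ^+ 2 * jb).
    by rewrite /l; field; rewrite sn0 pn0.
  rewrite /C; nra.
have ph : (0 : R) < pi / 2 by rewrite divr_gt0 ?pi_gt0.
have sp t : t \in `]0, (pi / 2 : R)[ -> 0 < sin t /\ 0 < cos t.
  rewrite in_itv/= => /andP[t0 tp]; split.
    by apply: sin_gt0_pi; rewrite t0/= (lt_trans tp)// ltr_pdivrMr// ltr_pMr ?pi_gt0// ltr1n.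
  by apply: cos_gt0_pihalf; rewrite tp andbT (lt_trans _ t0)// oppr_lt0.
(* [H] is nondecreasing on [0, pi/2]; its end values contain the entropy of [g] and [ent] of the
   mass. *)
pose H t := Ent t + G t.
have dH (t : R) : t \in `]0, (pi / 2 : R)[ -> is_derive t 1 H
    (- (sin t * cos t) * rint gamma (dissip t) + sin t * cos t * (C + jb / (1 + sin t ^+ 2 * jb))).
  move=> /sp[s0 c0]; have d1 := dE t s0; have d2 := dG t.
  exact: is_deriveD.
have cH : continuous H.
  apply: derivable1_continuous => t; apply: derivableD; last by have [] := dG t.
  by have [] := is_derive_Ent t.
have := @ger0_derive1_le_cc R H 0 (pi / 2).
move=> /(_ _ _ (continuous_subspaceT cH)) h.
have H0 : H 0 <= H (pi / 2).
  apply: h; rewrite ?in_itv/= ?lexx ?ltW//.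
  - by move=> t /dH[].
  - move=> t /[dup] /sp[s0 c0] /dH[_]; rewrite derive1E => ->.
    rewrite mulNr addrC subr_ge0 ler_wpM2l//; last exact: K_le.
    by rewrite mulr_ge0// ltW.
have E0 : Ent 0 = rint gamma (fun x => ent (g x)).
  apply: eq_rint => x; rewrite /heat; congr ent.
  rewrite -[RHS](rint_cst gamma (g x)); apply: eq_rint => y.
  by rewrite cos0 sin0 scale1r scale0r addr0.
have E1 : Ent (pi / 2) = ent m.
  rewrite -[RHS](rint_cst gamma (ent m)); apply: eq_rint => x; congr ent.
  by apply: eq_rint => y; rewrite cos_pihalf sin_pihalf scale1r scale0r add0r.
move: H0; rewrite /H E0 E1 /G sin0 sin_pihalf expr0n/= mulr0 mulr0 mul0r addr0 ln1.
by rewrite expr1n mulr1 mul1r mulr0 !addr0 addrA -/C.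
Qed.

End entropy_path.

(** * Fatou's lemma with real bounds *)

Section fatou.
Context d (T : measurableType d) {R : realType}
  (mu : {measure set T -> \bar R}).

Lemma fatou_real (F : nat -> T -> R) (f : T -> R) (b : nat -> R) (L : R) :
  (forall k, measurable_fun setT (F k)) -> (forall k x, 0 <= F k x) ->
  (forall x, F ^~ x @ \oo --> f x) ->
  (forall k, \int[mu]_x (F k x)%:E <= (b k)%:E)%E -> b @ \oo --> L ->
  measurable_fun setT f -> intR mu f /\ rint mu f <= L.
Proof.
move=> mF F0 cF Fb bL mf.
have f0 x : 0 <= f x.
  rewrite -(cvg_lim _ (cF x))//; apply: limr_ge; last exact: nearW.
  by apply/cvg_ex; exists (f x).
have h : (\int[mu]_x (f x)%:E <= L%:E)%E.
  have mFE k : measurable_fun setT (EFin \o F k) by apply/measurable_EFinP; exact: mF.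
  have h0 := @fatou _ T R mu setT measurableT (fun k x => (F k x)%:E) mFE
    (fun k x _ => F0 k x).
  have e1 : (\int[mu]_x limn_einf ((fun k x => (F k x)%:E)^~ x) = \int[mu]_x (f x)%:E)%E.
    apply: eq_integral => x _.
    have cFx : (fun k => (F k x)%:E) @ \oo --> (f x)%:E.
      by apply: cvg_EFin => //; [exact: nearW|exact: cF].
    by have [-> _] := cvg_limn_einf_sup cFx.
  rewrite -e1; apply: le_trans h0 _.
  rewrite limn_einf_lim.
  have bL' : (fun k => (b k)%:E) @ \oo --> L%:E by apply: cvg_EFin => //; exact: nearW.
  rewrite -(cvg_lim _ bL')//; apply: lee_lim.
  - exact: is_cvg_einfs.
  - by apply/cvg_ex; exists L%:E.
  - apply: nearW => k; apply: le_trans (Fb k).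
    by apply: ereal_inf_lbound; exists k => /=.
have fi : intR mu f by apply/(intRP mu mf f0); exact: le_lt_trans h (ltry _).
by split => //; rewrite -lee_fin rintE.
Qed.

End fatou.

(** * The squared positive part and the function r ln r *)

Section quadratic_error.
Context {R : realType}.

Lemma is_derive_quadratic (h : R -> R) (s d K : R) :
  (forall t, `|h (t + s) - h s - t * d| <= K * t ^+ 2) -> is_derive s 1 h d.
Proof.
move=> hq.
have K0 : 0 <= K.
  by have := hq 1; rewrite expr1n mulr1; apply: le_trans.
have c : (fun t : R => t^-1 *: ((h \o shift s) (t *: (1 : R)) - h s)) @ 0^' --> d.
  apply/cvgrPdist_le => e e0; near=> t.
  have t0 : t != 0 by near: t; exact: nbhs_dnbhs_neq.
  have te : `|t| <= e / (K + 1).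
    near: t; apply: dnbhs0_le.
    by rewrite divr_gt0// ltr_wpDl.
  rewrite /= scaler1 distrC.
  have -> : t^-1 *: (h (t + s) - h s) - d = t^-1 * (h (t + s) - h s - t * d).
    by rewrite /GRing.scale/=; field.
  rewrite normrM normfV ler_pdivrMl ?normr_gt0// (le_trans (hq t))//.
  rewrite -[t ^+ 2]real_normK ?num_real// expr2 mulrCA ler_wpM2l//.
  rewrite (le_trans (ler_wpM2l K0 te))// mulrCA ler_piMr ?ltW//.
  by rewrite ltr_pdivrMr ?mul1r ?ltrDl// ltr_wpDl.
split; first by apply/cvg_ex; exists d.
exact: cvg_lim c.
Unshelve. all: by end_near. Qed.

(** Squaring removes the corner of the positive part at 0, which keeps the truncated density C^1. *)
Lemma is_derive_pos_sqr (s : R) :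
  is_derive s 1 (fun s => Num.max 0 s ^+ 2) (2 * Num.max 0 s).
Proof.
apply: (@is_derive_quadratic _ _ _ 1) => t; rewrite mul1r ler_norml.
by have [s0|s0] := lerP 0 s; have [ts0|ts0] := lerP 0 (t + s); apply/andP; split; nra.
Qed.

Lemma ent_ge (r : R) : 0 <= r -> -1 <= ent r.
Proof.
rewrite /ent le_eqVlt => /predU1P[<-|r0]; first by rewrite mul0r lerN10.
have h : ln r^-1 <= r^-1 - 1.
  have -> : r^-1 = 1 + (r^-1 - 1) by rewrite addrC subrK.
  by rewrite [leRHS]addrAC subrr add0r le_ln1Dx// ltrBrDr addrC subrr invr_gt0.
rewrite lnV ?posrE// in h.
have : r * (- ln r) <= r * (r^-1 - 1) by rewrite ler_wpM2l// ltW.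
rewrite mulrBr mulfV ?gt_eqF// mulr1 mulrN; lra.
Qed.

Lemma ent_le_sqr (r : R) : 0 < r -> ent r <= r * (r - 1).
Proof.
move=> r0; rewrite /ent; apply: ler_wpM2l; first exact: ltW.
have -> : ln r = ln (1 + (r - 1)) by rewrite addrC subrK.
by rewrite le_ln1Dx// ltrBrDr addrC subrr.
Qed.

(** From r ln r = 2 sqrt r (sqrt r ln (sqrt r)) and the lower bound -1 on the bracket, r ln r lies
    between -2 sqrt r and 0 near 0. *)
Lemma continuous_ent0 : ent @ (0 : R)^'+ --> (0 : R).
Proof.
have sq0 : (fun x : R => - (2 * Num.sqrt x)) @ (0 : R)^'+ --> (0 : R).
  apply: cvg_at_right_filter.
  rewrite [X in _ --> X](_ : 0 = - (2 * Num.sqrt 0)); last by rewrite sqrtr0 mulr0 oppr0.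
  by apply: cvgN; apply: cvgM; [exact: cvg_cst|exact: sqrt_continuous].
apply: (squeeze_cvgr _ sq0 (cvg_cst 0)).
near=> x.
have x0 : 0 < x by near: x; exact: nbhs_right_gt.
have x1 : x <= 1 by near: x; exact: nbhs_right_le.
apply/andP; split; last first.
  by rewrite /ent pmulr_rle0// ln_le0.
have s0 : 0 < Num.sqrt x by rewrite sqrtr_gt0.
have -> : ent x = 2 * Num.sqrt x * ent (Num.sqrt x).
  rewrite /ent -{1 2}[x]sqr_sqrtr ?ltW// lnXn//; ring.
rewrite -mulrN1; apply: ler_wpM2l; last exact: ent_ge (ltW s0).
by rewrite mulr_ge0// ltW.
Unshelve. all: by end_near. Qed.

End quadratic_error.

Section continuous_real.
Context {T : topologicalType} {R : realType}.
Implicit Types f h : T -> R.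

Lemma cont_cst (k : R) : continuous (fun _ : T => k).
Proof. by move=> x; exact: cvg_cst. Qed.

Lemma contD f h : continuous f -> continuous h -> continuous (fun x => f x + h x).
Proof. by move=> cf ch x; apply: cvgD; [exact: cf|exact: ch]. Qed.

Lemma contB f h : continuous f -> continuous h -> continuous (fun x => f x - h x).
Proof. by move=> cf ch x; apply: cvgB; [exact: cf|exact: ch]. Qed.

Lemma contM f h : continuous f -> continuous h -> continuous (fun x => f x * h x).
Proof. by move=> cf ch x; apply: cvgM; [exact: cf|exact: ch]. Qed.

Lemma cont_sum (I : Type) (r : seq I) (F : I -> T -> R) :
  (forall i, continuous (F i)) -> continuous (fun x => \sum_(i <- r) F i x).
Proof.
move=> cF; elim: r => [|i r ih].
  by under eq_fun do rewrite big_nil; exact: cont_cst.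
by under eq_fun do rewrite big_cons; exact: contD.
Qed.

End continuous_real.

(** * Truncated densities *)

Section cutoff.
Context {R : realType} {n : nat}.
Local Notation V := 'rV[R]_n.

Lemma continuous_dotvv : continuous (fun x : V => dotv x x).
Proof.
apply: (@cont_sum _ _ _ _ (fun i (y : V) => y 0 i * y 0 i)) => i.
by apply: contM; exact: coord_continuous.
Qed.

Lemma is_derive_dotvv (x v : V) : is_derive x v (fun x => dotv x x) (2 * dotv v x).
Proof.
apply: is_derive_of_line.
have e : (fun r : R => dotv (x + r *: v) (x + r *: v)) =
    (fun r => dotv x x + r * (2 * dotv v x) + r ^+ 2 * dotv v v).
  apply/funext => r; rewrite dotvDl !dotvDr !dotvZl !dotvZr (dotvC x v); ring.
rewrite e; apply: is_derive_eq; rewrite /GRing.scale/=; ring.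
Qed.

Lemma continuous_bounded_on (a : V -> R) (r : R) : continuous a ->
  exists B, 0 <= B /\ forall x, dotv x x <= r -> `|a x| <= B.
Proof.
move=> ca.
(* The half-side 1 + |r| suffices, since each squared coordinate is at most r <= (1 + |r|)^2. *)
pose A : set V := [set v : V | forall i, v ord0 i \in `[- (1 + `|r|), 1 + `|r|]].
have cA : compact A.
  apply: (@rV_compact _ _ (fun=> `[- (1 + `|r|), 1 + `|r|]%classic)) => i.
  exact: segment_compact.
have /compact_bounded[M [_ hM]] : compact (a @` A).
  by apply: continuous_compact cA; exact: continuous_subspaceT.
exists (`|M| + 1); split; first by rewrite addr_ge0.
move=> x xr; apply: hM; first by rewrite (le_lt_trans (ler_norm M))// ltrDl.
exists x => // i /=.
have : x 0 i ^+ 2 <= dotv x x.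
  by rewrite /dotv (bigD1 i)//= expr2 lerDl sumr_ge0// => j _; rewrite -expr2 sqr_ge0.
have := ler_norm r; rewrite in_itv/= => h1 h2.
have := normr_ge0 r.
by move=> h3; have -> : x ord0 i = x 0 i by []; apply/andP; split; nra.
Qed.

Variable g : V -> R.
Hypotheses (C1g : C1 g) (g0 : forall x, 0 <= g x).
Variable r : R.
Hypothesis r0 : 0 < r.

Let M (x : V) : R := Num.max 0 (1 - dotv x x / r).

(** [r] is a squared radius: [g] is cut off outside |x|^2 < r, and the additive [r^-1] keeps the
    result away from 0. Both effects disappear as [r] grows. *)
Definition cutoff (x : V) : R := r^-1 + g x * M x ^+ 2.

Let M0 x : 0 <= M x. Proof. by rewrite le_max lexx. Qed.

Let M1 x : M x <= 1.
Proof. by rewrite ge_max ler01 gerBl divr_ge0 ?dotv_ge0// ltW. Qed.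

Lemma cutoff_out x : r <= dotv x x -> M x = 0.
Proof. by move=> rx; apply/max_idPl; rewrite subr_le0 ler_pdivlMr// mul1r. Qed.

Lemma cutoff_ge x : r^-1 <= cutoff x.
Proof. by rewrite lerDl mulr_ge0 ?sqr_ge0. Qed.

Lemma cutoff_le x : cutoff x <= r^-1 + g x.
Proof. by rewrite lerD2l ler_piMr// expr_le1. Qed.

(** From (1 - q)_+^2 >= 1 - 2q. It bounds the lost mass by 2/r times the second moment of [g]. *)
Lemma cutoff_lower x : r^-1 + g x - 2 * (g x * dotv x x / r) <= cutoff x.
Proof.
have h : 1 - 2 * (dotv x x / r) <= M x ^+ 2.
  rewrite /M; set q := dotv x x / r.
  have q0 : 0 <= q by rewrite divr_ge0 ?dotv_ge0// ltW.
  by have [h|h] := lerP 0 (1 - q); nra.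
have := ler_wpM2l (g0 x) h; rewrite /cutoff mulrBr mulr1; lra.
Qed.

Let dM x v : is_derive x v (fun x => M x ^+ 2) (- (4 * M x * dotv v x / r)).
Proof.
apply: is_derive_of_line.
have d1 : is_derive (0 : R) 1 (fun t : R => 1 - dotv (x + t *: v) (x + t *: v) / r)
    (- (2 * dotv v x / r)).
  have d0 : is_derive (0 : R) 1 (fun t : R => dotv (x + t *: v) (x + t *: v)) (2 * dotv v x).
    by apply: (@is_derive_line _ _ (fun x => dotv x x)); rewrite scale0r addr0; exact: is_derive_dotvv.
  by apply: is_derive_eq; rewrite /GRing.scale/=; ring.
have d2 := @is_derive1_comp R (fun s => Num.max 0 s ^+ 2) _ 0 _ _
  (is_derive_pos_sqr _) d1.
apply: (is_derive_eq d2); rewrite scale0r addr0 -/(M x); ring.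
Qed.

Let cM : continuous M.
Proof.
have c1 : continuous (fun x : V => 1 - dotv x x / r).
  apply: contB; first exact: cont_cst.
  by apply: contM; [exact: continuous_dotvv|exact: cont_cst].
have -> : M = (fun x => 2^-1 * ((1 - dotv x x / r) + `|1 - dotv x x / r|)).
  apply/funext => x; rewrite /M; set a := 1 - _.
  by have [a0|a0] := lerP 0 a; [rewrite ger0_norm//|rewrite ltr0_norm//]; lra.
apply: contM; first exact: cont_cst.
apply: contD => // x; apply: (@continuous_comp _ _ _ (fun x : V => 1 - dotv x x / r) Num.norm).
  exact: c1.
exact: norm_continuous.
Qed.

Let dcut x v : is_derive x v cutoff
  (M x ^+ 2 * dotv v (grad g x) - g x * (4 * M x * dotv v x / r)).
Proof.
have d1 := dM x v; have d2 := is_derive_C1 C1g x v.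
rewrite /cutoff; apply: is_derive_eq; rewrite /GRing.scale/=; ring.
Qed.

Lemma C1_cutoff : C1 cutoff.
Proof.
have cg : continuous g by case: C1g.
have cM2 : continuous (fun x => M x ^+ 2) by exact: contM cM cM.
split; [|split].
- rewrite /cutoff; apply: contD; first exact: cont_cst.
  exact: contM.
- by move=> x v; have [] := dcut x v.
- move=> v; rewrite (_ : (fun _ => _) = (fun x => M x ^+ 2 * dotv v (grad g x) -
      g x * (4 * M x * dotv v x / r))); last first.
    by apply/funext => x; have [_ ->] := dcut x v.
  apply: (contB (contM cM2 (@continuous_dgrad _ _ _ C1g v))).
  apply: (contM cg); apply: contM; last exact: cont_cst.
  apply: contM; last exact: continuous_dotv.
  by apply: contM => //; exact: cont_cst.
Qed.

Lemma dgrad_cutoff v x : dotv v (grad cutoff x) =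
  M x ^+ 2 * dotv v (grad g x) - g x * (4 * M x * dotv v x / r).
Proof. by rewrite -(C1_derive C1_cutoff); have [_ ->] := dcut x v. Qed.

(** Compactness gives bounds on the ball; outside it the truncated density is the constant
    [r^-1]. *)
Lemma cutoff_bounded : exists B, (forall x, cutoff x <= B) /\
  (forall i x, `|grad cutoff x 0 i| <= B).
Proof.
have [Bg [Bg0 hBg]] := continuous_bounded_on r (proj1 C1_cutoff).
have hi (i : 'I_n) : exists B : R, 0 <= B /\
    forall x, dotv x x <= r -> `|dotv (evec i) (grad cutoff x)| <= B.
  exact: continuous_bounded_on (@continuous_dgrad _ _ _ C1_cutoff (evec i)).
have {hi}[Bi hBi] := boolp.choice hi.
have S0 : 0 <= \sum_i Bi i by apply: sumr_ge0 => i _; have [] := hBi i.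
exists (Bg + r^-1 + \sum_i Bi i); split => [x|i x].
  have [xr|/ltW xr] := leP (dotv x x) r.
    have := hBg _ xr; have := ler_norm (cutoff x).
    by have : 0 < r^-1 by [rewrite invr_gt0]; lra.
  by rewrite /cutoff cutoff_out// expr0n/= mulr0 addr0; lra.
rewrite -dotv_evec.
have [Bi0 hi] := hBi i.
have Bi_le : Bi i <= \sum_i Bi i.
  by rewrite (bigD1 i)//= lerDl sumr_ge0// => j _; have [] := hBi j.
have ri : 0 < r^-1 by rewrite invr_gt0.
have [xr|/ltW xr] := leP (dotv x x) r.
  by have := hi _ xr; lra.
by rewrite dgrad_cutoff cutoff_out// expr0n/= !(mulr0, mul0r) subr0 normr0; lra.
Qed.

(** Dropping [r^-1] from the denominator leaves (a - b)^2 / g with a = M D and b = 4 g (v . x) / r,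
    and (a - b)^2 <= (1 + eta) a^2 + (1 + 1/eta) b^2; the 16 is the square of the 4 in [b]. *)
Lemma dgrad_cutoff_sqr_le v x (eta : R) : 0 < eta ->
  dotv v (grad cutoff x) ^+ 2 / cutoff x <=
  (1 + eta) * (dotv v (grad g x) ^+ 2 / g x) +
  (1 + eta^-1) * (16 / r ^+ 2) * (dotv v x ^+ 2 * g x).
Proof.
move=> eta0.
have rhs0 : 0 <= (1 + eta) * (dotv v (grad g x) ^+ 2 / g x) +
  (1 + eta^-1) * (16 / r ^+ 2) * (dotv v x ^+ 2 * g x).
  have e1 : 0 <= eta^-1 by rewrite invr_ge0 ltW.
  have [a1 a2] : 0 <= 1 + eta /\ 0 <= 1 + eta^-1 by split; rewrite addr_ge0// ltW.
  have a3 : 0 <= dotv v (grad g x) ^+ 2 / g x by rewrite divr_ge0 ?sqr_ge0.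
  have a4 : 0 <= 16 / r ^+ 2 by rewrite divr_ge0 ?sqr_ge0.
  apply: addr_ge0; first exact: mulr_ge0.
  by apply: mulr_ge0; [exact: mulr_ge0|apply: mulr_ge0 => //; exact: sqr_ge0].
have [gx|gx] := eqVneq (g x) 0.
  apply: le_trans rhs0.
  by rewrite dgrad_cutoff dgrad_eq0// gx mulr0 mul0r subr0 expr0n/= mul0r.
have [Mx|Mx] := eqVneq (M x) 0.
  by rewrite dgrad_cutoff Mx expr0n/= !(mulr0, mul0r) subr0 expr0n/= mul0r.
have gp : 0 < g x by rewrite lt_neqAle eq_sym gx g0.
have Mp : 0 < M x by rewrite lt_neqAle eq_sym Mx M0.
have gM : 0 < g x * M x ^+ 2 by rewrite mulr_gt0// exprn_gt0.
apply: (@le_trans _ _ (dotv v (grad cutoff x) ^+ 2 / (g x * M x ^+ 2))).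
  rewrite ler_wpM2l ?sqr_ge0// lef_pV2 ?posrE//.
    by rewrite lerDr invr_ge0 ltW.
  by rewrite (lt_le_trans _ (cutoff_ge x))// invr_gt0.
rewrite dgrad_cutoff; set D := dotv v (grad g x); set y := dotv v x.
pose a := M x * D; pose b := 4 * g x * y / r.
have -> : (M x ^+ 2 * D - g x * (4 * M x * y / r)) ^+ 2 / (g x * M x ^+ 2) =
    (a - b) ^+ 2 / g x.
  by rewrite /a /b; field; rewrite gx Mx gt_eqF.
have -> : (1 + eta) * (D ^+ 2 / g x) + (1 + eta^-1) * (16 / r ^+ 2) * (y ^+ 2 * g x) =
    ((1 + eta) * D ^+ 2 + (1 + eta^-1) * b ^+ 2) / g x.
  by rewrite /b; field; rewrite gx !gt_eqF.
rewrite ler_wpM2r ?invr_ge0//.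
have h1 : (a - b) ^+ 2 <= (1 + eta) * a ^+ 2 + (1 + eta^-1) * b ^+ 2.
  rewrite -subr_ge0 (_ : _ - _ = eta^-1 * (eta * a + b) ^+ 2); last by field; rewrite gt_eqF.
  by rewrite mulr_ge0 ?sqr_ge0// invr_ge0 ltW.
rewrite (le_trans h1)// lerD2r ler_wpM2l//; first by rewrite addr_ge0// ltW.
by rewrite /a exprMn ler_piMl ?sqr_ge0// expr_le1.
Qed.

End cutoff.

(** * The improved logarithmic Sobolev inequality for general densities *)

Section entropy_bound.
Context {R : realType} {n : nat} (gamma : probability 'rV[R]_n R).
Hypothesis gaussE : std_gaussian gamma.
Local Notation V := 'rV[R]_n.

Variable g : V -> R.
Hypotheses (C1g : C1 g) (g0 : forall x, 0 <= g x).
Variable u : V.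
Hypothesis u1 : dotv u u = 1.
Let nrm2 (a : V -> R) x := dotv (grad a x) (grad a x) / a x.
Hypotheses (ig : intR gamma g) (iI : intR gamma (nrm2 g))
  (iG : forall v, intR gamma (fun x => dotv v x ^+ 2 * g x))
  (mass1 : mass gamma g = 1) (second1 : second gamma g u <= 1).

Let vp i : V := evec i - u 0 i *: u.

(** The projections of the basis vectors orthogonally to [u] replace an orthonormal basis of the
    orthogonal complement, so directional estimates can be summed over [i] without choosing one. *)
Lemma perp_sum (w : V) : \sum_i dotv (vp i) w ^+ 2 = dotv w w - dotv u w ^+ 2.
Proof.
have e i : dotv (vp i) w = w 0 i - u 0 i * dotv u w.
  rewrite /vp dotvDl -scaleNr dotvZl mulNr; congr (_ - _).
  exact: dotv_evec.
transitivity (\sum_i (w 0 i * w 0 i - 2 * dotv u w * (u 0 i * w 0 i) +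
    dotv u w ^+ 2 * (u 0 i * u 0 i))).
  by apply: eq_bigr => i _; rewrite e; ring.
rewrite big_split big_split /= sumrN -!mulr_sumr -/(dotv u u) -/(dotv w w) -/(dotv u w) u1.
ring.
Qed.

Let D (a : V -> R) v x := dotv v (grad a x) ^+ 2 / a x.

Let nrm2_split (a : V -> R) x : nrm2 a x = D a u x + \sum_i D a (vp i) x.
Proof.
by rewrite /D -mulr_suml perp_sum /nrm2 -mulrDl addrC subrK.
Qed.

Let score_sqr (a : V -> R) v x : score a v x ^+ 2 * a x = D a v x.
Proof.
rewrite /score /D; have [->|ax] := eqVneq (a x) 0; first by rewrite invr0 !mulr0.
by field.
Qed.

Let mDa (a : V -> R) v : C1 a -> measurable_fun setT (D a v).
Proof.
move=> C1a; apply: measurable_funM; first by apply: measurable_funX; exact: measurable_dgrad.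
exact: measurableT_comp (@measurable_invr R) (measurable_C1 C1a).
Qed.

Let D_ge0 (a : V -> R) v x : (forall x, 0 <= a x) -> 0 <= D a v x.
Proof. by move=> a0; rewrite /D mulr_ge0 ?sqr_ge0 ?invr_ge0. Qed.

Let dvp i (w : V) : dotv (vp i) w ^+ 2 <= dotv w w.
Proof.
have := perp_sum w; rewrite (bigD1 i)//= => h.
have h2 : 0 <= \sum_(k | k != i) dotv (vp k) w ^+ 2.
  by apply: sumr_ge0 => k _; exact: sqr_ge0.
by have := sqr_ge0 (dotv u w); lra.
Qed.

Let iDg : intR gamma (D g u) /\ forall i, intR gamma (D g (vp i)).
Proof.
split => [|i].
  by apply: eq_intR (intR_score_sqr C1g g0 u1 iI) => x; rewrite score_sqr.
apply: (intR_le (mDa (vp i) C1g) _ iI) => x.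
rewrite ger0_norm; last exact: D_ge0.
by rewrite /D /nrm2 ler_wpM2r ?invr_ge0.
Qed.

Let P := rint gamma (fun x => \sum_i D g (vp i) x).
Let Q := rint gamma (fun x => \sum_i dotv (vp i) x ^+ 2 * g x).
Let j := finfo gamma g u.
Let S := second gamma g u.

Let iQ : intR gamma (fun x => \sum_i dotv (vp i) x ^+ 2 * g x).
Proof. exact: intR_sum. Qed.

Let iMo : intR gamma (fun x => g x * dotv x x).
Proof.
apply: eq_intR (intR_sum (index_enum 'I_n) (fun i => iG (evec i))) => x.
rewrite mulrC /dotv mulr_suml; apply: eq_bigr => i _.
by rewrite -/(dotv _ _) dotv_evec expr2.
Qed.

Let Mg := rint gamma (fun x => g x * dotv x x).

Let Mg0 : 0 <= Mg. Proof. by apply: rint_ge0 => x; rewrite mulr_ge0 ?dotv_ge0. Qed.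
Let j0 : 0 <= j. Proof. by apply: rint_ge0 => x; rewrite mulr_ge0 ?sqr_ge0. Qed.
Let S0 : 0 <= S. Proof. by apply: rint_ge0 => x; rewrite mulr_ge0 ?sqr_ge0. Qed.
Let Q0 : 0 <= Q.
Proof. by apply: rint_ge0 => x; apply: sumr_ge0 => i _; rewrite mulr_ge0 ?sqr_ge0. Qed.
Let P0 : 0 <= P.
Proof. by apply: rint_ge0 => x; apply: sumr_ge0 => i _; exact: D_ge0. Qed.

Let Pj : rint gamma (nrm2 g) = j + P.
Proof.
have [i1 i2] := iDg.
rewrite /j /finfo /P (eq_rint _ (fun x => score_sqr g u x)) -rintD//; last exact: intR_sum.
by apply: eq_rint => x; rewrite nrm2_split.
Qed.

(** The bounds for the truncated density with t = 1/r, where [t] also serves as Young parameter in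
    [dgrad_cutoff_sqr_le]: (1 + 1/t) 16/r^2 = 16 (t^2 + t). *)
Let jb (t : R) := (1 + t) * j + (t ^+ 2 + t) * 16 * S.
Let Ab (t : R) := (1 + t) * P + (t ^+ 2 + t) * 16 * Q.
Let eta (t : R) := (1 + 2 * Mg) * t.

Let bound (t : R) := (1 + eta t) * eta t +
  2^-1 * (Ab t + eta t * (1 + jb t ^+ 2)) + 2^-1 * (ln (1 + j) + (jb t - j)).

Lemma entropy_cutoff_le (t : R) : 0 < t -> rint gamma (fun x => ent (cutoff g t^-1 x)) <= bound t.
Proof.
move=> t0; set r := t^-1; have r0 : 0 < r by rewrite invr_gt0.
have rt : r^-1 = t by rewrite invrK.
have C1r := C1_cutoff C1g r.
have [B [B1 B2]] := cutoff_bounded C1g r0.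
have ge := cutoff_ge g0 r.
have e0 : 0 < r^-1 by rewrite invr_gt0.
set a := cutoff g r.
have a0 x : 0 <= a x by exact: le_trans (ltW e0) (ge x).
have mr := measurable_C1 C1r.
have ia : intR gamma a.
  apply: (intR_le mr _ (intRD (intR_cst gamma r^-1) ig)) => x.
  by rewrite ger0_norm//; exact: cutoff_le.
have iup v : intR gamma (fun x => (1 + t) * D g v x + (t ^+ 2 + t) * 16 * (dotv v x ^+ 2 * g x)) ->
   intR gamma (D a v) /\ rint gamma (D a v) <=
   rint gamma (fun x => (1 + t) * D g v x + (t ^+ 2 + t) * 16 * (dotv v x ^+ 2 * g x)).
  move=> iv; have le x : D a v x <= (1 + t) * D g v x + (t ^+ 2 + t) * 16 * (dotv v x ^+ 2 * g x).
    apply: le_trans (dgrad_cutoff_sqr_le C1g g0 r0 v x t0) _.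
    rewrite lerD2l (_ : _ * (16 / r ^+ 2) = (t ^+ 2 + t) * 16)//.
    by rewrite /r; field; rewrite gt_eqF.
  have iD : intR gamma (D a v).
    apply: (intR_le (mDa v C1r) _ iv) => x; rewrite ger0_norm//; exact: D_ge0.
  by split => //; apply: le_rint.
have [i1 i2] := iDg.
have iu : intR gamma (fun x => (1 + t) * D g u x + (t ^+ 2 + t) * 16 * (dotv u x ^+ 2 * g x)).
  by apply: intRD; exact: intRZ.
have ip i : intR gamma (fun x => (1 + t) * D g (vp i) x + (t ^+ 2 + t) * 16 * (dotv (vp i) x ^+ 2 * g x)).
  by apply: intRD; exact: intRZ.
have [iau hu] := iup _ iu.
have hj : finfo gamma a u <= jb t.
  rewrite /finfo (eq_rint _ (score_sqr a u)) (le_trans hu)// rintD ?rintZ//; [|exact: intRZ..].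
  by rewrite /jb /j /finfo (eq_rint _ (score_sqr g u)).
have hA : rint gamma (nrm2 a) - finfo gamma a u <= Ab t.
  have iap i : intR gamma (D a (vp i)) by have [] := iup _ (ip i).
  have -> : rint gamma (nrm2 a) = finfo gamma a u + \sum_i rint gamma (D a (vp i)).
    rewrite /finfo (eq_rint _ (score_sqr a u)) -rint_sum// -rintD//; last exact: intR_sum.
    by apply: eq_rint => x; exact: nrm2_split.
  rewrite addrC addKr /Ab /P /Q !rint_sum// !mulr_sumr -big_split /=.
  apply: ler_sum => i _; have [_ h] := iup _ (ip i).
  by rewrite (le_trans h)// rintD ?rintZ//; exact: intRZ.
have Mg2 : 0 <= 2 * Mg * t by rewrite !mulr_ge0// ltW.
have hS : second gamma a u <= 1 + eta t.
  have i3 : intR gamma (fun x => dotv u x ^+ 2 * t + dotv u x ^+ 2 * g x).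
    apply: intRD => //; apply: eq_intR (intRZ t (intR_dotv_sqr gaussE u)) => x.
    by rewrite mulrC.
  have i4 : intR gamma (fun x => dotv u x ^+ 2 * a x).
    apply: (intR_le _ _ i3).
      by apply: measurable_funM => //; apply: measurable_funX; exact: measurable_dotvl.
    move=> x; rewrite ger0_norm; last by rewrite mulr_ge0 ?sqr_ge0.
    by rewrite -mulrDr; apply: ler_wpM2l; [exact: sqr_ge0|rewrite -rt; exact: cutoff_le].
  apply: (@le_trans _ _ (t + second gamma g u)).
    have -> : t + second gamma g u = rint gamma (fun x => dotv u x ^+ 2 * t + dotv u x ^+ 2 * g x).
      rewrite rintD//; last first.
        by apply: eq_intR (intRZ t (intR_dotv_sqr gaussE u)) => x; rewrite mulrC.
      congr (_ + _); rewrite -[LHS]mulr1 -u1 -(rint_dotv_sqr gaussE u) -rintZ; last exact: intR_dotv_sqr.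
      by apply: eq_rint => x; rewrite mulrC.
    apply: le_rint => // x.
    by rewrite -mulrDr; apply: ler_wpM2l; [exact: sqr_ge0|rewrite -rt; exact: cutoff_le].
  by rewrite /eta mulrDl mul1r addrC lerD// lerDl.
have hm2 : mass gamma a <= 1 + eta t.
  apply: (@le_trans _ _ (t + 1)); last by rewrite /eta mulrDl mul1r; lra.
  rewrite -mass1 -{1}(rint_cst gamma t) -rintD//; last exact: intR_cst.
  apply: le_rint => //; first by apply: intRD => //; exact: intR_cst.
  by move=> x; rewrite -rt; exact: cutoff_le.
have hm1 : 1 - eta t <= mass gamma a.
  apply: (@le_trans _ _ (t + 1 - 2 * t * Mg)); first by rewrite /eta mulrDl mul1r; lra.
  rewrite -[X in _ + X - _]mass1 -{1}(rint_cst gamma t) -rintD//; last exact: intR_cst.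
  rewrite -rintZ// -rintB//; last 2 first.
  - by apply: intRD => //; exact: intR_cst.
  - exact: intRZ.
  apply: le_rint => //.
    by apply: intRB; [apply: intRD => //; exact: intR_cst|exact: intRZ].
  move=> x; apply: le_trans (cutoff_lower g0 r0 x).
  by rewrite rt le_eqVlt; apply/orP; left; apply/eqP; ring.
have et0 : 0 <= eta t by rewrite mulr_ge0 ?addr_ge0 ?mulr_ge0// ltW.
have jb0 : 0 <= jb t.
  by rewrite addr_ge0// !mulr_ge0 ?addr_ge0 ?sqr_ge0// ltW.
have := entropy_nice_le gaussE C1r e0 ge B1 B2 u1 et0 jb0 hA hj hS hm1 hm2.
move=> h; apply: (le_trans h).
have mp : 0 < mass gamma a.
  apply: lt_le_trans e0 _; rewrite -[leLHS](rint_cst gamma); apply: le_rint => //.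
  exact: intR_cst.
rewrite /bound; apply: lerD; [apply: lerD => //|].
  (* For the mass m, ent m <= m (m - 1) <= (1 + eta) eta. *)
  apply: le_trans (ent_le_sqr mp) _.
  have : mass gamma a * (mass gamma a - 1) <= mass gamma a * eta t.
    by apply: ler_wpM2l; [exact: ltW|rewrite lerBlDl].
  move/le_trans; apply; by rewrite ler_wpM2r.
(* The logarithm is linearised at [1 + j], so that [bound] is a polynomial in [t] and hence
   continuous at 0. *)
rewrite ler_wpM2l ?invr_ge0// -lerBlDl -ln_div ?posrE; [|by rewrite ltr_wpDr..].
have -> : (1 + jb t) / (1 + j) = 1 + (jb t - j) / (1 + j).
  by field; rewrite gt_eqF// ltr_wpDr.
have jbj : 0 <= jb t - j.
  rewrite (_ : _ - j = t * j + (t ^+ 2 + t) * 16 * S); last by rewrite /jb; ring.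
  apply: addr_ge0; first by rewrite mulr_ge0// ltW.
  by rewrite !mulr_ge0 ?addr_ge0 ?sqr_ge0// ltW.
apply: le_trans (le_ln1Dx _) _.
  by rewrite (lt_le_trans (ltrN10 _))// divr_ge0// addr_ge0.
by rewrite ler_pdivrMr ?ltr_wpDr// ler_peMr// lerDl.
Qed.


Let cvg_harmonic_comp (h : R -> R) : continuous h ->
  (fun k : nat => h k.+1%:R^-1) @ \oo --> h 0.
Proof.
by move=> ch; apply: (@continuous_cvg _ _ _ _ _ (@harmonic R) h 0); [exact: ch|exact: cvg_harmonic].
Qed.

Let bound_cvg : (fun k : nat => bound k.+1%:R^-1) @ \oo -->
  2^-1 * P + 2^-1 * ln (1 + j).
Proof.
have cb : continuous bound.
  by apply: derivable1_continuous => t; rewrite /bound /Ab /eta /jb; exact: ex_derive.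
have -> : 2^-1 * P + 2^-1 * ln (1 + j) = bound 0.
  by rewrite /bound /eta /Ab /jb; ring.
exact: cvg_harmonic_comp.
Qed.

(** Fatou's lemma along r = k + 1, applied to 1 + r ln r, which is nonnegative by [ent_ge]. *)
Lemma log_sobolev_improved : intR gamma (fun x => ent (g x)) /\
  rint gamma (fun x => ent (g x)) <=
    2^-1 * (rint gamma (nrm2 g) - finfo gamma g u) + 2^-1 * ln (1 + finfo gamma g u).
Proof.
have k0 (k : nat) : 0 < k.+1%:R^-1 :> R by rewrite invr_gt0.
pose a (k : nat) := cutoff g (k.+1%:R^-1^-1 : R).
have aE k x : a k x = k.+1%:R^-1 + g x * Num.max 0 (1 - dotv x x * k.+1%:R^-1) ^+ 2.
  by rewrite /a /cutoff !invrK.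
have ag k x : k.+1%:R^-1 <= a k x by rewrite aE lerDl mulr_ge0 ?sqr_ge0.
have a0 k x : 0 <= a k x by rewrite (le_trans _ (ag k x))// ltW.
have mg : measurable_fun setT g := measurable_C1 C1g.
have ma k : measurable_fun setT (a k) by exact: measurable_C1 (C1_cutoff C1g _).
have mea k : measurable_fun setT (fun x => ent (a k x)).
  exact: measurableT_comp measurable_ent (ma k).
have iea k : intR gamma (fun x => ent (a k x)).
  have rk : 0 < (k.+1%:R^-1^-1 : R) by rewrite invr_gt0.
  have [B [B1 B2]] := cutoff_bounded C1g rk.
  have B0 : 0 < B by apply: lt_le_trans (B1 0); rewrite (lt_le_trans (k0 k))// -/(a k 0).
  apply: (intR_le (mea k) _ (intR_cst gamma (1 + B * B))) => x.
  rewrite ler_norml; apply/andP; split.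
    by apply: le_trans (ent_ge (a0 k x)); rewrite opprD gerBl mulr_ge0 ?ltW.
  have ap : 0 < a k x := lt_le_trans (k0 k) (ag k x).
  apply: le_trans (ent_le_sqr ap) _.
  by have := B1 x; rewrite -/(a k x) => h; nra.
have cga x : a ^~ x @ \oo --> g x.
  have c : continuous (fun t : R => t + g x * Num.max 0 (1 - dotv x x * t) ^+ 2).
    apply: derivable1_continuous => t.
    have d1 : is_derive t 1 (fun t : R => 1 - dotv x x * t) (- dotv x x).
      by apply: is_derive_eq; rewrite /GRing.scale/=; ring.
    have d2 := @is_derive1_comp R (fun s => Num.max 0 s ^+ 2) _ t _ _
      (is_derive_pos_sqr _) d1.
    have d3 : is_derive t 1 (fun t : R => Num.max 0 (1 - dotv x x * t) ^+ 2) _ := d2.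
    exact: ex_derive.
  have -> : g x = 0 + g x * Num.max 0 (1 - dotv x x * 0) ^+ 2.
    by rewrite mulr0 subr0 max_r// expr1n mulr1 add0r.
  rewrite (_ : a ^~ x = fun k => k.+1%:R^-1 + g x * Num.max 0 (1 - dotv x x * k.+1%:R^-1) ^+ 2).
    exact: (cvg_harmonic_comp c).
  by apply/funext => k; rewrite aE.
have cent x : (fun k => 1 + ent (a k x)) @ \oo --> 1 + ent (g x).
  apply: cvgD; first exact: cvg_cst.
  (* At a zero of [g] the truncated density is 1/(k + 1), and convergence rests on the limit of r ln
     r at 0. *)
  have [gx|gx] := eqVneq (g x) 0.
    rewrite gx {2}/ent mul0r.
    rewrite (_ : (fun k => _) = fun k => ent k.+1%:R^-1); last first.
      by apply/funext => k; rewrite aE gx mul0r addr0.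
    have /cvg_at_rightP h := @continuous_ent0 R.
    by apply: h; split => //; exact: cvg_harmonic.
  have gp : 0 < g x by rewrite lt_neqAle eq_sym gx g0.
  rewrite /ent; apply: cvgM => //.
  by apply: (cvg_comp _ _ (cga x)); exact: continuous_ln.
have [ii le] : intR gamma (fun x => 1 + ent (g x)) /\
    rint gamma (fun x => 1 + ent (g x)) <= 1 + (2^-1 * P + 2^-1 * ln (1 + j)).
  apply: (fatou_real (F := fun k x => 1 + ent (a k x)) (b := fun k => 1 + bound k.+1%:R^-1)).
  - by move=> k; apply: measurable_funD.
  - by move=> k x; rewrite -lerBlDl sub0r ent_ge.
  - exact: cent.
  - move=> k; rewrite -rintE; last by apply: intRD => //; exact: intR_cst.
    rewrite lee_fin rintD//; last exact: intR_cst.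
    by rewrite rint_cst lerD2l entropy_cutoff_le.
  - by apply: cvgD; [exact: cvg_cst|exact: bound_cvg].
  - by apply: measurable_funD => //; exact: measurableT_comp measurable_ent mg.
have ie : intR gamma (fun x => ent (g x)).
  by apply: eq_intR (intRB ii (intR_cst gamma 1)) => x; rewrite addrC addKr.
split => //; move: le; rewrite rintD ?rint_cst ?lerD2l//; last exact: intR_cst.
by rewrite Pj /nrm2 -/j [j + P]addrC addrK.
Qed.

End entropy_bound.

(** * The time weight 4 e^(-4t) dt as a probability law *)

Section exponential_time.
Context {R : realType}.
Local Notation lam := (@lebesgue_measure R).

(** This law absorbs the factor 4 e^(-4t) of [phi_of], which makes phi an average over a product of
    probability spaces. *)
Definition exp4 : probability (measurableTypeR R) R.
Proof.
unshelve refine (exponential_prob 4 : probability _ R).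
by [].
Defined.

Let pdf4 := @exponential_pdf R 4.

Let pdf4_ge0 (t : R) : 0 <= pdf4 t. Proof. exact: exponential_pdf_ge0. Qed.

Let pdf4E (t : R) : 0 <= t -> pdf4 t = 4 * expR (- (4 * t)).
Proof. by move=> t0; rewrite /pdf4 exponential_pdfE// mulNr. Qed.

Let mpdf4 : measurable_fun setT pdf4. Proof. exact: measurable_exponential_pdf. Qed.

Lemma ge0_integral_exp4 (h : R -> \bar R) : measurable_fun setT h ->
  (forall t, (0 <= h t)%E) ->
  (\int[exp4]_t h t = \int[lam]_t (h t * (pdf4 t)%:E))%E.
Proof.
by move=> mh h0; rewrite (@ge0_integral_density _ _ _ exp4 lam pdf4).
Qed.

Lemma rint_exp4 (h : R -> R) : intR exp4 h ->
  4 * Rintegral lam [set t : R | 0 <= t] (fun t => expR (- (4 * t)) * h t) = rint exp4 h.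
Proof.
move=> ih; have mh := intR_meas ih.
have mid : measurable_fun [set: R] (fun t : R => t) by exact: measurable_id.
have i1 : intR lam (fun t => h t * pdf4 t).
  apply: (@intR_transfer _ _ (measurableTypeR R) (measurableTypeR R) R lam exp4
    (fun t => t) pdf4 mid mpdf4 pdf4_ge0 _ h ih) => k mk k0.
  by rewrite ge0_integral_exp4.
have <- : rint lam (fun t => h t * pdf4 t) = rint exp4 h.
  apply: (@rint_transfer _ _ (measurableTypeR R) (measurableTypeR R) R lam exp4
    (fun t => t) pdf4 pdf4_ge0 _ h mh) => k mk k0.
  by rewrite ge0_integral_exp4.
pose f := (fun t : R => expR (- (4 * t)) * h t) \_ [set t : R | 0 <= t].
have fE t : 4^-1 * (h t * pdf4 t) = f t.
  rewrite /f patchE; case: ifPn => [/set_mem t0|t0].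
    by rewrite pdf4E//; field.
  rewrite /pdf4 lt0_exponential_pdf ?mulr0 ?mulr0//.
  by rewrite ltNge; apply: contra t0 => t0; exact: mem_set.
rewrite Rintegral_mkcond -/f -[Rintegral _ _ _]/(rint lam f) -(@eq_rint _ _ _ lam _ _ fE).
by rewrite (rintZ _ i1) mulrA mulfV ?mul1r.
Qed.

Lemma ae_exp4_gt0 : {ae exp4, forall t : R, 0 < t}.
Proof.
exists (`]-oo, (0 : R)]%classic : set R); split.
- exact: measurable_itv.
- rewrite [LHS](_ : _ = (\int[lam]_(t in (`]-oo, (0%R : R)]%classic : set R)) (pdf4 t)%:E)%E)//.
  rewrite -integral_itv_bndo_bndc; last exact/measurable_EFinP/measurable_funTS.
  apply: integral0_eq => t /=; rewrite in_itv/= => t0.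
  by rewrite /pdf4 lt0_exponential_pdf.
- by move=> t /=; rewrite in_itv/= ltNge => /negP; rewrite negbK.
Qed.

Let c (t : R) := expR (- t).
Let s (t : R) := Num.sqrt (1 - expR (- (2 * t))).

Lemma exp2_lt1 (t : R) : 0 < t -> expR (- (2 * t)) < 1.
Proof. by move=> t0; rewrite -expR0 ltr_expR oppr_lt0 mulr_gt0. Qed.

Lemma OU_s_gt0 (t : R) : 0 < t -> 0 < s t.
Proof. by move=> t0; rewrite sqrtr_gt0 subr_gt0 exp2_lt1. Qed.

Lemma OU_s_sqr (t : R) : 0 < t -> s t ^+ 2 = 1 - c t ^+ 2.
Proof.
move=> t0; rewrite /s sqr_sqrtr; last by rewrite subr_ge0 ltW// exp2_lt1.
by rewrite /c expr2 -expRD; congr (_ - expR _); ring.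
Qed.

Lemma is_derive_OU_s (t : R) : 0 < t -> is_derive t 1 s (c t ^+ 2 / s t).
Proof.
move=> t0.
have p : 0 < 1 - expR (- (2 * t)) by rewrite subr_gt0 exp2_lt1.
have d1 : is_derive t 1 (fun t => 1 - expR (- (2 * t))) (2 * c t ^+ 2).
  have d0 : is_derive t 1 (fun t : R => - (2 * t)) (- 2).
    by apply: is_derive_eq; rewrite /GRing.scale/=; ring.
  have d2 := @is_derive1_comp R expR _ t _ _ (is_derive_expR _) d0.
  have d3 : is_derive t 1 (fun t : R => expR (- (2 * t))) _ := d2.
  apply: is_derive_eq; rewrite /c [expR (- t) ^+ 2]expr2 -expRD.
  have -> : - t + - t = - (2 * t) by ring.
  ring.
have d2 := @is_derive1_comp R (@Num.sqrt R) _ t _ _ (is_derive1_sqrt p) d1.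
apply: (is_derive_eq d2); rewrite -/(s t); field.
by rewrite gt_eqF// OU_s_gt0.
Qed.

Lemma continuous_OU_c : continuous c.
Proof.
apply: derivable1_continuous => t.
have d0 : is_derive t 1 (fun t : R => - t) (- 1).
  by apply: is_derive_eq.
by have [] := @is_derive1_comp R expR _ t _ _ (is_derive_expR _) d0.
Qed.

Lemma continuous_OU_s : continuous s.
Proof.
have c2 : continuous (fun t : R => 1 - expR (- (2 * t))).
  have e : (fun t : R => 1 - expR (- (2 * t))) = (fun t => 1 - c t * c t).
    by apply/funext => t; rewrite /c -expRD; congr (_ - expR _); ring.
  rewrite e; apply: contB; first exact: cont_cst.
  by apply: contM; exact: continuous_OU_c.
move=> t; apply: (@continuous_comp _ _ _ (fun t : R => 1 - expR (- (2 * t))) (@Num.sqrt R)).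
  exact: c2.
exact: sqrt_continuous.
Qed.

Let cvg_exp (k : R) : 0 < k -> expR (- (k * t)) @[t --> +oo] --> (0 : R).
Proof.
move=> k0; apply: (@cvg_comp _ _ _ (fun t : R => k * t) (fun t => expR (- t)) _ (pinfty_nbhs R)); last exact: cvgr_expR.
exact: gt0_cvgMry.
Qed.

Let cvg_s : s t @[t --> +oo] --> (1 : R).
Proof.
rewrite -[X in _ --> X](sqrtr1 R).
apply: (@continuous_cvg _ _ _ _ _ (fun t : R => 1 - expR (- (2 * t))) (@Num.sqrt R) 1).
  exact: sqrt_continuous.
rewrite -[X in _ --> X](subr0 1); apply: cvgB; first exact: cvg_cst.
exact: cvg_exp.
Qed.

(** Since e^(-4t) <= e^(-t), the weighted function is at most 4 c^2 / s, the derivative of 4 s,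
    whose total increase is 4. *)
Lemma intR_cs : intR exp4 (fun t : R => if 0 < t then c t / s t else 0).
Proof.
(* Cutting at 1/(k + 1) avoids the singularity at 0; Fatou's lemma removes the cut. *)
pose F (k : nat) t := if k.+1%:R^-1 <= t then c t / s t else 0.
have k0 (k : nat) : 0 < k.+1%:R^-1 :> R by rewrite invr_gt0.
have mcs : measurable_fun setT (fun t => c t / s t).
  apply: measurable_funM; first exact: continuous_measurable_fun continuous_OU_c.
  apply: measurableT_comp (@measurable_invr R) _.
  exact: continuous_measurable_fun continuous_OU_s.
have cs0 t : 0 <= c t / s t by rewrite mulr_ge0 ?invr_ge0 ?sqrtr_ge0 ?expR_ge0.
have mF k : measurable_fun setT (F k).
  apply: measurable_fun_ifT => //.
  by apply: measurable_fun_ler => //; exact: measurable_id.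
have m0 : measurable_fun setT (fun t : R => if 0 < t then c t / s t else 0).
  apply: measurable_fun_ifT => //.
  by apply: measurable_fun_ltr => //; exact: measurable_id.
have F0 k t : 0 <= F k t by rewrite /F; case: ifP.
have h1 t : F ^~ t @ \oo --> (if 0 < t then c t / s t else 0).
  have [t0|t0] := ltP 0 t.
    apply: cvg_near_cst.
    have /cvgrPdist_lt/(_ _ t0) := @cvg_harmonic R.
    apply: filterS => k; rewrite sub0r normrN ger0_norm ?invr_ge0// => h.
    by rewrite /F (ltW h).
  rewrite (_ : F ^~ t = fun=> 0); first exact: cvg_cst.
  by apply/funext => k; rewrite /F leNgt (le_lt_trans t0 (k0 k)).
have h2 k : (\int[exp4]_t (F k t)%:E <= (4%R : R)%:E)%E.
  set a := k.+1%:R^-1 : R.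
  have a0 : 0 < a by exact: k0.
  have mFE : measurable_fun setT (fun t => (F k t)%:E) by exact/measurable_EFinP.
  rewrite ge0_integral_exp4//; last by move=> t; rewrite lee_fin.
  pose f t := 4 * (c t ^+ 2 / s t).
  apply: (@le_trans _ _ (\int[lam]_(t in `[a, +oo[) (f t)%:E)%E).
    rewrite [leRHS]integral_mkcond; apply: ge0_le_integral => //.
    - by move=> t _; rewrite -EFinM lee_fin mulr_ge0.
    - by apply: emeasurable_funM => //; exact/measurable_EFinP.
    - apply/(measurable_restrictT _ (measurable_itv _)); apply/measurable_funTS/measurable_EFinP.
      apply: measurable_funM => //; apply: measurable_funM.
        by apply: measurable_funX; exact: continuous_measurable_fun continuous_OU_c.
      apply: measurableT_comp (@measurable_invr R) _.
      exact: continuous_measurable_fun continuous_OU_s.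
    - move=> t _; rewrite -EFinM patchE/= /F; case: ifPn => ta.
        rewrite ifT; last by rewrite inE/= in_itv/= andbT.
        rewrite lee_fin /f.
        rewrite pdf4E ?(le_trans (ltW a0))// mulrCA ler_wpM2l//.
        rewrite -mulrA [_^-1 * _]mulrC mulrA; apply: ler_wpM2r; first by rewrite invr_ge0 sqrtr_ge0.
        rewrite expr2.
        apply: ler_wpM2l; first exact: expR_ge0.
        by rewrite /c ler_expR lerN2; apply: ler_peMl; [exact: le_trans (ltW a0) ta|rewrite ler1n].
      rewrite ifF ?mul0r//; apply/negbTE; apply: contra ta.
      by rewrite inE/= in_itv/= andbT.
  have dF (t : R) : 0 < t -> is_derive t 1 (fun t => 4 * s t) (f t).
    move=> t0; have d := is_derive_OU_s t0.
    by apply: is_derive_eq.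
  have cf t : 0 < t -> {for t, continuous f}.
    move=> t0; apply: cvgM; first exact: cvg_cst.
    apply: cvgM; first by apply: cvgM; exact: continuous_OU_c.
    by apply: cvgV; [rewrite gt_eqF// OU_s_gt0|exact: continuous_OU_s].
  rewrite (@ge0_continuous_FTC2y _ f (fun t => 4 * s t) a 4).
  - by rewrite -EFinD lee_fin gerBl mulr_ge0// sqrtr_ge0.
  - move=> t ta; apply: mulr_ge0 => //; apply: mulr_ge0; first exact: sqr_ge0.
    by rewrite invr_ge0 sqrtr_ge0.
  - apply/continuous_within_itvcyP; split.
      move=> t; rewrite in_itv/= andbT => ta; apply: cf; exact: lt_trans ta.
    by apply: cvg_at_right_filter; exact: cf.
  - rewrite -[X in _ --> X]mulr1; apply: cvgM; [exact: cvg_cst|exact: cvg_s].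
  - by move=> t ta; have [] := dF t (lt_trans a0 ta).
  - by apply: cvg_at_right_filter; have [] := dF a a0 => /derivable1_diffP/differentiable_continuous.
  - move=> t; rewrite in_itv/= andbT => ta; rewrite derive1E.
    by have [_ ->] := dF t (lt_trans a0 ta).
by have [] := fatou_real (mu := exp4) (b := fun=> 4) mF F0 h1 h2 (cvg_cst _) m0.
Qed.


Lemma rint_exp4_rational (j : R) : 0 <= j ->
  intR exp4 (fun t : R => (j / (1 + (1 - expR (- (2 * t))) * j)) ^+ 2) /\
  rint exp4 (fun t : R => (j / (1 + (1 - expR (- (2 * t))) * j)) ^+ 2) =
    2 * (j - ln (1 + j)).
Proof.
move=> j0; pose r (t : R) := 1 - expR (- (2 * t)).
pose q t := 1 + r t * j; pose p t := (j / q t) ^+ 2.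
have r0 t : 0 <= t -> 0 <= r t.
  by move=> t0; rewrite subr_ge0 -expR0 ler_expR oppr_le0 mulr_ge0.
have q0 t : 0 <= t -> 0 < q t by move=> /r0 h; rewrite ltr_pwDl// mulr_ge0.
have dr (t : R) : is_derive t 1 r (2 * expR (- (2 * t))).
  have d0 : is_derive t 1 (fun t : R => - (2 * t)) (- 2).
    by apply: is_derive_eq; rewrite /GRing.scale/=; ring.
  have d2 := @is_derive1_comp R expR _ t _ _ (is_derive_expR _) d0.
  have d3 : is_derive t 1 (fun t : R => expR (- (2 * t))) _ := d2.
  by rewrite /r; apply: is_derive_eq; ring.
have cr : continuous r by apply: derivable1_continuous => t; have [] := dr t.
have cq : continuous q.
  by apply: contD; [exact: cont_cst|apply: contM => //; exact: cont_cst].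
have mp : measurable_fun setT p.
  apply: measurable_funX; apply: measurable_funM => //.
  exact: measurableT_comp (@measurable_invr R) (continuous_measurable_fun cq).
have p0 t : 0 <= p t by exact: sqr_ge0.
pose f t := 4 * expR (- (4 * t)) * p t.
(* With r = 1 - e^(-2t) the weight 4 e^(-4t) dt is 2 (1 - r) dr; as (1 - r) j = 1 + j - q and dq = j
   dr, the integrand becomes 2 (1 + j - q)/q^2 dq. *)
pose F t := - (2 * (1 + j) / q t) - 2 * ln (q t).
have dF (t : R) : 0 <= t -> is_derive t 1 F (f t).
  move=> t0; have qt := q0 t t0.
  have dq : is_derive t 1 q (2 * expR (- (2 * t)) * j).
    by have d := dr t; rewrite /q; apply: is_derive_eq; rewrite /GRing.scale/=; ring.
  have dln := @is_derive1_comp R (@ln R) _ t _ _ (is_derive1_ln qt) dq.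
  have dln' : is_derive t 1 (fun t => ln (q t)) _ := dln.
  have qn : q t != 0 by rewrite gt_eqF.
  have dV := is_deriveV qn dq.
  have dV' : is_derive t 1 (fun t => (q t)^-1) _ := dV.
  rewrite /F; apply: is_derive_eq; rewrite /f /p.
  have -> : expR (- (4 * t)) = (1 - r t) ^+ 2.
    by rewrite /r opprB addrC subrK expr2 -expRD; congr expR; ring.
  have -> : expR (- (2 * t)) = 1 - r t by rewrite /r opprB addrC subrK.
  by rewrite /GRing.scale/= /q; field; rewrite /q in qn.
have cf : continuous (fun t : R => expR (- (4 * t))).
  apply: derivable1_continuous => t.
  have d0 : is_derive t 1 (fun t : R => - (4 * t)) (- 4).
    by apply: is_derive_eq; rewrite /GRing.scale/=; ring.
  by have [] := @is_derive1_comp R expR _ t _ _ (is_derive_expR _) d0.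
have cft t : 0 <= t -> {for t, continuous f}.
  move=> t0; have c1 : {for t, continuous (fun t => j / q t)}.
    apply: cvgM; first exact: cvg_cst.
    by apply: cvgV; [rewrite gt_eqF// q0|exact: cq].
  apply: cvgM; last exact: (cvgM c1 c1).
  by apply: cvgM; [exact: cvg_cst|exact: cf].
have mpE : measurable_fun setT (fun t => (p t)%:E) by exact/measurable_EFinP.
have pE : (\int[exp4]_t (p t)%:E = (2 * (j - ln (1 + j)))%:E)%E.
  rewrite ge0_integral_exp4//.
  transitivity (\int[lam]_(t in `[(0%R : R), +oo[) (f t)%:E)%E.
    rewrite [RHS]integral_mkcond; apply: eq_integral => t _.
    rewrite -EFinM patchE/=; case: ifPn => [|t0].
      by rewrite inE/= in_itv/= andbT => t0; rewrite pdf4E// mulrC.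
    rewrite /pdf4 lt0_exponential_pdf ?mulr0//.
    by rewrite ltNge; apply: contra t0 => t0; rewrite inE/= in_itv/= t0.
  rewrite (@ge0_continuous_FTC2y _ f F 0 (- (2 * (1 + j) / (1 + j)) - 2 * ln (1 + j))).
  - rewrite -EFinD; congr EFin; rewrite /F /q /r mulr0 oppr0 expR0 subrr mul0r addr0 ln1.
    by field; rewrite gt_eqF// ltr_pwDl.
  - by move=> t t0; apply: mulr_ge0 => //; rewrite mulr_ge0// expR_ge0.
  - apply/continuous_within_itvcyP; split.
      by move=> t; rewrite in_itv/= andbT => /ltW; exact: cft.
    by apply: cvg_at_right_filter; exact: cft.
  - have cq1 : q t @[t --> +oo] --> 1 + j.
      rewrite -[j in X in _ --> X]mul1r -[X in X * j](subr0 1).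
      apply: cvgD; first exact: cvg_cst.
      apply: cvgM; last exact: cvg_cst.
      by apply: cvgB; [exact: cvg_cst|exact: cvg_exp].
    have j1 : 0 < 1 + j by rewrite ltr_pwDl.
    apply: cvgB.
      apply: cvgN; apply: cvgM; first exact: cvg_cst.
      by apply: cvgV => //; rewrite gt_eqF.
    apply: cvgM; first exact: cvg_cst.
    by apply: (@continuous_cvg _ _ _ _ _ q (@ln R) (1 + j)) => //; exact: continuous_ln.
  - by move=> t t0; have [] := dF t (ltW t0).
  - by apply: cvg_at_right_filter; have [] := dF 0 (lexx 0) => /derivable1_diffP/differentiable_continuous.
  - move=> t; rewrite in_itv/= andbT => t0; rewrite derive1E.
    by have [_ ->] := dF t (ltW t0).
have ip : intR exp4 p by apply/(intRP exp4 mp p0); rewrite pE ltry.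
by split => //; apply/EFin_inj; rewrite rintE.
Qed.

End exponential_time.

(** * Regularity of the Mehler average at a fixed time *)

Section mehler_regularity.
Context {R : realType} {n : nat} (gamma : probability 'rV[R]_n R).
Hypothesis gaussE : std_gaussian gamma.
Local Notation V := 'rV[R]_n.

(** In this form the exponent is at most |x|^2 / 2 for every [z], so only the factor [s^-n] can make
    the kernel large. *)
Lemma gauss_kernelE (c s : R) (x z : V) : c ^+ 2 + s ^+ 2 = 1 -> 0 < s ->
  gauss_kernel (c *: x) s z = s^-1 ^+ n *
    expR (dotv x x / 2 - dotv (c *: z - x) (c *: z - x) / (2 * s ^+ 2)).
Proof.
move=> cs s0; have s2 : s ^+ 2 = 1 - c ^+ 2 by rewrite -cs addrC addKr.
have sn0 : s != 0 by rewrite gt_eqF.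
have c2n0 : 1 - c ^+ 2 != 0 by rewrite -s2 sqrf_eq0.
transitivity (\prod_(i < n) (s^-1 * expR (x 0 i * x 0 i / 2 -
    (c * z 0 i - x 0 i) * (c * z 0 i - x 0 i) / (2 * s ^+ 2)))).
  apply: eq_bigr => i _; rewrite /normal_kernel !mxE; congr (_ * expR _).
  by rewrite s2; field.
rewrite big_split /= prodr_const card_ord -expR_sum; congr (_ * expR _).
rewrite sumrB /dotv !mulr_suml; congr (_ - _).
by apply: eq_bigr => i _; rewrite !mxE.
Qed.

(** One term of the exponential series of y^2 / 2, of degree n + 1, already dominates. It is applied
    to y = 1/s. *)
Lemma expr_le_expR (y : R) : 1 <= y ->
  y ^+ n <= 2 ^+ n.+1 * n.+1`!%:R * expR (y ^+ 2 / 2).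
Proof.
move=> y1; have y0 : 0 <= y by apply: le_trans y1.
have h : (y ^+ 2 / 2) ^+ n.+1 / n.+1`!%:R <= expR (y ^+ 2 / 2).
  by apply: le_trans (expR_ge1Dxn n _); rewrite ?lerDr// divr_ge0 ?sqr_ge0.
have f0 : 0 < n.+1`!%:R :> R by rewrite ltr0n fact_gt0.
rewrite ler_pdivrMr// expr_div_n ler_pdivrMr ?exprn_gt0// in h.
have : y ^+ n <= (y ^+ 2) ^+ n.+1.
  by rewrite -exprM; apply: ler_weXn2l => //; rewrite mul2n -addnn addnS ltnW// ltnS addSn leqW// leq_addr.
move=> /le_trans; apply; rewrite (le_trans h)//.
by rewrite le_eqVlt; apply/orP; left; apply/eqP; ring.
Qed.

Variable psi : V -> R.
Hypotheses (cpsi : continuous psi) (ipsi2 : intR gamma (fun x => psi x ^+ 2)).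

Let mpsi : measurable_fun setT psi. Proof. exact: continuous_measurable_rV. Qed.

Let mshift (c s : R) (x : V) : measurable_fun setT (fun y : V => c *: x + s *: y).
Proof. by apply: measurable_rVD => //; exact: measurable_rVZ. Qed.

(** The bound is uniform in time. If |c z - x| >= 1 the Gaussian factor beats [s^-n]; if c < 1/2
    then 1/s <= 2; in both cases the kernel is at most [C]. Otherwise [z] stays in a bounded set,
    where [psi] is at most [B]. *)
Lemma mehler_sqr_bound (r : R) : 0 <= r -> exists M, 0 <= M /\
  forall c s x, 0 <= c -> 0 < s -> c ^+ 2 + s ^+ 2 = 1 -> dotv x x <= r ->
  intR gamma (fun y => psi (c *: x + s *: y) ^+ 2) /\
  rint gamma (fun y => psi (c *: x + s *: y) ^+ 2) <= M.
Proof.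
move=> r0.
(* In the remaining case c^2 |z|^2 <= 2 |c z - x|^2 + 2 |x|^2 <= 2 + 2r with c^2 >= 1/4, so |z|^2 <=
   8 (r + 1). *)
have [B [B0 hB]] := continuous_bounded_on (8 * (r + 1)) cpsi.
pose Cn : R := 2 ^+ n.+1 * n.+1`!%:R.
have Cn0 : 0 <= Cn by rewrite mulr_ge0 ?exprn_ge0 ?ler0n.
pose C := (Cn + 2 ^+ n) * expR (r / 2).
have C0 : 0 <= C by rewrite mulr_ge0 ?expR_ge0// addr_ge0 ?exprn_ge0.
pose M := C * rint gamma (fun x => psi x ^+ 2) + B ^+ 2.
have M0 : 0 <= M.
  rewrite addr_ge0 ?sqr_ge0// mulr_ge0//.
  by apply: rint_ge0 => x; exact: sqr_ge0.
exists M; split => // c s x c0 s0 cs xr.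
have s1 : s <= 1.
  by have := sqr_ge0 c; nra.
have is1 : 1 <= s^-1 by rewrite invf_ge1.
pose K := gauss_kernel (c *: x) s.
have mK : measurable_fun setT K.
  apply: measurable_prod => i _.
  exact: measurableT_comp (measurable_normal_kernel _ _) (measurable_coord i).
have K0 z : 0 <= K z by exact: gauss_kernel_ge0.
have K1 : (\int[gamma]_z (K z)%:E = 1)%E.
  have := ge0_integral_gauss_affine gaussE (c *: x) s0 (measurable_cst (1%E : \bar R)) (fun=> lee01).
  rewrite integral_cst// [X in (_ * X)%E]probability_setT mul1e => ->.
  by apply: eq_integral => z _; rewrite mul1e.
have iK : intR gamma K by apply/(intRP gamma mK K0); rewrite K1 ltry.
have rK : rint gamma K = 1 by rewrite /rint /Rintegral K1.
have le z : psi z ^+ 2 * K z <= C * psi z ^+ 2 + B ^+ 2 * K z.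
  pose q := dotv (c *: z - x) (c *: z - x).
  have KE : K z = s^-1 ^+ n * expR (dotv x x / 2 - q / (2 * s ^+ 2)).
    exact: gauss_kernelE.
  have exr : expR (dotv x x / 2) <= expR (r / 2) by rewrite ler_expR ler_wpM2r.
  have [q1|q1] := leP 1 q.
    suff KC : K z <= C.
      by rewrite -[leLHS]addr0 lerD// ?mulr_ge0 ?sqr_ge0// mulrC ler_wpM2r ?sqr_ge0.
    rewrite KE expRD mulrCA.
    apply: (@le_trans _ _ (expR (r / 2) * Cn)); last first.
      by rewrite /C mulrC ler_wpM2r ?expR_ge0// lerDl exprn_ge0.
    apply: ler_pM => //; rewrite ?expR_ge0 ?mulr_ge0 ?exprn_ge0 ?invr_ge0 ?expR_ge0 ?(ltW s0)//.
    have := expr_le_expR is1 => h; apply: le_trans (ler_wpM2r (expR_ge0 _) h) _.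
    rewrite -/Cn -mulrA -expRD ler_piMr// -[leRHS]expR0 ler_expR.
    rewrite (_ : _ + _ = (1 - q) / (2 * s ^+ 2)); last by field; rewrite gt_eqF.
    by rewrite mulr_le0_ge0 ?subr_le0// invr_ge0 mulr_ge0 ?sqr_ge0.
  have [c2|c2] := leP (2^-1) c.
    suff zr : dotv z z <= 8 * (r + 1).
      have := hB _ zr => pB.
      rewrite -[leLHS]add0r; apply: lerD; first by rewrite mulr_ge0 ?sqr_ge0.
      apply: ler_wpM2r => //; rewrite -real_normK ?num_real//.
      by rewrite ler_pXn2r ?nnegrE.
    have q0 : 0 <= dotv (c *: z - 2 *: x) (c *: z - 2 *: x) by exact: dotv_ge0.
    have h1 : c ^+ 2 * dotv z z <= 2 * q + 2 * dotv x x.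
      have e1 : q = c ^+ 2 * dotv z z - 2 * c * dotv z x + dotv x x.
        rewrite /q -[- x]scaleN1r !(dotvDl, dotvDr, dotvZl, dotvZr) (dotvC x z); ring.
      move: q0; rewrite -scaleNr !(dotvDl, dotvDr, dotvZl, dotvZr) (dotvC x z) e1.
      by set a := dotv z z; set b := dotv z x; set d := dotv x x; nra.
    have z0 := dotv_ge0 z.
    have c4 : 4^-1 <= c ^+ 2 by nra.
    have := ler_wpM2r z0 c4; lra.
  have KC : K z <= C.
    rewrite KE expRD mulrCA /C mulrC.
    apply: ler_pM; rewrite ?mulr_ge0 ?expR_ge0 ?exprn_ge0 ?invr_ge0 ?(ltW s0)//.
    apply: (@le_trans _ _ (2 ^+ n)); last by rewrite lerDr.
    rewrite -[leRHS]mulr1; apply: ler_pM; rewrite ?expR_ge0 ?exprn_ge0 ?invr_ge0 ?(ltW s0)//.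
      have s2 : s^-1 <= 2.
        by rewrite -[leRHS]invrK lef_pV2 ?posrE ?invr_gt0//; nra.
      by apply: lerXn2r; rewrite ?nnegrE ?invr_ge0 ?(ltW s0).
    by rewrite -[leRHS]expR0 ler_expR oppr_le0 divr_ge0 ?dotv_ge0// mulr_ge0 ?sqr_ge0.
  by rewrite -[leLHS]addr0 lerD// ?mulr_ge0 ?sqr_ge0// mulrC ler_wpM2r ?sqr_ge0.
have irhs : intR gamma (fun z => C * psi z ^+ 2 + B ^+ 2 * K z).
  by apply: intRD; exact: intRZ.
have mp2 : measurable_fun setT (fun x => psi x ^+ 2) by exact: measurable_funX.
have ipK : intR gamma (fun z => psi z ^+ 2 * K z).
  apply: intR_le irhs; first exact: measurable_funM.
  by move=> z; rewrite ger0_norm; [exact: le|rewrite mulr_ge0 ?sqr_ge0].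
have mp2s : measurable_fun setT (fun y : V => psi (c *: x + s *: y) ^+ 2).
  exact: measurableT_comp mp2 (mshift c s x).
have IE : (\int[gamma]_y (psi (c *: x + s *: y) ^+ 2)%:E = (rint gamma (fun z => psi z ^+ 2 * K z))%:E)%E.
  rewrite rintE//.
  have mE : measurable_fun setT (fun z => (psi z ^+ 2)%:E) by exact/measurable_EFinP.
  have E0 z : (0 <= (psi z ^+ 2)%:E)%E by rewrite lee_fin sqr_ge0.
  apply: eq_trans (ge0_integral_gauss_affine gaussE (c *: x) s0 mE E0) _.
  by apply: eq_integral => z _; rewrite EFinM.
have ip : intR gamma (fun y => psi (c *: x + s *: y) ^+ 2).
  by apply/(intRP gamma mp2s); [move=> y; exact: sqr_ge0|rewrite IE ltry].
split => //; rewrite {1}/rint /Rintegral IE /=.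
apply: (le_trans (le_rint ipK irhs le)).
by rewrite rintD; [rewrite !rintZ// rK mulr1|exact: intRZ..].
Qed.

Section fixed_time.
Variables c s : R.
Hypotheses (c0 : 0 <= c) (s0 : 0 < s) (cs : c ^+ 2 + s ^+ 2 = 1).

Definition mehler (x : V) : R := rint gamma (fun y => psi (c *: x + s *: y)).
(** The derivative of [mehler] with the differentiation moved from [psi] to the Gaussian density, as
    nothing bounds the gradient of [psi]. *)
Definition dmehler (v x : V) : R :=
  c / s * rint gamma (fun y => psi (c *: x + s *: y) * dotv v y).

Let k := c / s.
Let k0 : 0 <= k. Proof. by rewrite divr_ge0// ltW. Qed.

Let ip2 x : intR gamma (fun y => psi (c *: x + s *: y) ^+ 2).
Proof.
have [M [_ h]] := mehler_sqr_bound (dotv_ge0 x).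
by have [] := h c s x c0 s0 cs (lexx _).
Qed.

Let mp x : measurable_fun setT (fun y : V => psi (c *: x + s *: y)).
Proof. exact: measurableT_comp mpsi (mshift c s x). Qed.

Lemma dmehler_le v x M : rint gamma (fun y => psi (c *: x + s *: y) ^+ 2) <= M ->
  `|dmehler v x| <= c / s * (2^-1 * (M + dotv v v)).
Proof.
move=> hM; rewrite /dmehler normrM -/k ger0_norm// ler_wpM2l//.
have i1 : intR gamma (fun y => psi (c *: x + s *: y) * dotv v y).
  by apply: intRM_sqr => //; [exact: measurable_dotvl|exact: intR_dotv_sqr].
rewrite (le_trans (le_normr_Rintegral measurableT i1))//.
have i2 : intR gamma (fun y => 2^-1 * (psi (c *: x + s *: y) ^+ 2 + dotv v y ^+ 2)).
  by apply: intRZ; apply: intRD => //; exact: intR_dotv_sqr.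
apply: (@le_trans _ _ (rint gamma (fun y => 2^-1 * (psi (c *: x + s *: y) ^+ 2 + dotv v y ^+ 2)))).
  apply: le_rint => //; first exact: intR_abs.
  move=> y; rewrite normrM -(real_normK (num_real (psi _))) -(real_normK (num_real (dotv v y))).
  by have := sqr_ge0 (`|psi (c *: x + s *: y)| - `|dotv v y|); nra.
rewrite rintZ; last by apply: intRD => //; exact: intR_dotv_sqr.
rewrite ler_wpM2l ?invr_ge0// rintD//; last exact: intR_dotv_sqr.
by rewrite (rint_dotv_sqr gaussE) lerD2r.
Qed.

Let w (v : V) (r : R) (y : V) := expR (k * r * dotv v y - k ^+ 2 * r ^+ 2 * dotv v v / 2).

(** A Cameron-Martin shift of [y] by -(c r / s) v cancels the displacement of [x]; only the weight
    then depends on [r]. *)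
Lemma mehler_line x v r :
  mehler (x + r *: v) = rint gamma (fun y => psi (c *: x + s *: y) * w v r y).
Proof.
pose a := - (k * r) *: v.
rewrite /mehler -(rint_cameron_martin gaussE a (mp (x + r *: v))).
apply: eq_rint => y; congr (psi _ * _).
  rewrite /a scalerDr [s *: (y + _)]scalerDr !scalerA addrACA -scalerDl.
  rewrite (_ : c * r + s * - (k * r) = 0) ?scale0r ?addr0//.
  by rewrite /k; field; rewrite gt_eqF.
rewrite /cm_weight /w /a !dotvZl !dotvZr; congr expR; ring.
Qed.

Let f x v r y := psi (c *: x + s *: y) * w v r y.
Let f' x v r y := psi (c *: x + s *: y) * ((k * dotv v y - k ^+ 2 * r * dotv v v) * w v r y).
(** Dominates both integrand and derivative for |r| < 1. The extra 1 in [k + 1] pays for the linear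
    factor v . y. *)
Let G x v y := (1 + k + k ^+ 2 * dotv v v) * `|psi (c *: x + s *: y) * expR ((k + 1) * `|dotv v y|)|.

Let iG x v : intR gamma (G x v).
Proof.
apply: intRZ; apply: intR_abs.
have mE : measurable_fun setT (fun y => expR ((k + 1) * `|dotv v y|)).
  apply: measurableT_comp => //; apply: measurable_funM => //.
  by apply: measurableT_comp => //; exact: measurable_dotvl.
apply: intRM_sqr => //.
apply: eq_intR (intR_expR_norm gaussE ((2 * (k + 1)) *: v)) => y.
rewrite dotvZl normrM ger0_norm; last by rewrite mulr_ge0// addr_ge0.
by rewrite expr2 -expRD; congr expR; ring.
Qed.

Let w_le v r y : -1 < r < 1 -> w v r y <= expR (k * `|dotv v y|).
Proof.
move=> /andP[r1 r2]; rewrite /w ler_expR.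
have h1 : k * r * dotv v y <= k * `|dotv v y|.
  rewrite -mulrA ler_wpM2l// (le_trans (ler_norm _))// normrM ler_piMl//.
  by rewrite ler_norml !ltW.
have h2 : 0 <= k ^+ 2 * r ^+ 2 * dotv v v / 2.
  by rewrite divr_ge0// mulr_ge0 ?dotv_ge0// mulr_ge0 ?sqr_ge0.
by rewrite lerBlDr (le_trans h1)// lerDl.
Qed.

Let wn v r y : `|w v r y| = w v r y. Proof. by rewrite ger0_norm// expR_ge0. Qed.

Let fG x v r y : -1 < r < 1 -> `|f x v r y| <= G x v y.
Proof.
move=> r1; rewrite /f /G normrM wn normrM (ger0_norm (expR_ge0 _)) mulrCA; apply: ler_wpM2l => //.
apply: le_trans (w_le v y r1) _.
have h : 1 <= 1 + k + k ^+ 2 * dotv v v.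
  by rewrite -addrA lerDl addr_ge0// mulr_ge0 ?sqr_ge0 ?dotv_ge0.
rewrite -[leLHS]mul1r ler_pM ?expR_ge0// ler_expR ler_wpM2r// lerDl//.
Qed.

Let f'G x v r y : -1 < r < 1 -> `|f' x v r y| <= G x v y.
Proof.
move=> r1; rewrite /f' /G normrM [X in _ * X]normrM wn [X in _ <= _ * X]normrM (ger0_norm (expR_ge0 _)) [leRHS]mulrCA; apply: ler_wpM2l => //.
have -> : expR ((k + 1) * `|dotv v y|) = expR `|dotv v y| * expR (k * `|dotv v y|).
  by rewrite -expRD; congr expR; ring.
rewrite [leRHS]mulrA.
have wl := w_le v y r1.
have [r2 r3] := andP r1.
have d0 := dotv_ge0 v.
have e1 : 1 + `|dotv v y| <= expR `|dotv v y| := expR_ge1Dx _.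
have h : `|k * dotv v y - k ^+ 2 * r * dotv v v| <=
   (1 + k + k ^+ 2 * dotv v v) * expR `|dotv v y|.
  have n1 : `|k * dotv v y| = k * `|dotv v y| by rewrite normrM ger0_norm.
  have n2 : `|k ^+ 2 * r * dotv v v| = k ^+ 2 * `|r| * dotv v v.
    by rewrite normrM (ger0_norm d0) normrM (ger0_norm (sqr_ge0 k)).
  apply: le_trans (ler_normB _ _) _; rewrite n1 n2.
  have a1 : k * `|dotv v y| <= k * expR `|dotv v y|.
    by rewrite ler_wpM2l// (le_trans _ e1)// lerDr.
  have a2 : k ^+ 2 * `|r| * dotv v v <= k ^+ 2 * dotv v v * expR `|dotv v y|.
    rewrite mulrAC; apply: ler_wpM2l; first by apply: mulr_ge0 => //; exact: sqr_ge0.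
    apply: (@le_trans _ _ 1); first by rewrite ler_norml !ltW.
    by rewrite (le_trans _ e1)// lerDl.
  rewrite mulrDl mulrDl mul1r -addrA (le_trans (lerD a1 a2))// lerDr expR_ge0//.
by apply: ler_pM; rewrite ?expR_ge0.
Qed.

Let mw v r : measurable_fun setT (w v r).
Proof.
apply: measurableT_comp => //; apply: measurable_funB => //.
by apply: measurable_funM => //; exact: measurable_dotvl.
Qed.

Let dw v y (r : R) : is_derive r 1 (fun r => w v r y)
  ((k * dotv v y - k ^+ 2 * r * dotv v v) * w v r y).
Proof.
have d0 : is_derive r 1 (fun r : R => k * r * dotv v y - k ^+ 2 * r ^+ 2 * dotv v v / 2)
    (k * dotv v y - k ^+ 2 * r * dotv v v).
  by apply: is_derive_eq; rewrite /GRing.scale/=; field.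
have d1 := @is_derive1_comp R expR _ r _ _ (is_derive_expR _) d0.
by apply: (is_derive_eq d1); rewrite mulrC.
Qed.

Let is_derive_mehler_at x v (r : R) : -1 < r < 1 ->
  is_derive r 1 (fun r => mehler (x + r *: v)) (rint gamma (f' x v r)).
Proof.
move=> r1; rewrite (_ : (fun r => _) = fun r => rint gamma (f x v r)); last first.
  by apply/funext => t; rewrite mehler_line.
apply: (@is_derive_rint _ _ _ gamma (f x v) (f' x v) (G x v) r (-1) 1 r1).
- move=> t t1; apply: intR_le (iG x v); first exact: measurable_funM.
  by move=> y; exact: fG.
- move=> t y _; rewrite /f /f'; have d := dw v y t.
  by apply: is_derive_eq; rewrite /GRing.scale/=; ring.
- exact: iG.
- by move=> t y; exact: f'G.
Qed.

Lemma is_derive_mehler x v : is_derive x v mehler (dmehler v x).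
Proof.
apply: is_derive_of_line.
have h : -1 < (0 : R) < 1 by rewrite ltrN10 ltr01.
have d := is_derive_mehler_at x v h.
apply: (is_derive_eq d); rewrite /dmehler -rintZ; last first.
  by apply: intRM_sqr => //; [exact: measurable_dotvl|exact: intR_dotv_sqr].
apply: eq_rint => y; rewrite /f' /w (_ : _ - _ / 2 = 0); last by ring.
by rewrite expR0 mulr1 mulr0 mul0r subr0 mulrCA.
Qed.

Lemma continuous_dmehler x v : continuous (fun r : R => dmehler v (x + r *: v)).
Proof.
have c1 y : {for 0, continuous (fun r : R => dmehler v (y + r *: v))}.
  have E (r : R) : -1 < r < 1 -> dmehler v (y + r *: v) = rint gamma (f' y v r).
    move=> r1; have [_ <-] := is_derive_mehler_at y v r1.
    by have [_ <-] := is_derive_line (is_derive_mehler (y + r *: v) v).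
  have h : -1 < (0 : R) < 1 by rewrite ltrN10 ltr01.
  have cc : {for 0, continuous (fun r => rint gamma (f' y v r))}.
    apply: (@continuous_rint _ _ _ gamma (f' y v) (G y v) 0 (-1) 1 h).
    - move=> r _; apply: measurable_funM => //; apply: measurable_funM => //.
      by apply: measurable_funB => //; apply: measurable_funM => //; exact: measurable_dotvl.
    - move=> z; apply: derivable1_continuous => r; rewrite /f'.
      by have d := dw v z r; exact: ex_derive.
    - exact: iG.
    - by move=> r z; exact: f'G.
  rewrite /prop_for /continuous_at /= (E 0 h).
  apply: cvg_trans cc; apply: near_eq_cvg.
  have h2 : (0 : R) \in `]-1, 1[ by rewrite in_itv.
  apply: filterS (near_in_itvoo h2) => r; rewrite in_itv/= => r1.
  by rewrite E.
move=> t.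
(* Domination is available only for |r| < 1; moving the base point to [x + t v] reduces continuity
   at [t] to continuity at 0. *)
have -> : (fun r : R => dmehler v (x + r *: v)) =
    (fun r => dmehler v ((x + t *: v) + r *: v)) \o (fun r => r - t).
  by apply/funext => r /=; rewrite -addrA -scalerDl [t + _]addrC subrK.
apply: (@continuous_comp _ _ _ (fun r : R => r - t)
  (fun r : R => dmehler v ((x + t *: v) + r *: v))).
  by apply: cvgB; [exact: cvg_id|exact: cvg_cst].
by rewrite subrr; exact: c1.
Qed.

End fixed_time.
End mehler_regularity.


(** * Integrability on a product from a bound on the sections *)

Section product_bound.
Context d1 d2 (T1 : measurableType d1) (T2 : measurableType d2) (R : realType).
Variables (m1 : probability T1 R) (m2 : {sigma_finite_measure set T2 -> \bar R}).

Lemma intR_prod_le (F : T1 * T2 -> R) (K : R) : 0 <= K -> measurable_fun setT F ->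
  (forall p, 0 <= F p) ->
  {ae m1, forall x, (\int[m2]_y (F (x, y))%:E <= K%:E)%E} ->
  intR (m1 \x m2)%E F /\ rint (m1 \x m2)%E F <= K.
Proof.
move=> K0 mF F0 FK.
have mFE : measurable_fun setT (EFin \o F) by exact/measurable_EFinP.
have F0E p : (0 <= (EFin \o F) p)%E by rewrite /= lee_fin.
have h : (\int[m1 \x m2]_p (F p)%:E <= K%:E)%E.
  rewrite [leLHS](@fubini_tonelli1 _ _ _ _ _ m1 m2 (EFin \o F) mFE F0E).
  apply: (@le_trans _ _ (\int[m1]_x K%:E)%E).
    have mf := @measurable_fun_fubini_tonelli_F _ _ _ _ _ m2 (EFin \o F) mFE F0E.
    apply: ae_ge0_le_integral => //.
    - by move=> x _; apply: integral_ge0 => y _; exact: F0E.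
    - by apply: filterS FK => x hx _.
  by rewrite integral_cst// [X in (_ * X)%E]probability_setT mule1.
have iF : intR (m1 \x m2)%E F.
  by apply/(intRP _ mF F0); exact: le_lt_trans h (ltry _).
by split => //; rewrite -lee_fin rintE.
Qed.

End product_bound.

Lemma exp4_ae_filter (R : realType) : Filter (almost_everywhere (@exp4 R)).
Proof. exact: ae_filter_ringOfSetsType. Qed.
#[local] Existing Instance exp4_ae_filter.

(** * Differentiability of phi *)

Section phi_regularity.
Context {R : realType} {n : nat} (gamma : probability 'rV[R]_n R).
Hypothesis gaussE : std_gaussian gamma.
Local Notation V := 'rV[R]_n.
Local Notation tau := (@exp4 R).

Variable psi : V -> R.
Hypotheses (cpsi : continuous psi) (ipsi2 : intR gamma (fun x => psi x ^+ 2)).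

Let c (t : R) := expR (- t).
Let s (t : R) := Num.sqrt (1 - expR (- (2 * t))).
Let s0 t : 0 < t -> 0 < s t. Proof. exact: OU_s_gt0. Qed.
Let cs t : 0 < t -> c t ^+ 2 + s t ^+ 2 = 1.
Proof. by move=> t0; rewrite OU_s_sqr// addrC subrK. Qed.
Let c0 t : 0 <= c t. Proof. exact: expR_ge0. Qed.
Let mc : measurable_fun [set: R] c.
Proof. exact: continuous_measurable_fun continuous_OU_c. Qed.
Let ms : measurable_fun [set: R] s.
Proof. exact: continuous_measurable_fun continuous_OU_s. Qed.
Let mpsi : measurable_fun setT psi. Proof. exact: continuous_measurable_rV. Qed.

Let zt (x : V) (q : measurableTypeR R * V) : V := c q.1 *: x + s q.1 *: q.2.

Let mzt x : measurable_fun setT (zt x).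
Proof.
apply: measurable_rVD.
  by apply: measurable_rVZ; [exact: measurableT_comp mc measurable_fst|exact: measurable_cst].
by apply: measurable_rVZ; [exact: measurableT_comp ms measurable_fst|exact: measurable_snd].
Qed.

Let mpz x : measurable_fun setT (fun q => psi (zt x q)).
Proof. exact: measurableT_comp mpsi (mzt x). Qed.

Let ipz2 x : intR (tau \x gamma)%E (fun q => psi (zt x q) ^+ 2).
Proof.
have [M [M0 hM]] := mehler_sqr_bound gaussE cpsi ipsi2 (dotv_ge0 x).
have [||||//] := @intR_prod_le _ _ _ _ _ tau gamma (fun q => psi (zt x q) ^+ 2) M.
- exact: M0.
- exact: measurable_funX.
- by move=> p; exact: sqr_ge0.
- apply: filterS ae_exp4_gt0 => t t0.
  have [h1 h2] := hM (c t) (s t) x (c0 t) (s0 t0) (cs t0) (lexx _).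
  by rewrite -(rintE h1) lee_fin.
Qed.

Let idv2 v : intR (tau \x gamma)%E (fun q => dotv v q.2 ^+ 2).
Proof.
have [||||//] := @intR_prod_le _ _ _ _ _ tau gamma (fun q => dotv v q.2 ^+ 2) (dotv v v).
- exact: dotv_ge0.
- apply: measurable_funX; exact: measurableT_comp (measurable_dotvl v) measurable_snd.
- by move=> p; exact: sqr_ge0.
- by apply: aeW => t; rewrite -(rintE (intR_dotv_sqr gaussE v)) lee_fin (rint_dotv_sqr gaussE).
Qed.

Let i1 : intR (tau \x gamma)%E (fun q => 1 ^+ 2).
Proof.
have [||||//] := @intR_prod_le _ _ _ _ _ tau gamma (fun q => 1 ^+ 2) 1.
- exact: ler01.
- exact: measurable_cst.
- by move=> p; exact: sqr_ge0.
- by apply: aeW => t; rewrite expr1n integral_cst// [X in (_ * X)%E]probability_setT mule1.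
Qed.

Lemma intR_mehler_path x : intR (tau \x gamma)%E (fun q => psi (zt x q)).
Proof.
apply: (@eq_intR _ _ _ _ (fun q => psi (zt x q) * 1)) => [q|]; first by rewrite mulr1.
exact: (intRM_sqr (mpz x) (measurable_cst _) (ipz2 x) i1).
Qed.

Let ipzv x v : intR (tau \x gamma)%E (fun q => psi (zt x q) * dotv v q.2).
Proof.
apply: (intRM_sqr (mpz x) _ (ipz2 x) (idv2 v)).
exact: measurableT_comp (measurable_dotvl v) measurable_snd.
Qed.

Lemma phi_ofE x : phi_of gamma psi x =
  rint (tau \x gamma)%E (fun q => psi (expR (- q.1) *: x +
    Num.sqrt (1 - expR (- (2 * q.1))) *: q.2)).
Proof.
have [h <-] := fubini_real1 (intR_mehler_path x).
by rewrite -rint_exp4.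
Qed.

(** The value 0 at t <= 0, a null set for the exponential law, makes the derivative formula and the
    domination valid for every [t]. *)
Let T t x := if 0 < t then mehler gamma psi (c t) (s t) x else 0.
Let D v t x := if 0 < t then dmehler gamma psi (c t) (s t) v x else 0.

Definition dphi v x := rint tau (fun t => D v t x).

Let mpos : measurable_fun [set: R] (fun t : R => 0 < t).
Proof. by apply: measurable_fun_ltr => //; exact: measurable_id. Qed.

Let iT x : intR tau (fun t => T t x) /\ phi_of gamma psi x = rint tau (fun t => T t x).
Proof.
have [h E] := fubini_real1 (intR_mehler_path x).
have mT : measurable_fun [set: R] (fun t => T t x).
  apply: measurable_fun_ifT => //; exact: intR_meas h.
have e : {ae tau, forall t, rint gamma (fun y => psi (zt x (t, y))) = T t x}.
  by apply: filterS ae_exp4_gt0 => t t0; rewrite /T t0.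
have [iT rT] := ae_eq_rint h mT e.
by split => //; rewrite phi_ofE -E.
Qed.

Let mD v x : measurable_fun [set: R] (fun t => D v t x).
Proof.
apply: measurable_fun_ifT => //; apply: measurable_funM.
  apply: measurable_funM => //.
  exact: measurableT_comp (@measurable_invr R) ms.
have [h _] := fubini_real1 (ipzv x v).
exact: intR_meas h.
Qed.

Let cs_or0 (t : R) := if 0 < t then c t / s t else 0.

Let D_le v r : 0 <= r -> exists K, forall t x, dotv x x <= r -> `|D v t x| <= K * cs_or0 t.
Proof.
move=> r0; have [M [_ hM]] := mehler_sqr_bound gaussE cpsi ipsi2 r0.
exists (2^-1 * (M + dotv v v)) => t x xr; rewrite /D /cs_or0; case: ifPn => t0; last first.
  by rewrite normr0 mulr0.
have [h1 h2] := hM (c t) (s t) x (c0 t) (s0 t0) (cs t0) xr.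
rewrite [leRHS]mulrC; apply: dmehler_le => //.
- exact: s0.
- exact: cs.
Qed.

Let line_le (x v : V) (r : R) : -1 < r < 1 ->
  dotv (x + r *: v) (x + r *: v) <= 2 * (dotv x x + dotv v v).
Proof.
move=> r1; have h := dotv_ge0 (x - r *: v).
have v0 := dotv_ge0 v.
have r2 : r ^+ 2 <= 1 by move: r1 => /andP[]; nra.
have h2 := ler_wpM2r v0 r2.
move: h; rewrite -scaleNr !(dotvDl, dotvDr, dotvZl, dotvZr) (dotvC v x); nra.
Qed.

Let h01 : -1 < (0 : R) < 1. Proof. by rewrite ltrN10 ltr01. Qed.

(** Differentiation under the time integral, dominated near [x] by a multiple of c/s, which
    [intR_cs] makes integrable. *)
Lemma is_derive_phi x v : is_derive x v (phi_of gamma psi) (dphi v x).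
Proof.
apply: is_derive_of_line.
rewrite (_ : (fun r => _) = fun r : R => rint tau (fun t => T t (x + r *: v))); last first.
  by apply/funext => r; have [_ ->] := iT (x + r *: v).
have r0 : 0 <= 2 * (dotv x x + dotv v v) by rewrite mulr_ge0// addr_ge0// dotv_ge0.
have [K hK] := D_le v r0.
have -> : dphi v x = rint tau (fun t => D v t (x + (0 : R) *: v)).
  by apply: eq_rint => t; rewrite scale0r addr0.
apply: (@is_derive_rint _ _ _ tau (fun (r : R) t => T t (x + r *: v))
  (fun (r : R) t => D v t (x + r *: v)) (fun t => K * cs_or0 t) 0 (-1) 1 h01).
- by move=> r _; have [] := iT (x + r *: v).
- move=> r t _; rewrite /T /D; case: ifPn => t0; last exact: is_derive_cst.
  apply: (@is_derive_line _ _ (mehler gamma psi (c t) (s t))).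
  apply: is_derive_mehler => //; [exact: s0|exact: cs].
- by apply: intRZ; exact: intR_cs.
- by move=> r t r1; apply: hK; exact: line_le.
Qed.

Lemma continuous_dphi x v : continuous (fun r : R => dphi v (x + r *: v)).
Proof.
have c1 y : {for 0, continuous (fun r : R => dphi v (y + r *: v))}.
  have r0 : 0 <= 2 * (dotv y y + dotv v v) by rewrite mulr_ge0// addr_ge0// dotv_ge0.
  have [K hK] := D_le v r0.
  apply: (@continuous_rint _ _ _ tau (fun (r : R) t => D v t (y + r *: v))
    (fun t => K * cs_or0 t) 0 (-1) 1 h01).
  - by move=> r _; exact: mD.
  - move=> t; rewrite /D; case: (boolP (0 < (t : R))) => t0; last exact: cont_cst.
    apply: continuous_dmehler => //; [exact: s0|exact: cs].
  - by apply: intRZ; exact: intR_cs.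
  - by move=> r t r1; apply: hK; exact: line_le.
move=> t.
have -> : (fun r : R => dphi v (x + r *: v)) =
    (fun r => dphi v ((x + t *: v) + r *: v)) \o (fun r => r - t).
  by apply/funext => r /=; rewrite -addrA -scalerDl [t + _]addrC subrK.
apply: (@continuous_comp _ _ _ (fun r : R => r - t)
  (fun r : R => dphi v ((x + t *: v) + r *: v))).
  by apply: cvgB; [exact: cvg_id|exact: cvg_cst].
by rewrite subrr; exact: c1.
Qed.

End phi_regularity.

(** * Products of probability laws and exchange of factors *)

Section product_probability.
Context d1 d2 (T1 : measurableType d1) (T2 : measurableType d2) (R : realType).
Variables (P1 : probability T1 R) (P2 : probability T2 R).

Let product_setT : (P1 \x P2)%E setT = 1%E.
Proof.
rewrite -setXTT product_measure1E//.
by rewrite [X in (X * _)%E]probability_setT [X in (_ * X)%E]probability_setT mul1e.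
Qed.

HB.instance Definition _ :=
  Measure_isProbability.Build _ _ R (P1 \x P2)%E product_setT.

End product_probability.

Section triple_product.
Context d1 d2 d3 (T1 : measurableType d1) (T2 : measurableType d2)
  (T3 : measurableType d3) (R : realType).
Variables (P1 : probability T1 R) (P2 : probability T2 R) (P3 : probability T3 R).

Let P13 : probability (T1 * T3)%type R := (P1 \x P3)%E.
Let P23 : probability (T2 * T3)%type R := (P2 \x P3)%E.

Let sw (q : T2 * (T1 * T3)) : T1 * (T2 * T3) := (q.2.1, (q.1, q.2.2)).

Let msw : measurable_fun setT sw.
Proof.
have m2 : measurable_fun setT (fun q : T2 * (T1 * T3) => q.2) by exact: measurable_snd.
apply: measurable_fun_pair; first exact: measurableT_comp measurable_fst m2.
apply: measurable_fun_pair; first exact: measurable_fst.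
exact: measurableT_comp measurable_snd m2.
Qed.

(** Both products are unfolded into iterated integrals by Tonelli, and the two outer ones are
    exchanged. *)
Lemma ge0_integral_triple_swap (h : T1 * (T2 * T3) -> \bar R) :
  measurable_fun setT h -> (forall p, (0 <= h p)%E) ->
  (\int[P2 \x P13]_q (h (sw q) * (cst 1 q)%:E) = \int[P1 \x P23]_p h p)%E.
Proof.
move=> mh h0.
transitivity (\int[P2 \x P13]_q h (sw q))%E.
  by apply: eq_integral => q _; rewrite mule1.
have mhs := measurableT_comp mh msw.
rewrite [LHS](fubini_tonelli1 (m1 := P2) (m2 := P13) _ mhs (fun q => h0 _)).
rewrite [RHS](fubini_tonelli1 (m1 := P1) (m2 := P23) _ mh h0).
pose k (q : (T1 * T2) * T3) := h (q.1.1, (q.1.2, q.2)).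
have mk : measurable_fun setT k.
  have m1 : measurable_fun setT (fun q : (T1 * T2) * T3 => q.1) by exact: measurable_fst.
  apply: (measurableT_comp mh); apply: measurable_fun_pair.
    exact: measurableT_comp measurable_fst m1.
  apply: measurable_fun_pair; first exact: measurableT_comp measurable_snd m1.
  exact: measurable_snd.
have mF := @measurable_fun_fubini_tonelli_F _ _ _ _ R P3 k mk (fun q => h0 _).
transitivity (\int[P2]_t \int[P1]_x \int[P3]_y h (x, (t, y)))%E.
  apply: eq_integral => t _.
  have mt : measurable_fun setT (fun q : T1 * T3 => h (sw (t, q))).
    exact: (measurableT_comp mhs (pair1_measurable t)).
  exact: (fubini_tonelli1 (m1 := P1) (m2 := P3) _ mt (fun q => h0 _)).
transitivity (\int[P1]_x \int[P2]_t \int[P3]_y h (x, (t, y)))%E.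
  apply/esym.
  apply: (@fubini_tonelli _ _ _ _ _ P1 P2 (fubini_F P3 k) mF) => q.
  by apply: integral_ge0 => y _; exact: h0.
apply: eq_integral => x _; apply/esym.
have mx : measurable_fun setT (fun q : T2 * T3 => h (x, q)).
  exact: (measurableT_comp mh (pair1_measurable x)).
exact: (fubini_tonelli1 (m1 := P2) (m2 := P3) _ mx (fun q => h0 _)).
Qed.

Lemma triple_swap (h : T1 * (T2 * T3) -> R) : measurable_fun setT h ->
  intR (P2 \x P13)%E (fun q => h (sw q)) ->
  intR (P1 \x P23)%E h /\ rint (P1 \x P23)%E h = rint (P2 \x P13)%E (fun q => h (sw q)).
Proof.
move=> mh ih.
have m1 : measurable_fun setT (@cst (T2 * (T1 * T3)) R 1) by exact: measurable_cst.
split; last first.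
  rewrite -(@rint_transfer _ _ _ _ R (P2 \x P13)%E (P1 \x P23)%E sw (cst 1) (fun=> ler01)
    ge0_integral_triple_swap h mh).
  by apply: eq_rint => q; rewrite mulr1.
apply/integrableP; split; first exact/measurable_EFinP.
rewrite -ge0_integral_triple_swap//; last first.
  by apply: measurableT_comp => //; exact/measurable_EFinP.
case/integrableP: ih => _; rewrite (_ : (\int[_]_q (_ * _) = \int[P2 \x P13]_q `|(h (sw q))%:E|)%E)//.
by apply: eq_integral => q _; rewrite mule1.
Qed.

End triple_product.

(** * The bound on the Stein vector *)

Section stein.
Context {R : realType} {n : nat} (gamma : probability 'rV[R]_n R).
Hypothesis gaussE : std_gaussian gamma.
Local Notation V := 'rV[R]_n.
Local Notation gamma2 := (gamma \x gamma)%E.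
Local Notation tau := (@exp4 R).

Variable g : V -> R.
Hypotheses (C1g : C1 g) (g0 : forall x, 0 <= g x).
Hypotheses (ig : intR gamma g) (mass1 : mass gamma g = 1)
  (iI : intR gamma (fun x => dotv (grad g x) (grad g x) / g x))
  (iG : forall v, intR gamma (fun x => dotv v x ^+ 2 * g x)).

Let c (t : R) := expR (- t).
Let s (t : R) := Num.sqrt (1 - expR (- (2 * t))).
Let s0 t : 0 < t -> 0 < s t. Proof. exact: OU_s_gt0. Qed.
Let cs t : 0 < t -> c t ^+ 2 + s t ^+ 2 = 1.
Proof. by move=> t0; rewrite OU_s_sqr// addrC subrK. Qed.
Let mc : measurable_fun [set: R] c.
Proof. exact: continuous_measurable_fun continuous_OU_c. Qed.
Let ms : measurable_fun [set: R] s.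
Proof. exact: continuous_measurable_fun continuous_OU_s. Qed.

Let mg : measurable_fun setT g. Proof. exact: measurable_C1. Qed.

Variable psi : V -> R.
Hypothesis psi_adm : admissible gamma g psi.

Let C1psi : C1 psi. Proof. by case: psi_adm. Qed.
Let cpsi : continuous psi. Proof. by case: C1psi. Qed.
Let mpsi : measurable_fun setT psi. Proof. exact: measurable_C1. Qed.

Let z t (p : V * V) := c t *: p.1 + s t *: p.2.

Let mz t : measurable_fun setT (z t).
Proof. by apply: measurable_rVD; exact: measurable_rVZ. Qed.

Let F t (p : V * V) : R := psi p.1 ^+ 2 * g (z t p).

Let mpz t : measurable_fun setT (F t).
Proof.
apply: measurable_funM; last exact: measurableT_comp mg (mz t).
by apply: measurable_funX; exact: measurableT_comp mpsi measurable_fst.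
Qed.

Let F0 t (p : V * V) : 0 <= F t p.
Proof. by rewrite mulr_ge0 ?sqr_ge0. Qed.

(** By Tonelli, the admissibility condition at time [t] is a bound on a double integral. *)
Lemma admissible_mix t : 0 < t -> intR gamma2 (fun p => psi p.1 ^+ 2 * g (z t p)) /\
  rint gamma2 (fun p => psi p.1 ^+ 2 * g (z t p)) <= 1.
Proof.
move=> t0.
have h : (\int[gamma2]_p (F t p)%:E <= 1)%E.
  have mFE : measurable_fun setT (EFin \o F t).
    by apply/measurable_EFinP; exact: mpz.
  have F0E p : (0 <= (EFin \o F t) p)%E.
    by rewrite lee_fin; exact: F0.
  have [_ /(_ t (ltW t0)) adm] := psi_adm.
  apply: le_trans adm.
  rewrite [leLHS](fubini_tonelli1 (m1 := gamma) (m2 := gamma) _ mFE F0E).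
  rewrite le_eqVlt; apply/orP; left; apply/eqP; apply: ae_eq_integral => //.
  - exact: measurable_fun_fubini_tonelli_F.
  - apply/measurable_EFinP; apply: measurable_funM; first exact: measurable_funX.
    have [iO _] := fubini_real1 (intR_z gaussE (s0 t0) (cs t0) ig).
    exact: intR_meas iO.
  (* [OU] is real-valued, so it represents the inner integral only where that is finite, which is
     almost everywhere. *)
  - have := ae_intR1 (intR_z gaussE (s0 t0) (cs t0) ig).
    apply: filterS => x ix _.
    rewrite /fubini_F /=.
    have -> : OU gamma t g x = rint gamma (fun y => g (c t *: x + s t *: y)) by [].
    rewrite EFinM rintE// -ge0_integralZl_EFin//.
    + by move=> y _; rewrite lee_fin.
    + by apply/measurable_EFinP; exact: intR_meas ix.
    + exact: sqr_ge0.
have iF : intR gamma2 (F t).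
  by apply/(intRP _ (mpz t) (F0 t)); exact: le_lt_trans h (ltry _).
by split => //; rewrite -lee_fin rintE.
Qed.

(** As t tends to infinity the moving point tends to [y], and Fatou's lemma leaves the integral of
    psi^2 times the mass of [g], which is 1. *)
Lemma admissible_sqr : intR gamma (fun x => psi x ^+ 2).
Proof.
(* Values of e^(-t); the factor 1/2 keeps [ck 0] below 1, so that every time [tk k] is positive. *)
pose ck (k : nat) : R := k.+1%:R^-1 * 2^-1.
pose tk (k : nat) : R := - ln (ck k).
have ck0 k : 0 < ck k by rewrite mulr_gt0 ?invr_gt0.
have tk0 k : 0 < tk k.
  by rewrite oppr_gt0 ln_lt0// ck0 /ck -invfM invf_lt1 ?mulr_gt0// -natrM ltr1n muln2 doubleS.
have cE k : c (tk k) = ck k by rewrite /c opprK lnK// posrE.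
have sE k : s (tk k) = Num.sqrt (1 - ck k ^+ 2).
  rewrite /s; congr (Num.sqrt (1 - _)).
  by rewrite -cE /c expr2 -expRD; congr expR; ring.
have ck_cvg : ck @ \oo --> (0 : R).
  rewrite -[X in _ --> X](mul0r (2^-1 : R)).
  by apply: cvgM; [exact: cvg_harmonic|exact: cvg_cst].
have [iF _] : intR gamma2 (fun p => psi p.1 ^+ 2 * g p.2) /\
    rint gamma2 (fun p => psi p.1 ^+ 2 * g p.2) <= 1.
  apply: (fatou_real (F := fun k p => psi p.1 ^+ 2 * g (z (tk k) p)) (b := fun=> 1)).
  - by move=> k; exact: mpz.
  - by move=> k p; exact: F0.
  - move=> p.
    have -> : psi p.1 ^+ 2 * g p.2 = psi p.1 ^+ 2 * g ((0 : R) *: p.1 + Num.sqrt (1 - 0 ^+ 2) *: p.2).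
      by rewrite scale0r add0r expr0n subr0 sqrtr1 scale1r.
    rewrite (_ : (fun k => _) = (fun k => psi p.1 ^+ 2 *
        g (ck k *: p.1 + Num.sqrt (1 - ck k ^+ 2) *: p.2))); last first.
      by apply/funext => k; rewrite /z cE sE.
    apply: cvgM; first exact: cvg_cst.
    pose h (a : R) := g (a *: p.1 + Num.sqrt (1 - a ^+ 2) *: p.2).
    have ch : {for 0, continuous h}.
      apply: (@continuous_comp _ _ _ (fun a : R => a *: p.1 + Num.sqrt (1 - a ^+ 2) *: p.2) g); last first.
        by case: C1g => cg _; exact: cg.
      apply: (@continuousD _ _ _ (fun a : R => a *: p.1) (fun a : R => Num.sqrt (1 - a ^+ 2) *: p.2)).
        exact: scalel_continuous.
      apply: (@continuous_comp _ _ _ (fun a : R => Num.sqrt (1 - a ^+ 2)) (fun a : R => a *: p.2)); last exact: scalel_continuous.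
      apply: (@continuous_comp _ _ _ (fun a : R => 1 - a ^+ 2) (@Num.sqrt R)); last exact: sqrt_continuous.
      by apply: cvgB; [exact: cvg_cst|exact: exprn_continuous].
    exact: (@continuous_cvg _ _ _ _ _ ck h 0 ch ck_cvg).
  - move=> k; have [i1 h1] := admissible_mix (tk0 k).
    by rewrite -rintE// lee_fin.
  - exact: cvg_cst.
  - apply: measurable_funM; last exact: measurableT_comp mg measurable_snd.
    by apply: measurable_funX; exact: measurableT_comp mpsi measurable_fst.
have mp2 : measurable_fun setT (fun x => psi x ^+ 2) by exact: measurable_funX.
apply/(intRP gamma mp2 (fun x => sqr_ge0 _)).
have /integrableP[mFE] := iF.
apply: le_lt_trans; rewrite le_eqVlt; apply/orP; left; apply/eqP/esym.
pose Fo (p : V * V) : R := psi p.1 ^+ 2 * g p.2.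
transitivity (\int[gamma2]_p (Fo p)%:E)%E.
  by apply: eq_integral => p _ /=; rewrite ger0_norm// mulr_ge0 ?sqr_ge0.
rewrite [LHS](fubini_tonelli1 (m1 := gamma) (m2 := gamma) _ mFE); last first.
  by move=> p; rewrite lee_fin mulr_ge0 ?sqr_ge0.
apply: eq_integral => x _; rewrite /fubini_F /=.
under eq_integral do rewrite EFinM.
transitivity ((psi x ^+ 2)%:E * \int[gamma]_y (g y)%:E)%E; last first.
  by rewrite -rintE// [rint _ _]mass1 mule1.
apply: ge0_integralZl_EFin => //; last exact: sqr_ge0.
  by move=> y _; rewrite lee_fin.
exact/measurable_EFinP.
Qed.

Let ipsi2 := admissible_sqr.
Local Notation phi := (phi_of gamma psi).

(* Integrating [phi a] against [gamma], the rotation exchanging [x] and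
   [c x + s y] moves the Ornstein-Uhlenbeck average from [psi] to [a]. *)
Lemma rint_phi_weight (a : V -> R) (K : R) : measurable_fun setT a -> 0 <= K ->
  (forall t, 0 < t -> intR gamma2 (fun p => psi p.1 * a (z t p)) /\
     rint gamma2 (fun p => `|psi p.1 * a (z t p)|) <= K) ->
  intR gamma (fun x => phi x * a x) /\
  exists2 H : R -> R, intR tau H & rint gamma (fun x => phi x * a x) = rint tau H /\
    forall t, 0 < t -> H t = rint gamma2 (fun p => psi p.1 * a (z t p)).
Proof.
move=> ma K0 haK.
pose P13 : probability (V * V)%type R := gamma2.
pose P23 : probability (measurableTypeR R * V)%type R := (tau \x gamma)%E.
pose zt x (q : measurableTypeR R * V) : V := c q.1 *: x + s q.1 *: q.2.
pose h (p : V * (measurableTypeR R * V)) := psi (zt p.1 p.2) * a p.1.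
have mh : measurable_fun setT h.
  apply: measurable_funM; last exact: measurableT_comp ma measurable_fst.
  apply: (measurableT_comp mpsi).
  have m2 : measurable_fun setT (fun p : V * (measurableTypeR R * V) => p.2) by exact: measurable_snd.
  apply: measurable_rVD; apply: measurable_rVZ.
  - exact: measurableT_comp mc (measurableT_comp measurable_fst m2).
  - exact: measurable_fst.
  - exact: measurableT_comp ms (measurableT_comp measurable_fst m2).
  - exact: measurableT_comp measurable_snd m2.
pose k (q : measurableTypeR R * (V * V)) := h (q.2.1, (q.1, q.2.2)).
have mk : measurable_fun setT k.
  have m2 : measurable_fun setT (fun q : measurableTypeR R * (V * V) => q.2) by exact: measurable_snd.
  apply: (measurableT_comp mh); apply: measurable_fun_pair.
    exact: measurableT_comp measurable_fst m2.
  apply: measurable_fun_pair; first exact: measurable_fst.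
  exact: measurableT_comp measurable_snd m2.
have rotE t : 0 < t -> forall p : V * V, psi (rot (c t) (s t) p).1 *
    a (z t (rot (c t) (s t) p)) = k (t, p).
  move=> t0 [x y]; have /(congr1 fst) /= e := rotK (x, y) (cs t0).
  by rewrite /k /h /zt /z /= e.
have kt t : 0 < t -> intR gamma2 (fun p => k (t, p)) /\
    rint gamma2 (fun p => k (t, p)) = rint gamma2 (fun p => psi p.1 * a (z t p)) /\
    rint gamma2 (fun p => `|k (t, p)|) <= K.
  move=> t0; have [i1 h1] := haK t t0.
  have ir := intR_rot gaussE (s0 t0) (cs t0) i1.
  split; first by apply: eq_intR ir => p; exact: rotE.
  split.
    rewrite -(rint_rot gaussE (s0 t0) (cs t0) (intR_meas i1)).
    by apply: eq_rint => p; rewrite -rotE.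
  apply: le_trans h1; rewrite -[leRHS](rint_rot gaussE (s0 t0) (cs t0) (intR_meas (intR_abs i1))).
  by rewrite le_eqVlt; apply/orP; left; apply/eqP; apply: eq_rint => p; rewrite -rotE.
have ik : intR (tau \x P13)%E k.
  have [|||ia _] := @intR_prod_le _ _ _ _ R tau P13 (fun q => `|k q|) K K0.
  - exact: measurableT_comp.
  - by move=> q; exact: normr_ge0.
  - apply: filterS ae_exp4_gt0 => t t0; have [i1 [_ h1]] := kt t t0.
    by rewrite -(rintE (intR_abs i1)) lee_fin.
  by apply: intR_le mk _ ia.
have [ih eh] := triple_swap mh ik.
have [i1 e1] := fubini_real1 (m1 := gamma) (m2 := P23) ih.
have [i2 e2] := fubini_real1 (m1 := tau) (m2 := P13) ik.
have pE x : rint P23 (fun q => h (x, q)) = phi x * a x.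
  transitivity (rint P23 (fun q => a x * psi (zt x q))).
    by apply: eq_rint => q; rewrite mulrC.
  rewrite rintZ; first by rewrite (phi_ofE gaussE cpsi ipsi2) mulrC.
  exact: (intR_mehler_path gaussE cpsi ipsi2 x).
split; first by apply: eq_intR i1 => x; rewrite pE.
exists (fun t => rint gamma2 (fun p => k (t, p))); first exact: i2.
split; last by move=> t t0; have [_ [-> _]] := kt t t0.
by rewrite e2 -eh -e1; apply: eq_rint => x; rewrite pE.
Qed.


Let ipsi : intR gamma psi.
Proof.
apply: (@eq_intR _ _ _ _ (fun x => psi x * 1)) => [x|]; first by rewrite mulr1.
apply: intRM_sqr => //; exact: intR_cst.
Qed.

(** The case of constant weight 1: integrability includes measurability. *)
Lemma measurable_phi : measurable_fun setT phi.
Proof.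
have [|||h _] := @rint_phi_weight (fun=> 1) (rint gamma (fun x => `|psi x|)).
- exact: measurable_cst.
- by apply: rint_ge0 => x; exact: normr_ge0.
- move=> t t0; have [h1 _] := intR_prod ipsi (intR_cst gamma 1).
  split; first exact: h1.
  have [h2 e2] := intR_prod (intR_abs ipsi) (intR_cst gamma 1).
  rewrite rint_cst mulr1 in e2; rewrite -e2 le_eqVlt; apply/orP; left; apply/eqP.
  by apply: eq_rint => p; rewrite !mulr1.
have mh := intR_meas h.
have e : phi = (fun x => phi x * 1) by apply/funext => x; rewrite mulr1.
by rewrite e.
Qed.

(** A pointwise limit of difference quotients with steps 1/(k + 1). *)
Lemma measurable_dphi v : measurable_fun setT (dphi gamma psi v).
Proof.
pose D (k : nat) (x : V) := k.+1%:R * (phi (x + k.+1%:R^-1 *: v) - phi x).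
apply: (@measurable_fun_cvg _ _ _ setT D) => [k|x _].
  apply: measurable_funM => //; apply: measurable_funB; last exact: measurable_phi.
  by apply: (measurableT_comp measurable_phi); exact: measurable_shift.
have [dx <-] := is_derive_phi gaussE cpsi ipsi2 x v.
apply: (@cvg_trans _ ((fun t : R => t^-1 *: ((phi \o shift x) (t *: v) - phi x)) \o
    (fun k : nat => k.+1%:R^-1) @ \oo)).
  apply: near_eq_cvg; apply: nearW => k.
  by rewrite /D /= invrK [x + _]addrC.
apply: (@cvg_comp _ _ _ (fun k : nat => k.+1%:R^-1) _ _ (dnbhs (0 : R))); last exact: dx.
have hh : (fun k : nat => k.+1%:R^-1 : R) @ \oo --> (0 : R) by exact: cvg_harmonic.
move=> A nA.
have nA' : \forall k \near \oo, (k.+1%:R^-1 : R) != 0 -> A k.+1%:R^-1 := hh _ nA.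
by apply: filterS nA' => k; apply; rewrite invr_eq0 pnatr_eq0.
Qed.
Let iphig : intR gamma (fun x => phi x * g x).
Proof.
have [|h _] := @rint_phi_weight g 1 mg ler01; last exact: h.
move=> t t0; have [i1 h1] := admissible_mix t0.
have iz := intR_z gaussE (s0 t0) (cs t0) ig.
have mpg : measurable_fun setT (fun p : V * V => psi p.1 * g (z t p)).
  apply: measurable_funM; first exact: measurableT_comp mpsi measurable_fst.
  exact: measurableT_comp mg (mz t).
have ib : intR gamma2 (fun p => 2^-1 * (psi p.1 ^+ 2 * g (z t p) + g (z t p))).
  by apply: intRZ; exact: intRD.
have le p : `|psi p.1 * g (z t p)| <= 2^-1 * (psi p.1 ^+ 2 * g (z t p) + g (z t p)).
  rewrite normrM (ger0_norm (g0 _)) -[psi p.1 ^+ 2]real_normK ?num_real//.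
  by have := sqr_ge0 (`|psi p.1| - 1); have := g0 (z t p); nra.
have ip : intR gamma2 (fun p => psi p.1 * g (z t p)) by exact: intR_le mpg le ib.
split => //; apply: (le_trans (le_rint (intR_abs ip) ib le)).
rewrite rintZ; last exact: intRD.
rewrite rintD// (rint_z gaussE (s0 t0) (cs t0) ig) [rint gamma g]mass1; lra.
Qed.

Lemma rint_phi_dgrad v : dotv v v = 1 -> intR gamma (fun x => phi x * dotv v (grad g x)) /\
  exists2 H : R -> R, intR tau H & rint gamma (fun x => phi x * dotv v (grad g x)) = rint tau H /\
    forall t, 0 < t -> H t = rint gamma2 (fun p => psi p.1 * dotv v (grad g (z t p))).
Proof.
move=> v1; have is2 := intR_score_sqr C1g g0 v1 iI.
apply: (@rint_phi_weight _ (2^-1 * (1 + finfo gamma g v))).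
- exact: measurable_dgrad.
- by rewrite mulr_ge0// addr_ge0// rint_ge0// => x; rewrite mulr_ge0 ?sqr_ge0.
move=> t t0; have [i1 h1] := admissible_mix t0.
have ip := intR_psi_dgrad gaussE C1g g0 v1 iI (s0 t0) (cs t0) mpsi i1.
split; first exact: ip.
have iz := intR_z gaussE (s0 t0) (cs t0) is2.
have ib : intR gamma2 (fun p => 2^-1 * (psi p.1 ^+ 2 * g (z t p) + score g v (z t p) ^+ 2 * g (z t p))).
  by apply: intRZ; exact: intRD.
have le p : `|psi p.1 * dotv v (grad g (z t p))| <=
    2^-1 * (psi p.1 ^+ 2 * g (z t p) + score g v (z t p) ^+ 2 * g (z t p)).
  rewrite -(scoreM C1g g0) mulrA normrM (ger0_norm (g0 _)) normrM.
  rewrite -[psi p.1 ^+ 2]real_normK ?num_real// -[score g v _ ^+ 2]real_normK ?num_real//.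
  by have := sqr_ge0 (`|psi p.1| - `|score g v (z t p)|); have := g0 (z t p); nra.
apply: (le_trans (le_rint (intR_abs ip) ib le)).
rewrite rintZ; last exact: intRD.
rewrite rintD// (rint_z gaussE (s0 t0) (cs t0) is2) -/(finfo gamma g v).
by rewrite ler_wpM2l ?invr_ge0// lerD2r.
Qed.

(* A coordinate whose integrand is not integrable has the junk value [0]. *)
Lemma stein_vecE i : stein_vec gamma g phi 0 i =
  rint gamma (fun x => phi x * dotv (evec i) (grad g x)) \/ stein_vec gamma g phi 0 i = 0.
Proof.
pose S (x : V) := (x 0 i * phi x - dphi gamma psi (evec i) x) * g x.
have SE : stein_vec gamma g phi 0 i = rint gamma S.
  rewrite mxE; apply: eq_rint => x.
  by have [_ ->] := is_derive_phi gaussE cpsi ipsi2 x (evec i).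
have mS : measurable_fun setT S.
  apply: measurable_funM => //; apply: measurable_funB; last exact: measurable_dphi.
  by apply: measurable_funM; [exact: measurable_coord|exact: measurable_phi].
have [iS|nS] := pselect (intR gamma S); last first.
  by right; rewrite SE rint_not_integrable.
left; rewrite SE.
have [id _] := rint_phi_dgrad (dotv_evec1 i).
pose G x := phi x * g x.
pose G' x := dphi gamma psi (evec i) x * g x + phi x * dotv (evec i) (grad g x).
(* Only the whole combination [S] is known to be integrable, not its two terms; integration by parts
   requires no more. *)
have E x : G' x - dotv (evec i) x * G x = phi x * dotv (evec i) (grad g x) - S x.
  by rewrite /G' /G /S (dotv_evec i x); ring.
have h : rint gamma (fun x => G' x - dotv (evec i) x * G x) = 0.
  apply: (gauss_ibp gaussE).
  - move=> x; have d1 := is_derive_phi gaussE cpsi ipsi2 x (evec i).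
    have d2 := is_derive_C1 C1g x (evec i).
    by rewrite /G; apply: is_derive_eq; rewrite /GRing.scale/= /G'; ring.
  - move=> x; apply: contD; apply: contM.
    + exact: (@continuous_dphi _ _ _ gaussE _ cpsi ipsi2 x (evec i)).
    + by apply: continuous_on_line; case: C1g.
    + apply: derivable1_continuous => r.
      by have [] := is_derive_line (is_derive_phi gaussE cpsi ipsi2 (x + r *: evec i) (evec i)).
    + exact: (@continuous_on_line _ _ (fun w => dotv (evec i) (grad g w)) _ _
        (@continuous_dgrad _ _ _ C1g (evec i))).
  - apply: measurable_funD; apply: measurable_funM => //.
    + exact: measurable_dphi.
    + exact: measurable_phi.
    + exact: measurable_dgrad.
  - exact: iphig.
  - by apply: eq_intR (intRB id iS) => x; rewrite E.
apply/esym/eqP; rewrite -subr_eq0 -rintB//; apply/eqP.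
by rewrite -h; apply: eq_rint => x; rewrite E.
Qed.

(** The norm [nv] is the time average of [H]. Young's inequality with parameter [nv] gives nv^2 <=
    int p, and a second one with parameter nv^2 gives nv^4 <= int p^2, which [rint_exp4_rational]
    evaluates. *)
Lemma stein_bound u nv : dotv u u = 1 -> stein_vec gamma g phi = nv *: u -> 0 < nv ->
  second gamma g u <= 1 ->
  nv ^+ 4 <= 2 * (finfo gamma g u - ln (1 + finfo gamma g u)).
Proof.
move=> u1 vE nv0 second1; set j := finfo gamma g u.
have j0 : 0 <= j by apply: rint_ge0 => x; rewrite mulr_ge0 ?sqr_ge0.
have id i : intR gamma (fun x => phi x * dotv (evec i) (grad g x)).
  by have [] := rint_phi_dgrad (dotv_evec1 i).
have [iu [H iH [eH HE]]] := rint_phi_dgrad u1.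
have nvE : nv = rint tau H.
  rewrite -eH.
  have -> : nv = \sum_i u 0 i * stein_vec gamma g phi 0 i.
    rewrite -[LHS]mulr1 -u1 /dotv mulr_sumr; apply: eq_bigr => i _.
    by rewrite vE mxE; ring.
  have ex x : phi x * dotv u (grad g x) = \sum_i u 0 i * (phi x * dotv (evec i) (grad g x)).
    rewrite {1}/dotv mulr_sumr; apply: eq_bigr => i _.
    by rewrite dotv_evec; ring.
  rewrite (eq_rint _ ex) rint_sum; last by move=> i; exact: intRZ.
  apply: eq_bigr => i _; rewrite rintZ//.
  (* A coordinate with the default value 0 forces [u 0 i = 0], so its term vanishes on both
     sides. *)
  have [->//|v0] := stein_vecE i.
  have : nv * u 0 i = 0 by rewrite -v0 vE mxE.
  by move/eqP; rewrite mulf_eq0 gt_eqF//= => /eqP ->; rewrite !mul0r.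
have icst k : intR tau (fun=> k) by exact: finite_measure_integrable_cst.
have rcst k : rint tau (fun=> k) = k.
  by rewrite /rint Rintegral_cst// [X in fine X]probability_setT mulr1.
pose p (t : R) := j / (1 + (1 - expR (- (2 * t))) * j).
have [ip2 rp2] : intR tau (fun t => p t ^+ 2) /\ rint tau (fun t => p t ^+ 2) = 2 * (j - ln (1 + j)).
  exact: rint_exp4_rational j0.
have Hp t : 0 < t -> H t <= (nv + p t / nv) / 2.
  move=> t0; rewrite HE//.
  have [i1 h1] := admissible_mix t0.
  (* The minimiser of l^2 j + (1 - l)^2 / s^2, the form left by the bound [second1] on the second
     moment ([a1] and [a2]); the minimum is [p t]. *)
  pose l := (1 + s t ^+ 2 * j)^-1.
  have := psi_dgrad_le gaussE C1g g0 u1 ig iI (iG u) (s0 t0) (cs t0) mpsi i1 l nv0 h1.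
  move/le_trans; apply; rewrite ler_wpM2r ?invr_ge0// lerD2l ler_wpM2r ?invr_ge0 ?(ltW nv0)//.
  rewrite mass1 -/j.
  have sp := s0 t0; have s2 : 0 < s t ^+ 2 by rewrite exprn_gt0.
  have q0 : 0 < 1 + s t ^+ 2 * j by rewrite ltr_pwDl// mulr_ge0// ltW.
  have l0 : 0 < l by rewrite invr_gt0.
  have l1 : l <= 1 by rewrite invf_le1// lerDl mulr_ge0// ltW.
  have c2 : c t ^+ 2 = 1 - s t ^+ 2 by rewrite -(cs t0) addrK.
  have pE : p t = j / (1 + s t ^+ 2 * j).
    rewrite /p; congr (_ / (1 + _ * _)); rewrite OU_s_sqr// expr2 -expRD.
    by congr (1 - expR _); ring.
  have a1 : 2 * l * (1 - l) * (second gamma g u - 1) <= 0.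
    by rewrite mulr_ge0_le0 ?subr_le0// !mulr_ge0 ?subr_ge0// ltW.
  have a2 : (1 - l) ^+ 2 * (second gamma g u + 1 * (c t / s t) ^+ 2) <=
      (1 - l) ^+ 2 / s t ^+ 2.
    apply: ler_wpM2l; first exact: sqr_ge0.
    rewrite mul1r expr_div_n c2 mulrBl mul1r divff ?gt_eqF//; lra.
  have a3 : l ^+ 2 * j + (1 - l) ^+ 2 / s t ^+ 2 = p t.
    by rewrite pE /l; field; rewrite !gt_eqF.
  lra.
have mp : measurable_fun [set: R] p.
  apply: measurable_funM => //; apply: measurableT_comp (@measurable_invr R) _.
  apply: measurable_funD => //; apply: measurable_funM => //; apply: measurable_funB => //.
  have e : (fun t : R => expR (- (2 * t))) = (fun t => c t * c t).
    by apply/funext => t; rewrite /c -expRD; congr expR; ring.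
  by rewrite e; exact: measurable_funM.
have ip : intR tau p.
  apply: (@intR_le _ (measurableTypeR R) _ tau p _ mp _ (intRD ip2 (icst 1))) => t.
  rewrite -[p t ^+ 2]real_normK ?num_real//.
  by have := sqr_ge0 (`|p t| - 1); have := normr_ge0 (p t); nra.
have nv2 : nv ^+ 2 <= rint tau p.
  have ib : intR tau (fun t => (2 * nv)^-1 * p t) by exact: intRZ.
  have ic : intR tau (fun t => nv / 2 + (2 * nv)^-1 * p t).
    by apply: intRD => //; exact: icst.
  have := le_rint_ae iH ic.
  rewrite (rintD (icst _) ib).
  rewrite (rintZ _ ip) rcst -nvE => h.
  have {h} : nv <= nv / 2 + (2 * nv)^-1 * rint tau p.
    apply: h; apply: filterS ae_exp4_gt0 => t /Hp; move/le_trans; apply.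
    by rewrite le_eqVlt; apply/orP; left; apply/eqP; field; rewrite gt_eqF.
  rewrite -lerBlDl (_ : nv - nv / 2 = nv / 2); last by field.
  by rewrite ler_pdivlMl ?mulr_gt0// (_ : 2 * nv * (nv / 2) = nv ^+ 2)//; field.
have nv20 : 0 < nv ^+ 2 by rewrite exprn_gt0.
have : rint tau p <= 2^-1 * nv ^+ 2 + (2 * nv ^+ 2)^-1 * (2 * (j - ln (1 + j))).
  have ib : intR tau (fun t => (2 * nv ^+ 2)^-1 * p t ^+ 2) by exact: intRZ.
  have ic : intR tau (fun t => 2^-1 * nv ^+ 2 + (2 * nv ^+ 2)^-1 * p t ^+ 2).
    by apply: intRD => //; exact: icst.
  have := le_rint ip ic.
  rewrite (rintD (icst _) ib).
  rewrite (rintZ _ ip2) rcst rp2; apply => t.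
  rewrite -subr_ge0 (_ : _ - p t = (2 * nv ^+ 2)^-1 * (nv ^+ 2 - p t) ^+ 2); last first.
    by field; rewrite gt_eqF.
  by rewrite mulr_ge0 ?sqr_ge0// invr_ge0 mulr_ge0// ltW.
set P := 2 * (j - ln (1 + j)) => h.
have h2 : 2^-1 * nv ^+ 2 <= (2 * nv ^+ 2)^-1 * P by lra.
have h3 : 2 * nv ^+ 2 * (2^-1 * nv ^+ 2) <= P.
  by rewrite -ler_pdivlMl ?mulr_gt0.
by move: h3; rewrite (_ : 2 * nv ^+ 2 * _ = nv ^+ 4); last by field.
Qed.

End stein.

(** * The Stein vector against the deficit of a centred density *)

Section deficit_bound.
Context {R : realType} {n : nat} (gamma : probability 'rV[R]_n R).
Hypothesis gaussE : std_gaussian gamma.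
Local Notation V := 'rV[R]_n.

Variable g : V -> R.
Hypotheses (C1g : C1 g) (g0 : forall x, 0 <= g x).
Let nrm2 x := dotv (grad g x) (grad g x) / g x.
Hypotheses (ig : intR gamma g) (mass1 : mass gamma g = 1) (iI : intR gamma nrm2)
  (iG : forall v, intR gamma (fun x => dotv v x ^+ 2 * g x))
  (second1 : forall u, dotv u u = 1 -> second gamma g u <= 1).

Definition rdeficit := 2^-1 * rint gamma nrm2 - rint gamma (fun x => ent (g x)).

Lemma finfo_le_rdeficit u : dotv u u = 1 -> intR gamma (fun x => ent (g x)) /\
  2^-1 * (finfo gamma g u - ln (1 + finfo gamma g u)) <= rdeficit.
Proof.
move=> u1; have [ie le] := log_sobolev_improved gaussE C1g g0 u1 ig iI iG mass1 (second1 u1).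
by split => //; move: le; rewrite /rdeficit /nrm2; lra.
Qed.

Lemma rdeficit_ge0 : intR gamma (fun x => ent (g x)) /\ 0 <= rdeficit.
Proof.
(* Dimension 0 has no unit vector; there [g] is the constant 1. *)
have [n0|n0] := posnP n.
  have v0 (x : V) : x = 0 by apply/rowP => i; move: (ltn_ord i); rewrite {2}n0.
  have gE x : g x = 1.
    by rewrite -mass1 (v0 x) -[LHS](rint_cst gamma); apply: eq_rint => y; rewrite (v0 y).
  have eE x : ent (g x) = 0 by rewrite gE /ent ln1 mulr0.
  split; first by apply: eq_intR (intR_cst gamma 0) => x; rewrite eE.
  rewrite /rdeficit (eq_rint _ eE) rint_cst subr0 mulr_ge0//.
  by apply: rint_ge0 => x; rewrite mulr_ge0 ?dotv_ge0 ?invr_ge0.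
pose i := Ordinal n0.
have u1 : dotv (evec i) (evec i : V) = 1 by exact: dotv_evec1.
have [ie le] := finfo_le_rdeficit u1; split => //; apply: le_trans le.
have j0 : 0 <= finfo gamma g (evec i) by apply: rint_ge0 => x; rewrite mulr_ge0 ?sqr_ge0.
by rewrite mulr_ge0// subr_ge0 le_ln1Dx// (lt_le_trans _ j0).
Qed.

(** The unit vector is v/|v|, which depends on [psi]; both bounds hold in every direction, so they
    can be combined there. *)
Lemma stein_le_rdeficit psi : admissible gamma g psi ->
  enorm (stein_vec gamma g (phi_of gamma psi)) ^+ 4 <= 4 * rdeficit.
Proof.
move=> adm; set v := stein_vec _ _ _; pose nv := enorm v.
have [_ d0] := rdeficit_ge0.
have vv : dotv v v = nv ^+ 2 by rewrite sqr_sqrtr// dotv_ge0.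
have nv0 : 0 <= nv by exact: sqrtr_ge0.
have [nvE|nvn0] := eqVneq nv 0.
  by rewrite -/nv nvE expr0n mulr_ge0.
have nvp : 0 < nv by rewrite lt_neqAle eq_sym nvn0.
pose u := nv^-1 *: v.
have u1 : dotv u u = 1 by rewrite dotvZl dotvZr vv; field.
have vE : v = nv *: u by rewrite scalerA mulfV// scale1r.
have h := stein_bound gaussE C1g g0 ig mass1 iI iG adm u1 vE nvp (second1 u1).
have [_ le] := finfo_le_rdeficit u1.
by rewrite -/nv; lra.
Qed.

End deficit_bound.

(** * Effect of the Cameron-Martin translation on entropy, information and moments *)

Section translation.
Context {R : realType} {n : nat} (gamma : probability 'rV[R]_n R).
Hypothesis gaussE : std_gaussian gamma.
Local Notation V := 'rV[R]_n.

Lemma cm_weightK (b x : V) : cm_weight b (x - b) * cm_weight (- b) x = 1.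
Proof.
rewrite /cm_weight -expRD -[RHS]expR0 -(scaleN1r b); congr expR.
by rewrite !(dotvDl, dotvDr, dotvZl, dotvZr); field.
Qed.

Lemma intR_cameron_martin_inv (b : V) (h : V -> R) :
  intR gamma (fun x => h (x + b) * cm_weight b x) -> intR gamma h.
Proof.
move=> /(intR_cameron_martin gaussE (- b)); apply: eq_intR => x.
by rewrite subrK -mulrA cm_weightK mulr1.
Qed.

Variables (f : V -> R) (b : V).
Hypotheses (C1f : C1 f) (f0 : forall x, 0 <= f x).
Local Notation g := (fshift f b).
Local Notation w := (cm_weight b).

Lemma fshift_ge0 x : 0 <= g x. Proof. by rewrite mulr_ge0 ?expR_ge0. Qed.

Let is_derive_w (x v : V) : is_derive x v w (- dotv b v * w x).
Proof.
apply: is_derive_of_line.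
have d0 : is_derive (0 : R) 1 (fun r : R => - (dotv b (x + r *: v) + dotv b b / 2)) (- dotv b v).
  rewrite (_ : (fun _ => _) = (fun r : R => - (dotv b x + r * dotv b v + dotv b b / 2))); last first.
    by apply/funext => r; rewrite dotvDr dotvZr.
  by apply: is_derive_eq; rewrite /GRing.scale/=; ring.
have d1 := @is_derive1_comp R expR _ 0 _ _ (is_derive_expR _) d0.
by apply: (is_derive_eq d1); rewrite scale0r addr0 mulrC.
Qed.

Let is_derive_shift (x v : V) : is_derive x v (fun x => f (x + b)) (dotv v (grad f (x + b))).
Proof.
apply: is_derive_of_line.
rewrite (_ : (fun r => _) = (fun r : R => f ((x + b) + r *: v))); last first.
  by apply/funext => r; rewrite addrAC.
by apply: is_derive_line; rewrite scale0r addr0; exact: is_derive_C1.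
Qed.

Let dg x v : is_derive x v g (dotv v (grad f (x + b)) * w x - dotv b v * g x).
Proof.
have d1 := is_derive_w x v; have d2 := is_derive_shift x v.
rewrite /fshift -/(w _); apply: is_derive_eq.
by rewrite /GRing.scale/= /fshift -/(w x); ring.
Qed.

Let cw : continuous w.
Proof.
have c1 : continuous (fun x : V => 0 - (dotv b x + dotv b b / 2)).
  apply: contB; first exact: cont_cst.
  by apply: contD; [exact: continuous_dotv|exact: cont_cst].
move=> x; apply: (@continuous_comp _ _ _ (fun x : V => - (dotv b x + dotv b b / 2)) expR); last exact: continuous_expR.
by have := c1 x; under eq_fun do rewrite sub0r.
Qed.

Let cshift (a : V -> R) : continuous a -> continuous (fun x : V => a (x + b)).
Proof.
move=> ca x; apply: (@continuous_comp _ _ _ (fun x : V => x + b) a); last exact: ca.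
apply: (@continuousD _ _ _ (fun x : V => x) (fun=> b)); last exact: cst_continuous.
by move=> A.
Qed.

Lemma C1_fshift : C1 g.
Proof.
have cg : continuous g by apply: contM; [apply: cshift; case: C1f|exact: cw].
split; [exact: cg|split].
- by move=> x v; have [] := dg x v.
- move=> v; rewrite (_ : (fun _ => _) = (fun x => dotv v (grad f (x + b)) * w x - dotv b v * g x)); last first.
    by apply/funext => x; have [_ ->] := dg x v.
  apply: contB; apply: contM => //; last exact: cont_cst.
  exact: (cshift (@continuous_dgrad _ _ _ C1f v)).
Qed.

Let nrm2 (a : V -> R) x := dotv (grad a x) (grad a x) / a x.

Let nrm2_shift x : nrm2 g x =
  (nrm2 f (x + b) - 2 * dotv b (grad f (x + b)) + dotv b b * f (x + b)) * w x.
Proof.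
have wp : 0 < w x by exact: expR_gt0.
have gE : g x = f (x + b) * w x by [].
have gradE : grad g x = w x *: grad f (x + b) + (- g x) *: b.
  apply/rowP => i; rewrite [LHS]mxE; have [_ ->] := dg x (evec i).
  by rewrite !mxE (dotvC b) !dotv_evec mxE; ring.
rewrite /nrm2 gradE !(dotvDl, dotvDr, dotvZl, dotvZr) (dotvC _ b) gE.
(* At a zero of [f] the gradient vanishes as well, so both sides are 0. *)
have [fx|fx] := eqVneq (f (x + b)) 0.
  by rewrite !fx (dgrad_eq0 C1f f0 _ fx) (dgrad_eq0 C1f f0 _ fx) !(mul0r, mulr0, oppr0, addr0, invr0, subr0).
by field; rewrite fx gt_eqF.
Qed.

Let ent_shift x : ent (g x) =
  (ent (f (x + b)) - (dotv b (x + b) * f (x + b) - dotv b b / 2 * f (x + b))) * w x.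
Proof.
have wp : 0 < w x by exact: expR_gt0.
have gE : g x = f (x + b) * w x by [].
have [fx|fx] := eqVneq (f (x + b)) 0.
  by rewrite gE fx /ent !(mul0r, mulr0, subr0).
have fp : 0 < f (x + b) by rewrite lt_neqAle eq_sym fx f0.
have lnw : ln (w x) = - (dotv b x + dotv b b / 2) by rewrite /cm_weight expRK.
by rewrite /ent gE lnM ?posrE// lnw dotvDr; field.
Qed.

Hypotheses (if_ : intR gamma f) (mass1 : mass gamma f = 1)
  (ixf : forall i, intR gamma (fun x => x 0 i * f x))
  (ixxf : forall i j, intR gamma (fun x => x 0 i * x 0 j * f x))
  (bE : forall i, b 0 i = rint gamma (fun x => x 0 i * f x)).

Let mf : measurable_fun setT f. Proof. exact: measurable_C1. Qed.

Lemma intR_fshift : intR gamma g /\ mass gamma g = 1.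
Proof.
split; first exact: (intR_cameron_martin gaussE b if_).
by rewrite -mass1; exact: (rint_cameron_martin gaussE b mf).
Qed.

Let ibf : intR gamma (fun x => dotv b x * f x) /\ rint gamma (fun x => dotv b x * f x) = dotv b b.
Proof.
have e x : dotv b x * f x = \sum_i b 0 i * (x 0 i * f x).
  by rewrite /dotv mulr_suml; apply: eq_bigr => i _; rewrite mulrA.
have i1 i : intR gamma (fun x => b 0 i * (x 0 i * f x)) by exact: intRZ.
split; first by apply: eq_intR (intR_sum (index_enum 'I_n) i1) => x; rewrite e.
rewrite (eq_rint _ e) rint_sum// /dotv; apply: eq_bigr => i _.
by rewrite rintZ// -bE.
Qed.

Let centered v x : dotv v (x - b) ^+ 2 * f x =
  \sum_i \sum_j v 0 i * v 0 j * ((x 0 i - b 0 i) * (x 0 j - b 0 j) * f x).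
Proof.
rewrite expr2 /dotv mulr_suml mulr_suml; apply: eq_bigr => i _.
rewrite mulr_sumr mulr_suml; apply: eq_bigr => j _.
by rewrite !mxE; ring.
Qed.

Let icov i j : intR gamma (fun x => (x 0 i - b 0 i) * (x 0 j - b 0 j) * f x).
Proof.
apply: eq_intR (intRD (intRB (intRB (ixxf i j) (intRZ (b 0 j) (ixf i))) (intRZ (b 0 i) (ixf j)))
  (intRZ (b 0 i * b 0 j) if_)) => x; ring.
Qed.

Let icentered v : intR gamma (fun x => dotv v (x - b) ^+ 2 * f x).
Proof.
apply: eq_intR (intR_sum (index_enum 'I_n) (fun i => intR_sum (index_enum 'I_n)
  (fun j => intRZ (v 0 i * v 0 j) (icov i j)))) => x.
by rewrite centered.
Qed.

Lemma intR_second_fshift v : intR gamma (fun x => dotv v x ^+ 2 * g x) /\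
  second gamma g v = \sum_i \sum_j v 0 i * v 0 j *
    rint gamma (fun x => (x 0 i - b 0 i) * (x 0 j - b 0 j) * f x).
Proof.
have e x : dotv v ((x + b) - b) ^+ 2 * f (x + b) * w x = dotv v x ^+ 2 * g x.
  by rewrite addrK mulrA.
have ic := icentered v.
split; first by apply: eq_intR (intR_cameron_martin gaussE b ic) => x; rewrite e.
rewrite /second -(eq_rint _ e) (rint_cameron_martin gaussE b (intR_meas ic)).
rewrite (eq_rint _ (centered v)) rint_sum; last first.
  by move=> i; apply: intR_sum => j; apply: intRZ; exact: icov.
apply: eq_bigr => i _; rewrite rint_sum; last by move=> j; apply: intRZ; exact: icov.
by apply: eq_bigr => j _; rewrite rintZ.
Qed.

Hypothesis iIf : intR gamma (nrm2 f).

(** Integration by parts turns the integral of the derivative along [b] into b . barycenter =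
    |b|^2. *)
Let idgf : intR gamma (fun x => dotv b (grad f x)) /\
  rint gamma (fun x => dotv b (grad f x)) = dotv b b.
Proof.
have i1 i : intR gamma (fun x => b 0 i * dotv (evec i) (grad f x)).
  by apply: intRZ; apply: intR_dgrad => //; exact: dotv_evec1.
have id : intR gamma (fun x => dotv b (grad f x)).
  apply: eq_intR (intR_sum (index_enum 'I_n) i1) => x.
  rewrite [RHS]/dotv; apply: eq_bigr => i _; congr (_ * _).
  exact: dotv_evec.
split => //; have [ib <-] := ibf.
apply/eqP; rewrite -subr_eq0 -rintB//; apply/eqP.
apply: (@gauss_ibp _ _ _ gaussE b f (fun x => dotv b (grad f x))) => //.
- by move=> x; exact: is_derive_C1.
- move=> x; exact: (@continuous_on_line _ _ (fun w => dotv b (grad f w)) _ _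
    (@continuous_dgrad _ _ _ C1f b)).
- exact: intR_meas id.
- exact: intRB.
Qed.

(** Expanding |grad f - f b|^2 / f, the cross term gives -2 |b|^2 by [idgf] and the last one
    +|b|^2. *)
Lemma fisher_fshift : intR gamma (nrm2 g) /\
  rint gamma (nrm2 g) = rint gamma (nrm2 f) - dotv b b.
Proof.
have [id ed] := idgf.
have i1 : intR gamma (fun y => nrm2 f y - 2 * dotv b (grad f y) + dotv b b * f y).
  by apply: intRD; [apply: intRB => //|]; exact: intRZ.
split.
  by apply: eq_intR (intR_cameron_martin gaussE b i1) => x; rewrite nrm2_shift.
rewrite (eq_rint _ nrm2_shift) (rint_cameron_martin gaussE b (intR_meas i1)).
rewrite rintD; [|by apply: intRB => //; exact: intRZ|exact: intRZ].
rewrite rintB//; last exact: intRZ.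
rewrite rintZ// rintZ// ed [rint gamma f]mass1; ring.
Qed.

(** Integrability goes from [g] back to [f], because the improved logarithmic Sobolev inequality
    provides it for the centred density. *)
Lemma entropy_fshift : intR gamma (fun x => ent (g x)) -> intR gamma (fun x => ent (f x)) /\
  rint gamma (fun x => ent (g x)) = rint gamma (fun x => ent (f x)) - dotv b b / 2.
Proof.
move=> ie; have [ib eb] := ibf.
pose h y := ent (f y) - (dotv b y * f y - dotv b b / 2 * f y).
have i2 : intR gamma (fun y => dotv b y * f y - dotv b b / 2 * f y).
  by apply: intRB => //; exact: intRZ.
have ih : intR gamma h.
  by apply: (@intR_cameron_martin_inv b); apply: eq_intR ie => x; exact: ent_shift.
have ief : intR gamma (fun x => ent (f x)).
  by apply: eq_intR (intRD ih i2) => x; rewrite /h subrK.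
split => //; rewrite (eq_rint _ ent_shift) (rint_cameron_martin gaussE b (intR_meas ih)).
rewrite rintB// rintB//; last exact: intRZ.
by rewrite rintZ// eb [rint gamma f]mass1; field.
Qed.

End translation.

(* The constant [0] is an admissible test function, so the supremum is not [-oo]. *)
Lemma admissible0 (R : realType) (n : nat) (gamma : probability 'rV[R]_n R)
  (g : 'rV[R]_n -> R) : admissible gamma g (fun=> 0).
Proof.
have d0 (x v : 'rV[R]_n) : is_derive x v (fun=> (0 : R)) 0 by exact: is_derive_cst.
split; [split; [exact: cont_cst|split]|].
- by move=> x v; have [] := d0 x v.
- move=> v; rewrite (_ : (fun _ => _) = (fun=> 0)); first exact: cont_cst.
  by apply/funext => x; have [_ ->] := d0 x v.
- move=> t t0; rewrite integral0_eq// => x _.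
  by rewrite expr0n mul0r.
Qed.


Theorem theorem4p1 (R : realType) (n : nat) (gamma : probability 'rV[R]_n R)
    (f : 'rV[R]_n -> R) (b : 'rV[R]_n) (Gamma : 'M[R]_n) :
  std_gaussian gamma ->
  smooth f ->
  (forall x, 0 <= f x) ->
  (\int[gamma]_x (f x)%:E = 1)%E ->
  (* mu = f dgamma has finite first and second moments *)
  (forall i, gamma.-integrable setT (fun x => (x 0 i * f x)%:E)) ->
  (forall i j, gamma.-integrable setT (fun x => (x 0 i * x 0 j * f x)%:E)) ->
  (* barycenter b *)
  (forall i, b 0 i = Rintegral gamma setT (fun x => x 0 i * f x)) ->
  (* covariance matrix Gamma *)
  (forall i j, Gamma i j = Rintegral gamma setT
     (fun x => (x 0 i - b 0 i) * (x 0 j - b 0 j) * f x)) ->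
  loewner_le Gamma 1%:M ->
  ((4^-1)%:E * Dtilde gamma (fshift f b) ^+ 4 <= deficit gamma f)%E.
Proof.
move=> gaussE smf f0 f1 ixf ixxf bE GE GI.
have C1f := smooth_C1 smf; have mf := measurable_C1 C1f.
have if_ : intR gamma f by apply/(intRP gamma mf f0); rewrite f1 ltry.
have mass1 : mass gamma f = 1 by rewrite /mass /rint /Rintegral f1.
(* Infinite Fisher information makes the deficit [+oo] by definition; below it is finite. *)
rewrite /deficit; case: ifPn => [_|finf]; first exact: leey.
pose nrm2 (a : 'rV[R]_n -> R) x := dotv (grad a x) (grad a x) / a x.
have nrm2_ge0 x : 0 <= nrm2 f x by rewrite mulr_ge0 ?dotv_ge0 ?invr_ge0.
have mgrad i : measurable_fun setT (fun x => grad f x 0 i).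
  rewrite (_ : (fun _ => _) = (fun x => dotv (evec i) (grad f x))); first exact: measurable_dgrad.
  by apply/funext => x; rewrite dotv_evec.
have mn : measurable_fun setT (nrm2 f).
  apply: measurable_funM; last exact: measurableT_comp (@measurable_invr R) mf.
  by apply: measurable_dotv; apply: measurable_rVP.
have iIf : intR gamma (nrm2 f).
  by apply/(intRP gamma mn nrm2_ge0); rewrite ltey.
have C1s := C1_fshift b C1f; have s0 := fshift_ge0 b f0.
have [is1 ms1] := intR_fshift gaussE b C1f if_ mass1.
have [iIs eI] := fisher_fshift gaussE C1f f0 if_ mass1 ixf bE iIf.
have iGs v := proj1 (intR_second_fshift gaussE b if_ ixf ixxf v).
have second_le u : dotv u u = 1 -> second gamma (fshift f b) u <= 1.
  move=> u1; have [_ ->] := intR_second_fshift gaussE b if_ ixf ixxf u.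
  have := GI u; rewrite mulmx1 !mxE.
  have -> : \sum_k u 0 k * u^T k 0 = 1.
    by rewrite -u1 /dotv; apply: eq_bigr => k _; rewrite mxE.
  apply: le_trans; rewrite le_eqVlt; apply/orP; left; apply/eqP.
  rewrite exchange_big; apply: eq_bigr => k _ /=; rewrite !mxE mulr_suml.
  by apply: eq_bigr => i _; rewrite GE mulrAC.
have [ies d0] := rdeficit_ge0 gaussE C1s s0 is1 ms1 iIs iGs second_le.
have [ief eH] := entropy_fshift gaussE f0 if_ mass1 ixf bE ies.
have dE : ((2^-1)%:E * fisher gamma f - entropy gamma f)%E =
    (2^-1 * rint gamma (nrm2 f) - rint gamma (fun x => ent (f x)))%:E.
  by rewrite EFinB EFinM !rintE.
(* The losses |b|^2 / 2 in half the information and in the entropy cancel. *)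
have dle : rdeficit gamma (fshift f b) <=
    2^-1 * rint gamma (nrm2 f) - rint gamma (fun x => ent (f x)).
  by rewrite /rdeficit eI eH; lra.
rewrite dE; set r := Num.sqrt (Num.sqrt (4 * rdeficit gamma (fshift f b))).
have r4 : r ^+ 4 = 4 * rdeficit gamma (fshift f b).
  by rewrite (exprM _ 2 2) !sqr_sqrtr ?sqrtr_ge0// mulr_ge0.
have Dr : (Dtilde gamma (fshift f b) <= r%:E)%E.
  apply: ge_ereal_sup => _ [psi adm <-]; rewrite lee_fin.
  have := stein_le_rdeficit gaussE C1s s0 is1 ms1 iIs iGs second_le adm.
  by rewrite -r4 ler_pXn2r ?nnegrE ?sqrtr_ge0.
(* With the upper bound [Dr], this makes the supremum finite, so its fourth power can be taken among
   the reals. *)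
have D0 : (0 <= Dtilde gamma (fshift f b))%E.
  apply: (@le_trans _ _ (enorm (stein_vec gamma (fshift f b) (phi_of gamma (fun=> 0))))%:E).
    by rewrite lee_fin sqrtr_ge0.
  by apply: ereal_sup_ubound; exists (fun=> 0) => //; exact: admissible0.
have Dfin : Dtilde gamma (fshift f b) \is a fin_num.
  by rewrite ge0_fin_numE// (le_lt_trans Dr)// ltry.
rewrite -(fineK Dfin) in Dr D0 *; move: (fine _) Dr D0 => D; rewrite !lee_fin => Dr D0.
apply: le_trans dle.
have : D ^+ 4 <= r ^+ 4 by rewrite ler_pXn2r ?nnegrE ?sqrtr_ge0.
by rewrite r4 (_ : D * (D * (D * D)) = D ^+ 4); [lra|ring].
Qed.
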